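(* The group scheme $\underline{G}$ is smooth over $A$, and $\underline{G}(R)=\mathrm{Aut}_R(L\otimes_A R,\,q\otimes_A R)$ for every étale $A$-algebra $R$.
   Context: Let $F$ be a finite unramified extension of $\mathbb{Q}_2$, $A$ its ring of integers (so $2$ is a uniformizer) and $\kappa=A/2A$. Let $L$ be a free $A$-module of rank $n$ with a quadratic form $q:L\to A$, and $\langle x,y\rangle=\frac12(q(x+y)-q(x)-q(y))$, so $\langle x,x\rangle=q(x)$. Assume $\langle-,-\rangle$ is nondegenerate on $V=L\otimes_AF$ and $\langle L,L\rangle\subseteq A$. For a lattice $M\subset V$ put $M^{\perp}=\{x\in V:\langle x,M\rangle\subseteq A\}$. Lattices: for each integer $i\ge 0$ let $A_i=\{x\in L:\langle x,L\rangle\subseteq 2^iA\}$. On the $\kappa$-space $A_i/2A_i$ let $b_i$ be the symmetric bilinear form $2^{-i}\langle-,-\rangle \bmod 2$. Let $X_i\supseteq 2A_i$ be the lattice with $X_i/2A_i$ the radical of $b_i$, and $B_i$ the lattice with $B_i/2A_i$ the kernel of the additive map $x\mapsto 2^{-i}q(x)\bmod 2$. On $A_i/X_i$ there is a unique vector $e$ with $b_i(v,e)^2=2^{-i}q(v)\bmod 2$ for all $v$ (so $e=0$ iff $B_i=A_i$); let $W_i$ be the preimage of $\kappa e$ in $A_i$. Let $Y_i$ be the lattice with $Y_i/2A_i$ the radical of $b_i$ restricted to $B_i/2A_i$, and $Z_i$ the lattice with $Z_i/2A_i=\{x\in Y_i/2A_i:2^{-i-1}q(x)\equiv 0\bmod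 2\}$ (the kernel of the quadratic form $2^{-i-1}q\bmod 2$ on $B_i/2A_i$). Group schemes: for a flat $A$-algebra $R$ and lattice $M\subset V$ write $M_R=M\otimes_AR\subset V\otimes_AR$. Let $\underline{M}$ be the functor on flat $A$-algebras with $\underline{M}(R)$ the set of $m\in\mathrm{End}_R(L_R)$ such that for all $i$: $m$ maps each of $(A_i)_R,(B_i)_R,(W_i)_R,(X_i)_R,(Y_i)_R,(Z_i)_R$ into itself, and $m-1$ maps $(A_i)_R$ into $(B_i)_R$, $(W_i)_R$ into $(X_i\cap Z_i)_R$, and $((X_i\cap Z_i)^\perp)_R$ into $(W_i^\perp)_R$. It is represented by an affine space over $A$ (a monoid scheme) with coordinate ring $A(\underline M)$. Let $\underline{M}^{*}=\mathrm{Spec}\,A(\underline M)_{\det}$, an open subgroup scheme, and let $\underline{G}$ be the stabilizer of $q$ in $\underline M^{*}$, i.e. the closed subgroup scheme with $\underline G(R)=\{m\in\underline M^*(R): q\circ m=q\}$. *)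

(* Defs.v *)
From HB Require Import structures.
From mathcomp Require Import all_boot all_order all_algebra.
From mathcomp Require Import fieldext boolp classical_sets ring.
From mathcomp Require Import mpoly.

Set Implicit Arguments.
Unset Strict Implicit.
Unset Printing Implicit Defensive.

Import GRing.Theory.
Local Open Scope ring_scope.
Local Open Scope quotient_scope.
Local Open Scope classical_set_scope.

(* The rings below are comPzRingType's, so that the zero ring is an algebra. *)

(* The localization R[1/s]; the pair (r, k) stands for r / s ^+ k. *)
Module Loc.
Section Loc.
Variables (R : comPzRingType) (s : R).

Definition equiv (x y : R * nat) : bool :=
  `[< exists N, s ^+ N * (s ^+ y.2 * x.1) = s ^+ N * (s ^+ x.2 * y.1) >].

Lemma equiv_refl : reflexive equiv.
Proof. by move=> x; apply/asboolP; exists 0%N. Qed.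

Lemma equiv_sym : ssrbool.symmetric equiv.
Proof. by move=> x y; apply/asboolP/asboolP => -[N e]; exists N. Qed.

Lemma equiv_trans : transitive equiv.
Proof.
move=> y x z /asboolP[N1 e1] /asboolP[N2 e2]; apply/asboolP.
exists (N1 + N2 + y.2)%N; rewrite !exprD.
transitivity (s ^+ N2 * s ^+ z.2 * (s ^+ N1 * (s ^+ y.2 * x.1))); first by ring.
transitivity (s ^+ N1 * s ^+ x.2 * (s ^+ N2 * (s ^+ z.2 * y.1))).
  by rewrite e1; ring.
by rewrite e2; ring.
Qed.

Canonical equiv_equiv := EquivRel equiv equiv_refl equiv_sym equiv_trans.

Definition type := {eq_quot equiv}.
HB.instance Definition _ : EqQuotient _ equiv type := EqQuotient.on type.
HB.instance Definition _ := Choice.on type.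

(* r / s ^+ k *)
Definition frac (r : R) (k : nat) : type := \pi_type (r, k).

Lemma fracP (r t : R) k l :
  frac r k = frac t l <->
  exists N, s ^+ N * (s ^+ l * r) = s ^+ N * (s ^+ k * t).
Proof. by split=> [/eqmodP/asboolP|e]; [|apply/eqmodP/asboolP]. Qed.

Lemma fracW (P : type -> Prop) : (forall r k, P (frac r k)) -> forall x : type, P x.
Proof. by move=> h x; rewrite -(reprK x); case: (repr x) => r k; apply: h. Qed.

Definition num (x : type) : R := (repr x).1.
Definition den (x : type) : nat := (repr x).2.

Lemma numdenK (x : type) : frac (num x) (den x) = x.
Proof. by rewrite /frac /num /den -surjective_pairing reprK. Qed.

Definition add (x y : type) : type :=
  frac (s ^+ den y * num x + s ^+ den x * num y) (den x + den y).
Definition mul (x y : type) : type := frac (num x * num y) (den x + den y).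
Definition opp (x : type) : type := frac (- num x) (den x).

Lemma addE r k t l :
  add (frac r k) (frac t l) = frac (s ^+ l * r + s ^+ k * t) (k + l).
Proof.
have /fracP[N1 e1] := numdenK (frac r k).
have /fracP[N2 e2] := numdenK (frac t l).
apply/fracP; exists (N1 + N2)%N; rewrite !exprD.
set r' := num (frac r k) in e1 *; set k' := den (frac r k) in e1 *.
set t' := num (frac t l) in e2 *; set l' := den (frac t l) in e2 *.
clearbody r' k' t' l'.
transitivity (s ^+ N2 * s ^+ l * s ^+ l' * (s ^+ N1 * (s ^+ k * r')) +
  s ^+ N1 * s ^+ k * s ^+ k' * (s ^+ N2 * (s ^+ l * t'))); first by ring.
by rewrite e1 e2; ring.
Qed.

Lemma mulE r k t l : mul (frac r k) (frac t l) = frac (r * t) (k + l).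
Proof.
have /fracP[N1 e1] := numdenK (frac r k).
have /fracP[N2 e2] := numdenK (frac t l).
apply/fracP; exists (N1 + N2)%N; rewrite !exprD.
set r' := num (frac r k) in e1 *; set k' := den (frac r k) in e1 *.
set t' := num (frac t l) in e2 *; set l' := den (frac t l) in e2 *.
clearbody r' k' t' l'.
transitivity ((s ^+ N1 * (s ^+ k * r')) * (s ^+ N2 * (s ^+ l * t'))).
  by ring.
by rewrite e1 e2; ring.
Qed.

Lemma oppE r k : opp (frac r k) = frac (- r) k.
Proof.
have /fracP[N e] := numdenK (frac r k).
by apply/fracP; exists N; rewrite !mulrN e.
Qed.

Lemma addA : associative add.
Proof.
elim/fracW=> a i; elim/fracW=> b j; elim/fracW=> c k; rewrite !addE.
by apply/fracP; exists 0%N; rewrite !exprD; ring.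
Qed.

Lemma addC : commutative add.
Proof.
elim/fracW=> a i; elim/fracW=> b j; rewrite !addE.
by apply/fracP; exists 0%N; rewrite !exprD; ring.
Qed.

Lemma add0x : left_id (frac 0 0) add.
Proof.
by elim/fracW=> a i; rewrite !addE; apply/fracP; exists 0%N; rewrite !exprD; ring.
Qed.

Lemma addNx : left_inverse (frac 0 0) opp add.
Proof.
elim/fracW=> a i; rewrite oppE !addE.
by apply/fracP; exists 0%N; rewrite !exprD; ring.
Qed.

HB.instance Definition _ := GRing.isZmodule.Build type addA addC add0x addNx.

Lemma mulA : associative mul.
Proof.
elim/fracW=> a i; elim/fracW=> b j; elim/fracW=> c k; rewrite !mulE.
by apply/fracP; exists 0%N; rewrite !exprD; ring.
Qed.

Lemma mulC : commutative mul.
Proof.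
elim/fracW=> a i; elim/fracW=> b j; rewrite !mulE.
by apply/fracP; exists 0%N; rewrite !exprD; ring.
Qed.

Lemma mul1x : left_id (frac 1 0) mul.
Proof.
by elim/fracW=> a i; rewrite !mulE; apply/fracP; exists 0%N; rewrite !exprD; ring.
Qed.

Lemma mulDx : left_distributive mul add.
Proof.
elim/fracW=> a i; elim/fracW=> b j; elim/fracW=> c k; rewrite !(addE, mulE).
by apply/fracP; exists 0%N; rewrite !exprD; ring.
Qed.

HB.instance Definition _ :=
  GRing.Zmodule_isComPzRing.Build type mulA mulC mul1x mulDx.

Definition inj (r : R) : type := frac r 0.

Lemma inj_zmod_morphism : zmod_morphism inj.
Proof.
move=> a b; rewrite -[RHS]/(add _ (opp _)) /inj oppE addE.
by apply/fracP; exists 0%N; rewrite !exprD; ring.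
Qed.

Lemma inj_monoid_morphism : monoid_morphism inj.
Proof. by split=> // a b; rewrite -[RHS]/(mul _ _) /inj mulE. Qed.

HB.instance Definition _ := GRing.isZmodMorphism.Build R type inj
  inj_zmod_morphism.
HB.instance Definition _ := GRing.isMonoidMorphism.Build R type inj
  inj_monoid_morphism.

End Loc.
End Loc.
HB.export Loc.

Notation loc := Loc.type.
Notation loc_frac := Loc.frac.
Notation to_loc := Loc.inj.

Section Algebras.
Variable A : comNzRingType.

Record algebra := Algebra {
  alg_ring :> comPzRingType;
  alg_map : {rmorphism A -> alg_ring} }.

Record alghom (R S : algebra) := AlgHom {
  alghom_map :> {rmorphism R -> S};
  alghomP : forall a, alghom_map (alg_map R a) = alg_map S a }.

Definition loc_alg (R : algebra) (s : R) : algebra :=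
  Algebra (to_loc s \o alg_map R).

Definition mpoly_alg (k : nat) : algebra := Algebra (@mpoly.mpolyC k A).

(* The equational criterion: every A-linear relation in R is a consequence of
   relations in A. *)
Definition flat (R : algebra) : Prop :=
  forall k (a : 'rV[A]_k) (r : 'cV[R]_k), map_mx (alg_map R) a *m r = 0 ->
  exists l (c : 'M[A]_(k, l)) (t : 'cV[R]_l),
    r = map_mx (alg_map R) c *m t /\ a *m c = 0.

Definition finitely_presented (R : algebra) : Prop :=
  exists k (f : alghom (mpoly_alg k) R) l (g : 'I_l -> mpoly_alg k),
    (forall r, exists p, f p = r) /\
    (forall p, f p = 0 <-> exists c : 'I_l -> mpoly_alg k,
       p = \sum_(j < l) c j * g j).

(* p : T -> T' is the quotient of T by an ideal of square zero. *)
Definition square_zero_ext (T T' : algebra) (p : alghom T T') : Prop :=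
  (forall y, exists x, p x = y) /\
  (forall x y, p x = 0 -> p y = 0 -> x * y = 0).

Definition formally_smooth (R : algebra) : Prop :=
  forall (T T' : algebra) (p : alghom T T') (f : alghom R T'),
    square_zero_ext p -> exists g : alghom R T, p \o g =1 f.

Definition formally_unramified (R : algebra) : Prop :=
  forall (T T' : algebra) (p : alghom T T') (g h : alghom R T),
    square_zero_ext p -> p \o g =1 p \o h -> g =1 h.

Definition smooth (R : algebra) : Prop :=
  finitely_presented R /\ formally_smooth R.

Definition etale (R : algebra) : Prop :=
  [/\ flat R, finitely_presented R & formally_unramified R].

End Algebras.

(* Z2 is the inverse limit of the rings Z/2^(k+1)Z. *)
Definition dyadic_integers (Z2 : comNzRingType)
    (res : forall k, {rmorphism Z2 -> 'Z_(2 ^ k.+1)%N}) : Prop :=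
  let compatible (a : forall k, 'Z_(2 ^ k.+1)%N) :=
    forall k, ((a k.+1 : nat) = (a k : nat) %[mod 2 ^ k.+1])%N in
  (forall z, compatible (fun k => res k z)) /\
  (forall a, compatible a ->
     exists z, (forall k, res k z = a k) /\
               (forall z', (forall k, res k z' = a k) -> z' = z)).

(* iota identifies A with the integral closure of Z2 in F. *)
Definition ring_of_integers (Z2 : idomainType)
    (F : fieldExtType {fraction Z2}) (A : idomainType)
    (iota : {rmorphism A -> F}) : Prop :=
  injective iota /\
  (forall x : F, integralOver (fun z : Z2 => GRing.in_alg F (FracField.tofrac z)) x <->
                 exists a, x = iota a).

(* 2 generates the maximal ideal of A; the residue field being finite, its
   extension over F_2 is automatically separable. *)
Definition unramified2 (A : idomainType) : Prop :=
  forall a : A, a \isn't a GRing.unit <-> exists b, a = 2%:R * b.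

Section Lattice.
Variables (F : fieldType) (A : idomainType) (iota : {rmorphism A -> F}).
Variables (n : nat) (q : 'cV[A]_n -> A).

Definition polar (x y : 'cV[A]_n) : A := q (x + y) - q x - q y.

Definition quadratic_form : Prop :=
  (forall a x, q (a *: x) = a ^+ 2 * q x) /\
  (forall a x y z, polar (a *: x + y) z = a * polar x z + polar y z).

Definition std_basis (i : 'I_n) : 'cV[A]_n := delta_mx i 0.

Definition gram : 'M[F]_n :=
  \matrix_(i, j) (iota (polar (std_basis i) (std_basis j)) / 2%:R).

(* < x , y > on V = F^n; L is the lattice of vectors with entries in A. *)
Definition bform (x y : 'cV[F]_n) : F := (x^T *m gram *m y) 0 0.

Definition qform (x : 'cV[F]_n) : F := bform x x.

Definition nondegenerate_form : Prop :=
  forall x, (forall y, bform x y = 0) -> x = 0.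

(* 2^i A *)
Definition pow2A (i : nat) : set F := [set c | exists a, c = 2%:R ^+ i * iota a].

Definition lat_L : set 'cV[F]_n := [set x | exists y, x = map_mx iota y].

Definition integral_form : Prop :=
  forall x y, lat_L x -> lat_L y -> pow2A 0 (bform x y).

Definition dual (M : set 'cV[F]_n) : set 'cV[F]_n :=
  [set x | forall y, M y -> pow2A 0 (bform x y)].

Definition lat_A i : set 'cV[F]_n :=
  [set x | lat_L x /\ forall y, lat_L y -> pow2A i (bform x y)].

Definition lat_X i : set 'cV[F]_n :=
  [set x | lat_A i x /\ forall y, lat_A i y -> pow2A i.+1 (bform x y)].

Definition lat_B i : set 'cV[F]_n :=
  [set x | lat_A i x /\ pow2A i.+1 (qform x)].

(* e lifts the vector of A_i / X_i with b_i(v, e)^2 = 2^-i q(v) mod 2. *)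
Definition characteristic_vector i (e : 'cV[F]_n) : Prop :=
  lat_A i e /\ forall v, lat_A i v ->
    pow2A 1 ((bform v e / 2%:R ^+ i) ^+ 2 - qform v / 2%:R ^+ i).

Definition lat_W i : set 'cV[F]_n :=
  [set x | lat_A i x /\ exists e a, characteristic_vector i e /\
                                    lat_X i (x - iota a *: e)].

Definition lat_Y i : set 'cV[F]_n :=
  [set x | lat_B i x /\ forall y, lat_B i y -> pow2A i.+1 (bform x y)].

Definition lat_Z i : set 'cV[F]_n :=
  [set x | lat_Y i x /\ pow2A i.+2 (qform x)].

Section BaseChange.
Variable R : algebra A.

(* The base change of V to R is R[1/2]^n, as F = A[1/2]; v is the image of x. *)
Definition base_vec (x : 'cV[F]_n) (v : 'cV[loc (2%:R : R)]_n) : Prop :=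
  exists k (y : 'cV[A]_n), 2%:R ^+ k *: x = map_mx iota y /\
    v = loc_frac 2%:R 1 k *: map_mx (to_loc 2%:R \o alg_map R) y.

(* M_R : the R-span of M in V_R. *)
Definition base_lat (M : set 'cV[F]_n) : set 'cV[loc (2%:R : R)]_n :=
  [set v | exists k (c : 'I_k -> R) (x : 'I_k -> 'cV[F]_n)
             (w : 'I_k -> 'cV[loc (2%:R : R)]_n),
     (forall j, M (x j) /\ base_vec (x j) (w j)) /\
     v = \sum_(j < k) to_loc 2%:R (c j) *: w j].

Definition maps_lat (m : 'M[R]_n) (M N : set 'cV[F]_n) : Prop :=
  forall v, base_lat M v -> base_lat N (map_mx (to_loc 2%:R) m *m v).

Definition monoid_pts : set 'M[R]_n :=
  [set m | forall i,
    [/\ maps_lat m (lat_A i) (lat_A i), maps_lat m (lat_B i) (lat_B i),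
        maps_lat m (lat_W i) (lat_W i), maps_lat m (lat_X i) (lat_X i) &
        maps_lat m (lat_Y i) (lat_Y i) /\ maps_lat m (lat_Z i) (lat_Z i)] /\
    [/\ maps_lat (m - 1%:M) (lat_A i) (lat_B i),
        maps_lat (m - 1%:M) (lat_W i) (lat_X i `&` lat_Z i) &
        maps_lat (m - 1%:M) (dual (lat_X i `&` lat_Z i)) (dual (lat_W i))]].

Definition base_q (x : 'cV[R]_n) : R :=
  \sum_(i < n) alg_map R (q (std_basis i)) * x i 0 ^+ 2 +
  \sum_(i < n) \sum_(j < n | (i < j)%N)
     alg_map R (polar (std_basis i) (std_basis j)) * x i 0 * x j 0.

Definition preserves_q (m : 'M[R]_n) : Prop :=
  forall x : 'cV[R]_n, base_q (m *m x) = base_q x.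

Definition isometries : set 'M[R]_n :=
  [set m | (exists m', m *m m' = 1%:M /\ m' *m m = 1%:M) /\ preserves_q m].

End BaseChange.

(* Spec AM, with universal point uM, is the flat A-scheme with the given
   functor of points on flat algebras. *)
Definition represents_monoid (AM : algebra A) (uM : 'M[AM]_n) : Prop :=
  flat AM /\
  forall R : algebra A, flat R ->
    (forall f : alghom AM R, monoid_pts (map_mx f uM)) /\
    (forall m : 'M[R]_n, monoid_pts m ->
       exists f : alghom AM R, map_mx f uM = m /\
         forall g : alghom AM R, map_mx g uM = m -> g =1 f).

(* M* = Spec AM_det, and G = Spec AG is the closed subscheme of M*, flat over A,
   whose points in a flat A-algebra are the points of M* preserving q.  All the
   functors are only defined on flat algebras: imposing q o m = q on the points
   of M* in every algebra would give another scheme, in general not flat. *)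
Record stabilizer_scheme := StabilizerScheme {
  AM : algebra A;
  uM : 'M[AM]_n;
  AM_represents : represents_monoid uM;
  AG : algebra A;
  res_G : alghom (loc_alg (\det uM)) AG;
  res_G_surj : forall y, exists x, res_G x = y;
  AG_flat : flat AG;
  AG_pts : forall R : algebra A, flat R ->
    forall f : alghom (loc_alg (\det uM)) R,
      (exists g : alghom AG R, g \o res_G =1 f) <->
      preserves_q (map_mx (f \o to_loc (\det uM)) uM) }.

(* G(R), as a set of endomorphisms of L_R *)
Definition stabilizer_pts (G : stabilizer_scheme) (R : algebra A) :
    set 'M[R]_n :=
  [set m | exists g : alghom (AG G) R,
     m = map_mx (g \o (res_G G \o to_loc (\det (uM G)))) (uM G)].

End Lattice.

Arguments isometries [A n] q R.
Arguments stabilizer_pts [F A iota n q] G R.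

(* Main.v *)
(* In a basis of L adapted to a Jordan splitting of q and to the characteristic
   vectors of its blocks, let B be the Gram matrix, with unit part U and scale
   exponents w.  The conditions defining M say that B (m - 1) has its (a, b)
   entry divisible by 2 ^ theta(a, b), for an explicit symmetric theta, so M is
   the affine space of the coordinates y with B (m - 1) = (2 ^ theta y).  In
   these coordinates m preserves q when y + y^T + y^T * y = 0 for the monoid law
   y * z; the left side is symmetric with diagonal divisible by 2, and dividing
   the diagonal by 2 gives the equations of G.

   Their scheme is formally smooth: if y solves them modulo an ideal of square
   zero, then 1 + y is invertible modulo the ideal, with inverse 1 + y^T, which
   makes the linearized equations solvable.  Formal smoothness over A, together
   with an argument of Artin-Rees type, shows that the scheme is 2-torsion free,
   hence flat, so it is G.

   If R is etale, then R / 2 R is reduced, because its Frobenius endomorphism is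
   surjective.  An isometry of L_R preserves the lattices A_i, and the reducedness
   of R / 2 R turns the congruences modulo 2 between squares that it satisfies
   into the divisibility by 2 ^ theta. *)
From HB Require Import structures.
Require Import Defs.
From mathcomp Require Import all_boot all_order all_algebra.
From mathcomp Require Import fingroup perm generic_quotient.
From mathcomp Require Import fieldext boolp classical_sets ring mpoly zify.

Set Implicit Arguments.
Unset Strict Implicit.
Unset Printing Implicit Defensive.

Import GRing.Theory.
Local Open Scope ring_scope.
Local Open Scope quotient_scope.

(** * Quotients and noetherian rings *)

(** The exponents [theta] combine three sources. The conditions on [A_i], for m - 1 and its adjoint,
    give the larger of the two scales. The characteristic vectors, through [B_i] and [W_i], add 1
    inside a block. The condition on [Z_i] bounds only twice the entry for block i - 1 plus the
    entry for block i + 1; an induction on i separates the two, which adds 1 between characteristic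
    vectors of consecutive blocks. The diagonal equations can be halved because the coefficient of
    each y_ca ^ 2 in (y^T * y)_aa is even: it is a power of 2 times the diagonal entry at c of V =
    U^-1. That entry is even unless c indexes a characteristic vector, and for such c the power of 2
    is positive. G is known only through its points in flat algebras. As its algebra and that of the
    explicit model are both flat, each can be tested on the other, and their universal points give
    inverse isomorphisms. Reducedness of R / 2 R rests on A / 2 A being perfect, which comes from
    the finite order of units modulo 2. *)

Module Quot.
Section Quot.
Variables (R : comPzRingType) (J : R -> Prop).

Definition ideal := [/\ J 0, forall x y, J x -> J y -> J (x + y) &
  forall a x, J x -> J (a * x)].

Hypothesis HJ : ideal.

Let J0 : J 0. Proof. by case: HJ. Qed.
Let JD x y : J x -> J y -> J (x + y). Proof. by case: HJ => _ h _; apply: h. Qed.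
Let JM a x : J x -> J (a * x). Proof. by case: HJ => _ _ h; apply: h. Qed.
Let JN x : J x -> J (- x). Proof. by rewrite -mulN1r; apply: JM. Qed.

Definition equiv (x y : R) : bool := `[< J (x - y) >].

Lemma equiv_refl : reflexive equiv.
Proof. by move=> x; apply/asboolP; rewrite subrr. Qed.

Lemma equiv_sym : ssrbool.symmetric equiv.
Proof.
by move=> x y; apply/asboolP/asboolP => /JN; rewrite opprB.
Qed.

Lemma equiv_trans : transitive equiv.
Proof.
move=> y x z /asboolP h1 /asboolP h2; apply/asboolP.
by have := JD h1 h2; rewrite addrA subrK.
Qed.

Canonical equiv_equiv := EquivRel equiv equiv_refl equiv_sym equiv_trans.

Definition type := {eq_quot equiv_equiv}.
HB.instance Definition _ : EqQuotient _ equiv_equiv type := EqQuotient.on type.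
HB.instance Definition _ := Choice.on type.

Definition cls (r : R) : type := \pi_type r.

Lemma clsP r s : cls r = cls s <-> J (r - s).
Proof. by split=> [/eqmodP/asboolP|e]; [|apply/eqmodP/asboolP]. Qed.

Lemma clsW (P : type -> Prop) : (forall r, P (cls r)) -> forall x, P x.
Proof. by move=> h x; rewrite -(reprK x); apply: h. Qed.

Definition add (x y : type) := cls (repr x + repr y).
Definition mul (x y : type) := cls (repr x * repr y).
Definition opp (x : type) := cls (- repr x).

Lemma reprJ r : J (repr (cls r) - r).
Proof. by apply/clsP; rewrite /cls reprK. Qed.

Lemma addE r s : add (cls r) (cls s) = cls (r + s).
Proof.
apply/clsP; rewrite (_ : _ - _ = (repr (cls r) - r) + (repr (cls s) - s)).
  by apply: JD; apply: reprJ.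
by ring.
Qed.

Lemma mulE r s : mul (cls r) (cls s) = cls (r * s).
Proof.
apply/clsP; rewrite (_ : _ - _ = repr (cls s) * (repr (cls r) - r)
   + r * (repr (cls s) - s)).
  by apply: JD; apply: JM; apply: reprJ.
by ring.
Qed.

Lemma oppE r : opp (cls r) = cls (- r).
Proof.
by apply/clsP; rewrite -opprD; apply/JN/reprJ.
Qed.

Lemma addA : associative add.
Proof. by elim/clsW=> a; elim/clsW=> b; elim/clsW=> c; rewrite !addE addrA. Qed.
Lemma addC : commutative add.
Proof. by elim/clsW=> a; elim/clsW=> b; rewrite !addE addrC. Qed.
Lemma add0x : left_id (cls 0) add.
Proof. by elim/clsW=> a; rewrite addE add0r. Qed.
Lemma addNx : left_inverse (cls 0) opp add.
Proof. by elim/clsW=> a; rewrite oppE addE addNr. Qed.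

HB.instance Definition _ := GRing.isZmodule.Build type addA addC add0x addNx.

Lemma mulA : associative mul.
Proof. by elim/clsW=> a; elim/clsW=> b; elim/clsW=> c; rewrite !mulE mulrA. Qed.
Lemma mulC : commutative mul.
Proof. by elim/clsW=> a; elim/clsW=> b; rewrite !mulE mulrC. Qed.
Lemma mul1x : left_id (cls 1) mul.
Proof. by elim/clsW=> a; rewrite mulE mul1r. Qed.
Lemma mulDx : left_distributive mul add.
Proof.
by elim/clsW=> a; elim/clsW=> b; elim/clsW=> c; rewrite !(addE, mulE) mulrDl.
Qed.

HB.instance Definition _ :=
  GRing.Zmodule_isComPzRing.Build type mulA mulC mul1x mulDx.

Lemma cls_zmod_morphism : zmod_morphism cls.
Proof. by move=> a b; rewrite -[RHS]/(add _ (opp _)) oppE addE. Qed.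

Lemma cls_monoid_morphism : monoid_morphism cls.
Proof. by split=> // a b; rewrite -[RHS]/(mul _ _) mulE. Qed.

HB.instance Definition _ := GRing.isZmodMorphism.Build R type cls
  cls_zmod_morphism.
HB.instance Definition _ := GRing.isMonoidMorphism.Build R type cls
  cls_monoid_morphism.

Lemma cls0P r : cls r = 0 <-> J r.
Proof. by rewrite -[r in J r]subr0; exact: (clsP r 0). Qed.

Section Lift.
Variables (S : comPzRingType) (f : {rmorphism R -> S}).
Hypothesis fJ : forall x, J x -> f x = 0.

Definition induced (x : type) : S := f (repr x).

Lemma inducedE r : induced (cls r) = f r.
Proof. by apply/eqP; rewrite -subr_eq0 -rmorphB fJ//; apply: reprJ. Qed.

Lemma induced_zmod_morphism : zmod_morphism induced.
Proof.
by elim/clsW=> a; elim/clsW=> b; rewrite -rmorphB !inducedE rmorphB.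
Qed.

Lemma induced_monoid_morphism : monoid_morphism induced.
Proof.
split=> [|]; first by rewrite -(rmorph1 cls) inducedE rmorph1.
by elim/clsW=> a; elim/clsW=> b; rewrite -rmorphM !inducedE rmorphM.
Qed.

HB.instance Definition _ := GRing.isZmodMorphism.Build type S induced
  induced_zmod_morphism.
HB.instance Definition _ := GRing.isMonoidMorphism.Build type S induced
  induced_monoid_morphism.

Definition induced_rmorphism : {rmorphism type -> S} := induced.
End Lift.
End Quot.
End Quot.
HB.export Quot.

Section Noetherian.

(* Equivalent to the noetherian property; this form passes to images and is
   directly usable on sequences. *)
Definition noetherian (R : comNzRingType) := forall x : nat -> R,
  exists k (c : 'I_k -> R), x k = \sum_(j < k) c j * x j.

Lemma noetherian_image (R S : comNzRingType) (f : {rmorphism R -> S}) :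
  (forall y, exists x, f x = y) -> noetherian R -> noetherian S.
Proof.
move=> fs hR x; have [g gE] := choice (fun k => fs (x k)).
have [k [c e]] := hR g; exists k, (f \o c).
by rewrite -gE e rmorph_sum; apply: eq_bigr => j _; rewrite rmorphM gE.
Qed.

(* Hilbert's basis theorem: f_k has minimal degree among the elements of the
   ideal of the x_j which are not combinations of f_0, ..., f_(k-1). *)
Lemma noetherian_poly (R : comNzRingType) : noetherian R -> noetherian {poly R}.
Proof.
move=> hR x; apply: contrapT => hx.
pose span (s : seq {poly R}) p := exists c : nat -> {poly R},
  p = \sum_(j < size s) c j * s`_j.
have span0 s : span s 0.
  by exists (fun=> 0); rewrite big1// => j _; rewrite mul0r.
have spanD s p r : span s p -> span s r -> span s (p + r).
  move=> [c ->] [d ->]; exists (fun j => c j + d j).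
  by rewrite -big_split; apply: eq_bigr => j _; rewrite mulrDl.
have spanM s a p : span s p -> span s (a * p).
  move=> [c ->]; exists (fun j => a * c j).
  by rewrite mulr_sumr; apply: eq_bigr => j _; rewrite mulrA.
have spanI s p : p \in s -> span s p.
  move=> ps; exists (fun j => (j == index p s)%:R).
  have hi : (index p s < size s)%N by rewrite index_mem.
  rewrite (bigD1 (Ordinal hi))//= eqxx mul1r nth_index// big1 ?addr0// => j.
  by rewrite -val_eqE /= => /negbTE ->; rewrite mul0r.
have span_sub s t p : (forall r, r \in s -> span t r) -> span s p -> span t p.
  move=> h [c ->]; elim/big_ind: _ => // [a b|j _]; first exact: spanD.
  by apply/spanM/h/mem_nth.
pose J p := exists k, span (mkseq x k) p.
have Jmono k l p : (k <= l)%N -> span (mkseq x k) p -> span (mkseq x l) p.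
  move=> kl; apply: span_sub => r /mapP[j]; rewrite mem_iota /= add0n => jk ->.
  by apply/spanI/map_f; rewrite mem_iota /= add0n (leq_trans jk).
have JM a p : J p -> J (a * p) by move=> [k h]; exists k; apply: spanM.
have JD p r : J p -> J r -> J (p + r).
  move=> [k hp] [l hr]; exists (maxn k l).
  by apply: spanD; [apply: Jmono hp|apply: Jmono hr]; rewrite ?leq_maxl ?leq_maxr.
have notfg s : (forall p, p \in s -> J p) -> exists p, J p /\ ~ span s p.
  move=> sJ; apply: contrapT => h.
  have {}h p : J p -> span s p by move=> Jp; apply: contrapT => np; apply: h; exists p.
  have [k hk] : exists k, forall p, p \in s -> span (mkseq x k) p.
    elim: s sJ {h} => [|p s IH] sJ; first by exists 0%N.
    have [|k hk] := IH; first by move=> r rs; apply: sJ; rewrite inE rs orbT.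
    have [l hl] := sJ p (mem_head _ _).
    exists (maxn k l) => r; rewrite inE => /orP[/eqP->|rs].
      by apply: Jmono hl; rewrite leq_maxr.
    by apply: Jmono (hk _ rs); rewrite leq_maxl.
  have : J (x k).
    by exists k.+1; apply/spanI/map_f; rewrite mem_iota /= add0n.
  move=> /h /(span_sub _ _ _ hk) [c e]; apply: hx; exists k, (fun j => c j).
  rewrite e size_mkseq; apply: eq_bigr => j _; by rewrite nth_mkseq.
have minp s : exists p, (forall r, r \in s -> J r) -> [/\ J p, ~ span s p &
    forall r, J r -> ~ span s r -> (size p <= size r)%N].
  have [sJ|] := pselect (forall r, r \in s -> J r); last by exists 0.
  have [p0 [Jp0 np0]] := notfg _ sJ.
  pose Q k := `[< exists p, [/\ J p, ~ span s p & size p = k] >].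
  have exQ : exists k, Q k by exists (size p0); apply/asboolP; exists p0.
  case: (ex_minnP exQ) => k /asboolP[p [Jp np sp]] hk; exists p => _.
  split=> // r Jr nr; rewrite sp; apply: hk; apply/asboolP; by exists r.
have [f fE] := choice minp.
pose S := fix S k := if k is k'.+1 then rcons (S k') (f (S k')) else [::].
have SJ k : forall r, r \in S k -> J r.
  elim: k => [|k IH] r //=; rewrite mem_rcons inE => /orP[/eqP->|/IH//].
  by have [] := fE _ IH.
have sizeS k : size (S k) = k by elim: k => //= k IH; rewrite size_rcons IH.
have nthS k j : (j < k)%N -> (S k)`_j = f (S j).
  elim: k => // k IH; rewrite ltnS leq_eqVlt => /orP[/eqP->|jk] /=.
    by rewrite nth_rcons sizeS ltnn eqxx.
  by rewrite nth_rcons sizeS jk IH.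
pose p k := f (S k).
have pJ k : J (p k) by have [] := fE _ (@SJ k).
have pn k : ~ span (S k) (p k) by have [] := fE _ (@SJ k).
have pmin k r : J r -> ~ span (S k) r -> (size (p k) <= size r)%N.
  by have [_ _] := fE _ (@SJ k); apply.
have pS k j : (j < k)%N -> span (S k) (p j).
  by move=> jk; apply: spanI; rewrite /p -(nthS k j jk) mem_nth ?sizeS.
(* A candidate for stage k is also one for each earlier stage, so the minimal degrees increase and
   the exponents in [d] below are true differences. *)
have smono j k : (j <= k)%N -> (size (p j) <= size (p k))%N.
  move=> jk; apply: pmin => // h; apply: (pn k); apply: span_sub h => r rS.
  apply/spanI; move: jk rS; elim: k => [|k IH]; first by rewrite leqn0 => /eqP->.
  rewrite leq_eqVlt => /orP[/eqP->//|jk] rS /=.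
  by rewrite mem_rcons inE IH ?orbT.
have [k [c e]] := hR (fun j => lead_coef (p j)).
(* [d] lies in the span and has the same coefficient as [p k] at its top degree, so [p k - d] is a
   candidate of stage k whose degree would be below the minimum. *)
pose d := \sum_(j < k) (c j)%:P * 'X^(size (p k) - size (p j)) * p j.
have Sd : span (S k) d.
  by rewrite /d; elim/big_ind: _ => // [a b|j _]; [exact: spanD|apply/spanM/pS].
have pk0 : p k != 0 by apply/eqP => h; apply: (pn k); rewrite h; apply: span0.
have : (size (p k) <= size (p k - d)%R)%N.
  apply: pmin => [|h].
    rewrite -[- d]mulN1r; apply: (JD _ _ (pJ k) (JM _ _ _)).
    apply: (big_ind J) => [|a b|j _]; [|exact: JD|exact/JM/pJ].
    by exists 0%N; apply: span0.
  by apply: (pn k); rewrite -(subrK d (p k)); apply: spanD.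
have dsize : (size d <= size (p k))%N.
  apply: leq_trans (size_sum _ _ _) _; apply/bigmax_leqP => j _.
  rewrite -mulrA mul_polyC; apply: leq_trans (size_scale_leq _ _) _.
  have [->|pj0] := eqVneq (p j) 0; first by rewrite mulr0 size_poly0.
  by rewrite mulrC size_mulXn// subnK// smono// ltnW.
have : (p k - d)`_(size (p k)).-1 = 0.
  rewrite coefB -/(lead_coef (p k)) e coef_sum -sumrB big1// => j _.
  rewrite -mulrA coefCM coefXnM.
  have sj : (size (p j) <= size (p k))%N by rewrite smono// ltnW.
  have [pj0|pj0] := eqVneq (p j) 0.
    by rewrite pj0 lead_coef0 coef0 if_same mulr0 subrr.
  have sp : (0 < size (p j))%N by rewrite size_poly_gt0.
  rewrite ifN; last by rewrite -leqNgt; move: sj sp; lia.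
  rewrite lead_coefE (_ : (_ - _)%N = (size (p j)).-1) ?subrr//.
  by move: sj sp; lia.
set r := p k - d => rl sr.
have sr2 : size r = size (p k).
  apply/eqP; rewrite eqn_leq sr andbT.
  by apply: leq_trans (size_polyD _ _) _; rewrite geq_max leqnn size_polyN.
have /eqP := rl; rewrite -sr2 -lead_coefE lead_coef_eq0 -size_poly_eq0 sr2.
by rewrite size_poly_eq0 (negbTE pk0).
Qed.

Lemma mpoly_subring (A : comNzRingType) k (P : {mpoly A[k]} -> Prop) :
  (forall a, P a%:MP) -> (forall i, P 'X_i) ->
  (forall p q, P p -> P q -> P (p + q)) -> (forall p q, P p -> P q -> P (p * q)) ->
  forall p, P p.
Proof.
move=> PC PX PD PM p; rewrite [p]mpolyE.
have P0 : P 0 by rewrite -(rmorph0 (@mpolyC k A)); apply: PC.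
apply: (big_ind P) => // m _; rewrite -mul_mpolyC; apply: (PM) => //.
have P1 : P 1 by rewrite -(rmorph1 (@mpolyC k A)); apply: PC.
rewrite mpolyXE_id; apply: (@big_rec _ P) => // i r _ Pr; apply: (PM _ _ _ Pr).
by elim: (m i) => [|j IH] //; rewrite exprS; apply: PM.
Qed.

(** As the property passes to images, it is enough that the polynomial ring over k variables maps
    onto the one in k + 1 variables. *)
Lemma noetherian_mpoly (A : comNzRingType) k :
  noetherian A -> noetherian {mpoly A[k]}.
Proof.
move=> hA; elim: k => [|k IH].
  refine (@noetherian_image _ _ (@mpolyC 0 A) _ hA).
  apply: mpoly_subring => [a|[]//|p q|p q]; first by exists a.
    by move=> [x <-] [y <-]; exists (x + y); rewrite rmorphD.
  by move=> [x <-] [y <-]; exists (x * y); rewrite rmorphM.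
pose f : {rmorphism {mpoly A[k]} -> {mpoly A[k.+1]}} :=
  mmap (@mpolyC k.+1 A) (fun i => 'X_(widen_ord (leqnSn k) i)).
have cf : commr_rmorph f ('X_ord_max : {mpoly A[k.+1]}).
  by move=> x; apply: mulrC.
refine (@noetherian_image _ _ (horner_morph cf) _ (noetherian_poly IH)).
apply: mpoly_subring => [a|i|p q|p q].
- by exists a%:MP%:P; rewrite [LHS]horner_morphC [LHS]mmapC.
- have [ik|ki] := ltnP i k.
    exists ('X_(Ordinal ik))%:P; rewrite [LHS]horner_morphC [LHS]mmapX mmap1U.
    by congr mpolyX; congr mnm1; apply: val_inj.
  exists 'X; rewrite [LHS]horner_morphX; congr mpolyX; congr mnm1; apply: val_inj.
  by apply/eqP; rewrite eqn_leq /= ki -ltnS ltn_ord.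
- by move=> [x <-] [y <-]; exists (x + y); rewrite rmorphD.
- by move=> [x <-] [y <-]; exists (x * y); rewrite rmorphM.
Qed.
End Noetherian.

(** * Homomorphisms out of polynomial algebras and quotients *)

Section AlgebraBasics.
Variable A : comNzRingType.

Definition alghom_id (R : algebra A) : alghom R R :=
  @AlgHom A R R idfun (fun=> erefl).

Lemma alghom_compP (R S T : algebra A) (g : alghom S T) (f : alghom R S) a :
  (g \o f) (alg_map R a) = alg_map T a.
Proof. by rewrite /= !alghomP. Qed.

Definition alghom_comp (R S T : algebra A) (g : alghom S T) (f : alghom R S) :
  alghom R T := AlgHom (alghom_compP g f).

Lemma mpoly_alghom_eq k (R : algebra A) (f g : alghom (mpoly_alg A k) R) :
  (forall i, f 'X_i = g 'X_i) -> f =1 g.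
Proof.
move=> h; apply: mpoly_subring => [a|//|p q hp hq|p q hp hq].
- exact: etrans (alghomP f a) (esym (alghomP g a)).
- by rewrite !rmorphD hp hq.
- by rewrite !rmorphM hp hq.
Qed.

Lemma mpoly_eval k (R : algebra A) (y : 'I_k -> R) :
  exists f : alghom (mpoly_alg A k) R, forall i, f 'X_i = y i.
Proof.
(* [mmap] needs a nonzero target, so the zero algebra is treated apart. *)
have [R1|R0] := eqVneq (1 : R) 0.
  have all0 (x : R) : x = 0 by rewrite -[x]mul1r R1 mul0r.
  pose f (x : mpoly_alg A k) : R := 0.
  have fa : zmod_morphism f by move=> ? ?; rewrite subr0.
  have fm : monoid_morphism f by split=> [|? ?]; rewrite /f ?mul0r ?R1.
  pose fr : {rmorphism mpoly_alg A k -> R} :=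
    HB.pack f (GRing.isZmodMorphism.Build _ _ f fa)
      (GRing.isMonoidMorphism.Build _ _ f fm).
  have fP a : fr (alg_map (mpoly_alg A k) a) = alg_map R a.
    by rewrite [RHS]all0.
  by exists (AlgHom fP) => i; rewrite [RHS]all0.
pose R' : comNzRingType := HB.pack (GRing.ComPzRing.sort R)
  (GRing.PzSemiRing_isNonZero.Build R R0).
pose h : {rmorphism A -> R'} := alg_map R.
pose g : {rmorphism {mpoly A[k]} -> R'} := mmap h (y : 'I_k -> R').
pose gr : {rmorphism mpoly_alg A k -> R} := g.
have gP a : gr (alg_map (mpoly_alg A k) a) = alg_map R a.
  exact: (mmapC (y : 'I_k -> R') h a).
exists (AlgHom gP) => i.
by rewrite /= [LHS](mmapX (y : 'I_k -> R') h) mmap1U.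
Qed.

Definition quot_alg (R : algebra A) (J : R -> Prop) (HJ : Quot.ideal J) :
  algebra A := Algebra (Quot.cls HJ \o alg_map R).

Definition quot_hom (R : algebra A) (J : R -> Prop) (HJ : Quot.ideal J) :
    alghom R (quot_alg HJ) :=
  @AlgHom A R (quot_alg HJ) (Quot.cls HJ) (fun=> erefl).

Lemma quot_hom_surj (R : algebra A) (J : R -> Prop) (HJ : Quot.ideal J) y :
  exists x, quot_hom HJ x = y.
Proof. by elim/Quot.clsW: y => r; exists r. Qed.

Lemma quot_hom0P (R : algebra A) (J : R -> Prop) (HJ : Quot.ideal J) x :
  quot_hom HJ x = 0 <-> J x.
Proof. exact: Quot.cls0P. Qed.

Lemma quot_lift (R S : algebra A) (J : R -> Prop) (HJ : Quot.ideal J)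
    (f : alghom R S) : (forall x, J x -> f x = 0) ->
  exists g : alghom (quot_alg HJ) S, forall x, g (quot_hom HJ x) = f x.
Proof.
move=> fJ.
pose gr : {rmorphism Quot.type HJ -> S} := Quot.induced_rmorphism HJ fJ.
have gP a : gr (alg_map (quot_alg HJ) a) = alg_map S a.
  by rewrite /gr /= Quot.inducedE// alghomP.
by exists (@AlgHom A (quot_alg HJ) S gr gP) => x; rewrite /= /gr /= Quot.inducedE.
Qed.
End AlgebraBasics.

(** * Torsion in formally smooth algebras *)

Section FormallySmoothTorsion.
Variables (A : comNzRingType) (k c : nat) (f : 'I_c -> mpoly_alg A k).
Let P := mpoly_alg A k.

Definition ideal_gen (x : P) := exists b : 'I_c -> P, x = \sum_(j < c) b j * f j.

(** The power I^i of the ideal, with the coefficients of the generators taken in I^(i-1); this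
    recursion matches the construction of preimages in the Rees algebra. *)
Fixpoint ideal_pow i (x : P) : Prop :=
  if i is i'.+1 then exists b : 'I_c -> P,
    (forall j, ideal_pow i' (b j)) /\ x = \sum_(j < c) b j * f j
  else True.

Lemma ideal_pow_ideal i : Quot.ideal (ideal_pow i).
Proof.
elim: i => [|i [IH0 IHD IHM]] //; split=> [|x y|a x].
- by exists (fun=> 0); split=> //; rewrite big1// => j _; rewrite mul0r.
- move=> [b [bJ ->]] [d [dJ ->]]; exists (fun j => b j + d j); split.
    by move=> j; exact: IHD (bJ j) (dJ j).
  by rewrite -big_split; apply: eq_bigr => j _; rewrite mulrDl.
- move=> [b [bJ ->]]; exists (fun j => a * b j); split.
    by move=> j; exact: IHM (bJ j).
  by rewrite mulr_sumr; apply: eq_bigr => j _; rewrite mulrA.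
Qed.

Lemma ideal_pow1 x : ideal_pow 1 x <-> ideal_gen x.
Proof.
by split=> [[b [_ ->]]|[b ->]]; exists b.
Qed.

Lemma ideal_gen_ideal : Quot.ideal ideal_gen.
Proof.
have [h0 hD hM] := ideal_pow_ideal 1.
by split=> [|x y|a x]; rewrite -!ideal_pow1; [exact: h0|exact: hD|exact: hM].
Qed.

Lemma ideal_powS i x : ideal_pow i.+1 x -> ideal_pow i x.
Proof.
elim: i x => // i IH x [b [bJ ->]]; exists b; split=> // j; exact/IH/bJ.
Qed.

Lemma ideal_pow_gen i x : ideal_pow i.+1 x -> ideal_gen x.
Proof.
by elim: i x => [|i IH] x h; [apply/ideal_pow1|apply/IH/ideal_powS].
Qed.

Lemma ideal_gen_powM i x y :
  ideal_gen x -> ideal_pow i y -> ideal_pow i.+1 (x * y).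
Proof.
have [_ _ hM] := ideal_pow_ideal i.
move=> [b ->] yJ; exists (fun j => b j * y); split=> [j|]; first exact: hM.
by rewrite mulr_suml; apply: eq_bigr => j _; rewrite mulrAC.
Qed.

(** The kernel of P/I^(i+2) -> P/I^(i+1) has square zero, so formal smoothness of P/I lifts a
    section of P/I^(i+1) -> P/I one step further. *)
Lemma formally_smooth_section (Hs : formally_smooth (quot_alg ideal_gen_ideal)) i :
  exists s : alghom (quot_alg ideal_gen_ideal) (quot_alg (ideal_pow_ideal i.+1)),
  forall x : P, exists z : P, ideal_gen (z - x) /\
    s (quot_hom ideal_gen_ideal x) = quot_hom (ideal_pow_ideal i.+1) z.
Proof.
have [I0 ID IM] := ideal_gen_ideal.
elim: i => [|i [s sE]].
  have [x|s sE] := @quot_lift _ P _ _ ideal_gen_ideal (quot_hom (ideal_pow_ideal 1)).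
    by move=> Ix; apply/quot_hom0P/ideal_pow1.
  by exists s => x; exists x; rewrite subrr; split=> //; apply: sE.
have [x|p pE] := @quot_lift _ P _ _ (ideal_pow_ideal i.+2)
    (quot_hom (ideal_pow_ideal i.+1)).
  by move=> /ideal_powS Ix; apply/quot_hom0P.
have [] := Hs _ _ p s.
  split=> [y|x y].
    by have [x <-] := quot_hom_surj y; exists (quot_hom _ x); apply: pE.
  have [{}x <-] := quot_hom_surj x; have [{}y <-] := quot_hom_surj y.
  rewrite !pE => /quot_hom0P xI /quot_hom0P yI; rewrite -rmorphM.
  by apply/quot_hom0P/ideal_gen_powM => //; apply: ideal_pow_gen xI.
move=> g gE; exists g => x.
have [y [yI sy]] := sE x.
have [z gz] := quot_hom_surj (g (quot_hom ideal_gen_ideal x)).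
exists z; split=> //.
have : quot_hom (ideal_pow_ideal i.+1) (z - y) = 0.
  by rewrite rmorphB -sy -gE /= -gz pE subrr.
move=> /quot_hom0P /ideal_pow_gen zy.
by have := ID _ _ zy yI; rewrite addrA subrK.
Qed.

(** The Rees algebra, the sum of the I^i T^i, is the image of [rees]: the first k variables go to
    those of P, the last c to the f_j T. Relations are taken in [N], which is noetherian as a
    polynomial ring. *)
Let N := {mpoly A[k + c]}.
Let rees_coef : {rmorphism A -> {poly P}} := polyC \o alg_map P.
Let rees_var (i : 'I_(k + c)) : {poly P} :=
  match split i with inl j => ('X_j : P)%:P | inr j => (f j)%:P * 'X end.
Let rees : {rmorphism N -> {poly P}} := mmap rees_coef rees_var.

Let rees_X i : rees 'X_i = rees_var i.
Proof. by rewrite [LHS](mmapX rees_var rees_coef) mmap1U. Qed.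

Let rees_C a : rees a%:MP = (alg_map P a)%:P.
Proof. exact: (mmapC rees_var rees_coef). Qed.

Let rees_surj i x : ideal_pow i x -> exists h, rees h = x%:P * 'X^i.
Proof.
elim: i x => [|i IH] x.
  move=> _; rewrite mulr1; move: x.
  apply: (@mpoly_subring A k (fun x => exists h, rees h = (x : P)%:P)).
  - by move=> a; exists a%:MP; apply: rees_C.
  - move=> j; exists 'X_(lshift c j); rewrite rees_X /rees_var.
    by rewrite (unsplitK (inl j)).
  - by move=> p q [g gE] [h hE]; exists (g + h); rewrite !rmorphD gE hE.
  - by move=> p q [g gE] [h hE]; exists (g * h); rewrite !rmorphM gE hE.
move=> [b [bJ ->]].
have [h hE] := choice (fun j => IH _ (bJ j)).
exists (\sum_(j < c) h j * 'X_(rshift k j)).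
rewrite !rmorph_sum mulr_suml; apply: eq_bigr => j _.
rewrite !rmorphM hE rees_X /rees_var (unsplitK (inr j)) exprS.
by rewrite -!mulrA; congr (_ * _); rewrite mulrA mulrC -mulrA.
Qed.

Let rees_ideal h i : (0 < i)%N -> ideal_gen (rees h)`_i.
Proof.
have [I0 ID IM] := ideal_gen_ideal; move: h i.
apply: (@mpoly_subring A _ (fun h => forall i, (0 < i)%N -> ideal_gen (rees h)`_i)).
- by move=> a [|i]// _; rewrite rees_C coefC.
- move=> j [|i]// _; rewrite rees_X /rees_var; case: (split j) => l.
    by rewrite coefC.
  rewrite coefMX /= coefC; case: eqP => // _.
  exists (fun l' => (l' == l)%:R); rewrite (bigD1 l)//= eqxx mul1r big1 ?addr0//.
  by move=> l' /negbTE ->; rewrite mul0r.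
- by move=> p q hp hq i i0; rewrite rmorphD coefD; apply: ID; [apply: hp|apply: hq].
- move=> p q hp hq i i0; rewrite rmorphM coefM.
  apply: (@big_rec _ ideal_gen) => // j r _ Ir; apply: (ID) => //.
  have [j0|j0] := posnP j; last by rewrite mulrC; apply/IM/hp.
  by apply/IM/hq; rewrite j0 subn0.
Qed.

(* Lifts x_i to P/I^i of a torsion element satisfy t x_i in I^i; by the
   argument of the Artin-Rees lemma, t x_i lies in t I for some i. *)
Lemma formally_smooth_torsion_free (t : A) :
  noetherian A -> (forall x : P, alg_map P t * x = 0 -> x = 0) ->
  formally_smooth (quot_alg ideal_gen_ideal) ->
  forall x, ideal_gen (alg_map P t * x) -> ideal_gen x.
Proof.
move=> hA tinj Hs x tx; have [I0 ID IM] := ideal_gen_ideal.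
(* The section kills the class of t x, so it sends the class of x to a class modulo I^(i+1) that t
   annihilates. *)
have /choice[z zP] i : exists z, ideal_gen (z - x) /\ ideal_pow i (alg_map P t * z).
  have [s sE] := formally_smooth_section Hs i.
  have [z [zx sz]] := sE x.
  exists z; split=> //; apply/ideal_powS/(quot_hom0P (ideal_pow_ideal i.+1)).
  rewrite rmorphM -sz alghomP -(alghomP s) -(alghomP (quot_hom ideal_gen_ideal)).
  by rewrite -!rmorphM (_ : quot_hom _ _ = 0) ?rmorph0//; apply/quot_hom0P.
have /choice[h hP] i : exists h, rees h = (alg_map P t * z i)%:P * 'X^i.
  by apply/rees_surj; have [] := zP i.
have [m [b e]] := noetherian_mpoly hA h.
suff : ideal_gen (z m).
  move=> zI; have [zx _] := zP m.
  have := ID _ _ zI (IM (-1) _ zx).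
  by rewrite mulN1r opprB addrC subrK.
(* Compare the coefficients of T^m and cancel t. As j < m, the coefficient of degree m - j of
   [rees (b j)] is in I. *)
have {}e : z m = \sum_(j < m) (rees (b j))`_(m - j) * z j.
  apply/eqP; rewrite -subr_eq0; apply/eqP/tinj; rewrite mulrBr mulr_sumr.
  have /(congr1 (fun p : {poly P} => p`_m)) := congr1 rees e.
  rewrite hP rmorph_sum coef_sum coefMXn ltnn subnn coefC eqxx /= => ->.
  rewrite -sumrB big1// => j _.
  rewrite rmorphM hP mulrA coefMXn ltnNge (ltnW (ltn_ord j)) /= coefMC.
  by rewrite mulrCA mulrA subrr.
rewrite e; apply: (@big_rec _ ideal_gen) => // j r _ Ir.
apply: (ID) => //; rewrite mulrC; apply/IM/rees_ideal.
by rewrite subn_gt0.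
Qed.
End FormallySmoothTorsion.

(** * Etale algebras modulo 2 *)

Module Dual.
Section Dual.
Variable S : comPzRingType.

(** The pair (a, b) stands for a + b e with e^2 = 0; the second component of a ring map to this ring
    is a derivation. *)
Definition type : Type := (S * S)%type.
HB.instance Definition _ := GRing.Zmodule.copy type (S * S)%type.

Definition mul (x y : type) : type := (x.1 * y.1, x.1 * y.2 + y.1 * x.2).

Lemma mulA : associative mul.
Proof. by move=> [a b] [c d] [e f]; congr (_, _); rewrite /=; ring. Qed.
Lemma mulC : commutative mul.
Proof. by move=> [a b] [c d]; congr (_, _); rewrite /=; ring. Qed.
Lemma mul1x : left_id (1, 0) mul.
Proof. by move=> [a b]; congr (_, _); rewrite /=; ring. Qed.
Lemma mulDx : left_distributive mul +%R.
Proof. by move=> [a b] [c d] [e f]; congr (_, _); rewrite /=; ring. Qed.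

HB.instance Definition _ :=
  GRing.Zmodule_isComPzRing.Build type mulA mulC mul1x mulDx.

Definition pr (x : type) : S := x.1.
Lemma pr_zmod_morphism : zmod_morphism pr. Proof. by []. Qed.
Lemma pr_monoid_morphism : monoid_morphism pr. Proof. by []. Qed.
HB.instance Definition _ := GRing.isZmodMorphism.Build type S pr pr_zmod_morphism.
HB.instance Definition _ := GRing.isMonoidMorphism.Build type S pr
  pr_monoid_morphism.

Definition cst (x : S) : type := (x, 0).
Lemma cst_zmod_morphism : zmod_morphism cst.
Proof. by move=> x y; congr (_, _); rewrite /= ?subrr. Qed.
Lemma cst_monoid_morphism : monoid_morphism cst.
Proof. by split=> // x y; congr (_, _); rewrite /= !mulr0 addr0. Qed.
HB.instance Definition _ := GRing.isZmodMorphism.Build S type cst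
  cst_zmod_morphism.
HB.instance Definition _ := GRing.isMonoidMorphism.Build S type cst
  cst_monoid_morphism.
End Dual.
End Dual.
HB.export Dual.

Section DyadicRing.
Variable A : idomainType.
Hypothesis two_neq0 : 2%:R != 0 :> A.
Hypothesis two_val : forall a : A, a != 0 ->
  exists k u, u \is a GRing.unit /\ a = 2%:R ^+ k * u.
Hypothesis two_sqrt : forall a : A, exists b c, a = b ^+ 2 + 2%:R * c.

Definition torsion_free (R : pzRingType) := forall x : R, 2%:R * x = 0 -> x = 0.

Lemma torsion_freeX (R : pzRingType) : torsion_free R ->
  forall k (x : R), 2%:R ^+ k * x = 0 -> x = 0.
Proof.
move=> h; elim=> [|k IH] x; first by rewrite mul1r.
by rewrite exprS -mulrA => /h/IH.
Qed.

(** Every nonzero element of A is a power of 2 times a unit, so a relation without 2-torsion can be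
    divided by its coefficient of least valuation. *)
Lemma flatP (R : algebra A) : flat R <-> torsion_free R.
Proof.
split=> [hR x x0|tf k a r ar].
  have [|l [c [t [rct ac]]]] := hR 1%N (const_mx 2%:R) (const_mx x).
    apply/matrixP => i j; rewrite !mxE big_ord1 !mxE rmorph_nat.
    exact: x0.
  have c0 : c = 0.
    apply/matrixP => i j; move/matrixP: ac => /(_ i j).
    rewrite !mxE big_ord1 !mxE => /eqP; rewrite mulf_eq0 (negbTE two_neq0) /=.
    by rewrite !(ord1 i) => /eqP.
  move/matrixP: rct => /(_ 0 0); rewrite c0 !mxE => ->.
  by rewrite big1// => i _; rewrite !mxE rmorph0 mul0r.
have [a0|] := pselect (a = 0).
  exists k, 1%:M, r; rewrite a0 mul0mx; split=> //.
  by rewrite map_mx1 mul1mx.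
move=> /eqP a0.
pose Q m := `[< exists i u, u \is a GRing.unit /\ a 0 i = 2%:R ^+ m * u >].
have exQ : exists m, Q m.
  apply: contrapT => h; case/eqP: a0; apply/matrixP => i j; rewrite (ord1 i) mxE.
  apply/eqP/negPn/negP => /two_val[m [u [uu e]]].
  by apply: h; exists m; apply/asboolP; exists j, u.
case: (ex_minnP exQ) => m /asboolP[i [u [uu ai]]] mmin.
have /choice[b bE] j : exists b, a 0 j = a 0 i * b.
  have [->|/two_val[l [v [vu e]]]] := eqVneq (a 0 j) 0; first by exists 0; rewrite mulr0.
  have ml : (m <= l)%N by apply: mmin; apply/asboolP; exists j, v.
  exists (2%:R ^+ (l - m) * (v / u)).
  by rewrite e ai -(subnKC ml) exprD addKn -{1}[v](divrK uu); ring.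
have bi : b i = 1.
  apply: (@mulfI _ (a 0 i)); last by rewrite mulr1 -bE.
  by rewrite ai mulf_neq0 ?expf_neq0//; apply: contraTneq uu => ->; rewrite unitr0.
have br : \sum_j alg_map R (b j) * r j 0 = 0.
  have /matrixP/(_ 0 0) := ar; rewrite !mxE => e.
  apply: (torsion_freeX tf (k := m)).
  have uV : alg_map R u^-1 * alg_map R u = 1 by rewrite -rmorphM mulVr// rmorph1.
  transitivity (alg_map R u^-1 * (\sum_j map_mx (alg_map R) a 0 j * r j 0)).
    rewrite !mulr_sumr; apply: eq_bigr => j _.
    rewrite !mxE bE ai !rmorphM rmorphXn rmorph_nat.
    by rewrite -[LHS]mul1r -uV; ring.
  by rewrite e mulr0.
(* After the division the i-th coefficient is 1. The matrix 1 - e_i b then fixes [r], because b r =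
   0, and is annihilated by [a], which is a multiple of b. *)
exists k, (1%:M - \matrix_(j, l) ((j == i)%:R * b l)), r; split.
  rewrite map_mxB map_mx1 mulmxBl mul1mx [X in _ - X](_ : _ = 0) ?subr0//.
  apply/matrixP => j l; rewrite !mxE (ord1 l) (eq_bigr (fun l' =>
    (j == i)%:R * (alg_map R (b l') * r l' 0))); last first.
    move=> l' _; rewrite !mxE.
    by rewrite [X in X * _](rmorphM (alg_map R) (j == i)%:R (b l')) rmorph_nat mulrA.
  by rewrite -mulr_sumr br mulr0.
rewrite mulmxBr mulmx1; apply/matrixP => j l; rewrite !mxE (ord1 j) (bigD1 i)//=.
rewrite !mxE eqxx mul1r -bE big1 ?addr0 ?subrr// => l' /negbTE li.
by rewrite !mxE li mul0r mulr0.
Qed.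

Definition reduced_mod2 (R : comPzRingType) :=
  forall x y : R, x ^+ 2 = 2%:R * y -> exists z, x = 2%:R * z.

(** An entry of least valuation divides its successor. *)
Lemma noetherian_dyadic : noetherian A.
Proof.
move=> x; have [h|] := pselect (exists m, x m = 0).
  have [m xm] := h; exists m, (fun=> 0).
  by rewrite xm big1// => j _; rewrite mul0r.
move=> /forallNP/(_ _)/eqP x0.
have /choice[v vE] j : exists m, exists u, u \is a GRing.unit /\ x j = 2%:R ^+ m * u.
  exact: two_val.
pose Q m := `[< exists j, v j = m >].
have exQ : exists m, Q m by exists (v 0%N); apply/asboolP; exists 0%N.
case: (ex_minnP exQ) => _ /asboolP[j <-] jmin.
have vj : (v j <= v j.+1)%N by apply/jmin/asboolP; exists j.+1.
have [u [uu xj]] := vE j; have [w [wu xj1]] := vE j.+1.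
exists j.+1, (fun l => if l == ord_max then 2%:R ^+ (v j.+1 - v j) * (w / u) else 0).
rewrite big_ord_recr /= eqxx big1 ?add0r => [|l _]; last first.
  by rewrite ifN ?mul0r// -val_eqE /= neq_ltn ltn_ord.
by rewrite xj1 xj -{1}(subnKC vj) exprD -{1}[w](divrK uu); ring.
Qed.

Section EtaleReduced.
Variables (S : algebra A).
Hypothesis S2 : 2%:R = 0 :> S.
Hypothesis Su : formally_unramified S.

Let sqrD (x y : S) : (x + y) ^+ 2 = x ^+ 2 + y ^+ 2.
Proof. by rewrite sqrrD -mulr_natl S2 mul0r addr0. Qed.

(* The subring generated by the squares and the elements of s. *)
Fixpoint adjoin_squares (s : seq S) (y : S) : Prop :=
  if s is x :: s' then exists a b,
    [/\ adjoin_squares s' a, adjoin_squares s' b & y = a + b * x]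
  else exists r, y = r ^+ 2.

Lemma adjoin_squares_sqr s r : adjoin_squares s (r ^+ 2).
Proof.
elim: s r => [|x s IH] r; first by exists r.
exists (r ^+ 2), (0 ^+ 2); split; [exact: IH|exact: IH|].
by rewrite expr0n mul0r addr0.
Qed.

Lemma adjoin_squares0 s : adjoin_squares s 0.
Proof. by have := adjoin_squares_sqr s 0; rewrite expr0n. Qed.

Lemma adjoin_squares1 s : adjoin_squares s 1.
Proof. by have := adjoin_squares_sqr s 1; rewrite expr1n. Qed.

Lemma adjoin_squaresD s x y :
  adjoin_squares s x -> adjoin_squares s y -> adjoin_squares s (x + y).
Proof.
elim: s x y => [|z s IH] x y /=; first by move=> [r ->] [t ->]; exists (r + t).
move=> [a [b [ha hb ->]]] [c [d [hc hd ->]]]; exists (a + c), (b + d).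
by split; [exact: IH|exact: IH|ring].
Qed.

(** The term in z ^ 2 falls back into the smaller subring, which contains all squares; this is why
    expressions of degree 1 in z suffice. *)
Lemma adjoin_squaresM s x y :
  adjoin_squares s x -> adjoin_squares s y -> adjoin_squares s (x * y).
Proof.
elim: s x y => [|z s IH] x y /=.
  by move=> [r ->] [t ->]; exists (r * t); rewrite exprMn.
move=> [a [b [ha hb ->]]] [c [d [hc hd ->]]].
exists (a * c + b * d * z ^+ 2), (a * d + b * c); split; last by ring.
  apply: adjoin_squaresD; first exact: IH.
  by apply: (IH); [exact: IH|exact: adjoin_squares_sqr].
by apply: adjoin_squaresD; apply: IH.
Qed.

Lemma adjoin_squares_mem s x : x \in s -> adjoin_squares s x.
Proof.
elim: s => //= z s IH; rewrite inE => /orP[/eqP ->|/IH xs].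
  by exists 0, 1; split; rewrite ?add0r ?mul1r//;
    [exact: adjoin_squares0|exact: adjoin_squares1].
by exists x, 0; split=> //; rewrite ?mul0r ?addr0//; apply: adjoin_squares0.
Qed.

(* If S = C + C x with x ^ 2 in C, then a + b x |-> b is a derivation to the
   quotient of S by the ideal generated by the conductor of C; as it vanishes,
   1 is in this ideal, and its square is in the conductor. *)
Lemma adjoin_squares_peel x s :
  (forall y, adjoin_squares (x :: s) y) -> forall y, adjoin_squares s y.
Proof.
move=> hS.
pose C := adjoin_squares s.
pose J (y : S) := exists m (r b : 'I_m -> S),
  (forall j, C (b j) /\ C (b j * x)) /\ y = \sum_(j < m) r j * b j.
have CD a b : C a -> C b -> C (a + b) := @adjoin_squaresD s a b.
have CM a b : C a -> C b -> C (a * b) := @adjoin_squaresM s a b.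
have CQ a : C (a ^+ 2) := adjoin_squares_sqr s a.
have C0 : C 0 := adjoin_squares0 s.
have C1 : C 1 := adjoin_squares1 s.
have N1 (a : S) : - a = a.
  by apply/eqP; rewrite -subr_eq0 -opprD -mulr2n -mulr_natl S2 mul0r oppr0.
have CN a : C a -> C (- a) by rewrite N1.
have JI : Quot.ideal J.
  split=> [|u v|a u].
  - by exists 0%N, (fun=> 0), (fun=> 0); split=> [[]//|]; rewrite big_ord0.
  - move=> [m [r [b [hb ->]]]] [m' [r' [b' [hb' ->]]]].
    exists (m + m')%N, (fun j => match split j with inl i => r i | inr i => r' i end),
      (fun j => match split j with inl i => b i | inr i => b' i end).
    split=> [j|]; first by case: (split j).
    rewrite big_split_ord; congr (_ + _); apply: eq_bigr => j _.
      by rewrite (unsplitK (inl j)).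
    by rewrite (unsplitK (inr j)).
  - move=> [m [r [b [hb ->]]]]; exists m, (fun j => a * r j), b; split=> //.
    by rewrite mulr_sumr; apply: eq_bigr => j _; rewrite mulrA.
pose Q := quot_alg JI; pose cl := quot_hom JI.
pose T := @Algebra A (Dual.type Q) (@Dual.cst Q \o alg_map Q).
pose p : alghom T Q := @AlgHom A T Q (@Dual.pr Q) (fun=> erefl).
pose g : alghom S T := @AlgHom A S T (@Dual.cst Q \o cl) (fun=> erefl).
have /choice[b bE] y : exists b, C b /\ C (y - b * x).
  have [a [b [ha hb ->]]] := hS y; exists b; split=> //.
  by rewrite addrK; exact: ha.
(* Two coefficients of x in the same y differ by an element of the conductor, so the coefficient is
   well defined modulo J. *)
have bcl y b' : C b' -> C (y - b' * x) -> cl (b y) = cl b'.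
  move=> Cb Cy; have [h1 h2] := bE y.
  apply/eqP; rewrite -subr_eq0 -rmorphB; apply/eqP/quot_hom0P.
  exists 1%N, (fun=> 1), (fun=> b y - b'); split=> [_|]; last by rewrite big_ord1 mul1r.
  split; first by apply: (CD) => //; apply: (CN).
  have -> : (b y - b') * x = (y - b' * x) - (y - b y * x) by ring.
  by apply: (CD) => //; apply: (CN).
pose hf (y : S) : T := (cl y, cl (b y)).
have hz : zmod_morphism hf.
  move=> u v; congr (_, _); rewrite /= -rmorphB //.
  have [h1 h2] := bE u; have [h3 h4] := bE v.
  apply: (bcl); first by apply: (CD) => //; apply: (CN).
  have -> : u - v - (b u - b v) * x = (u - b u * x) - (v - b v * x) by ring.
  by apply: (CD) => //; apply: (CN).
have hm : monoid_morphism hf.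
  split=> [|u v]; congr (_, _); rewrite /= ?rmorph1 ?rmorphM//.
    rewrite -(rmorph0 cl); apply: (bcl); first exact: C0.
    by rewrite mul0r subr0.
  have [h1 h2] := bE u; have [h3 h4] := bE v.
  rewrite -!rmorphM -rmorphD.
  set au := u - b u * x in h2; set av := v - b v * x in h4.
  (* The Leibniz rule: the two arguments differ by 2 * b u * b v * x, which is 0. *)
  have -> : cl (u * b v + v * b u) = cl (au * b v + av * b u).
    rewrite -[X in cl X]addr0 -[0](mul0r (b u * b v * x)) -S2; congr (cl _).
    by rewrite -[2%:R * _]N1 /au /av; ring.
  apply: (bcl); first by apply: (CD); apply: (CM).
  have -> : u * v - (au * b v + av * b u) * x =
     au * av + (b u * b v) * x ^+ 2 by rewrite /au /av; ring.
  by apply: (CD); apply: (CM) => //; apply: (CM).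
pose hr : {rmorphism S -> T} := HB.pack hf (GRing.isZmodMorphism.Build _ _ hf hz)
   (GRing.isMonoidMorphism.Build _ _ hf hm).
have hP a : hr (alg_map S a) = alg_map T a.
  rewrite /= /hf; congr (_, _); rewrite -(rmorph0 cl); apply: (bcl).
    exact: C0.
  (* The derivation must vanish on A: modulo 2 a constant is a square, hence lies in C. *)
  have [c [d ->]] := two_sqrt a.
  rewrite mul0r subr0 rmorphD rmorphXn rmorphM rmorph_nat S2 mul0r addr0.
  exact: CQ.
pose h : alghom S T := AlgHom hP.
have pse : square_zero_ext p.
  split=> [y|[u u'] [v v'] /= hu hv]; first by exists (y, 0).
  rewrite /Dual.pr /= in hu hv; rewrite hu hv.
  by congr (_, _); rewrite /= !mul0r ?addr0.
(* Both [g] and [h] lift [cl], so they agree; at x their second components are 0 and the class of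
   1. *)
have gh := Su pse (g := g) (h := h) (fun=> erefl).
have /quot_hom0P[m [r [c [hc e]]]] : cl 1 = 0.
  have e : 0 = cl (b x) := congr1 snd (gh x); rewrite [RHS]e; symmetry; apply: (bcl).
    exact: C1.
  by rewrite mul1r subrr.
have Cx : C x.
  (* Squaring the relation in characteristic 2 replaces r_j by r_j ^ 2, which is in C, and c_j ^ 2 *
     x is the product of c_j and c_j * x, both in C. *)
  have e2 : 1 = \sum_(j < m) (r j * c j) ^+ 2.
    rewrite -[LHS](expr1n S 2) {1}e.
    elim/big_rec2: _ => [|j y z _ <-]; first by rewrite expr0n.
    by rewrite sqrD.
  rewrite -[x]mul1r e2 mulr_suml; apply: (@big_rec _ C) => //.
  move=> j y _ Cy; have [h1 h2] := hc j.
  have -> : (r j * c j) ^+ 2 * x = r j ^+ 2 * c j * (c j * x) by ring.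
  by apply: (CD) => //; apply: (CM) => //; apply: (CM).
by move=> y; have [a [d [ha hd ->]]] := hS y; apply: (CD) => //; apply: (CM).
Qed.

(** The image of A consists of squares, so S is generated over its squares by the images of the
    variables, and [adjoin_squares_peel] removes these one at a time. *)
Lemma unramified_frobenius_surj k (f : alghom (mpoly_alg A k) S) :
  (forall y, exists x, f x = y) -> forall y : S, exists r, y = r ^+ 2.
Proof.
move=> fs.
suff h s : (forall y, adjoin_squares s y) -> forall y, adjoin_squares [::] y.
  apply: (h [seq f 'X_i | i <- enum 'I_k]) => y; have [x <-] := fs y; move: x.
  apply: (@mpoly_subring A k (fun x => adjoin_squares _ (f x))).
  - move=> a; rewrite (alghomP f a) /=; have [c [d ->]] := two_sqrt a.
    rewrite rmorphD rmorphXn rmorphM rmorph_nat S2 mul0r addr0.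
    exact: adjoin_squares_sqr.
  - by move=> i; apply/adjoin_squares_mem/map_f; rewrite mem_enum.
  - by move=> p q hp hq; rewrite rmorphD; apply: adjoin_squaresD.
  - by move=> p q hp hq; rewrite rmorphM; apply: adjoin_squaresM.
by elim: s => // x s IH /adjoin_squares_peel.
Qed.

(* A surjective endomorphism of a noetherian ring is injective. *)
Lemma unramified_reduced k (f : alghom (mpoly_alg A k) S) :
  (forall y, exists x, f x = y) -> forall x : S, x ^+ 2 = 0 -> x = 0.
Proof.
move=> fs x x0; have /choice[r rE] := unramified_frobenius_surj fs.
(* [xs i] is a 2^i-th root of x, and its power 2^j vanishes for i < j. A relation expressing [xs m]
   by earlier terms, raised to the power 2^m, therefore gives x = 0. *)
pose xs i := iter i r x.
have xsS i : xs i.+1 ^+ 2 = xs i by rewrite [RHS]rE.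
have xsX i : xs i ^+ (2 ^ i) = x.
  by elim: i => // i IH; rewrite expnS exprM xsS.
have xs0 i j : (i < j)%N -> xs i ^+ (2 ^ j) = 0.
  move=> ij; rewrite -(subnKC ij) expnD expnSr exprM exprM xsX x0.
  by rewrite expr0n expn_eq0.
have [g gE] := choice (fun i => fs (xs i)).
have [m [c e]] := noetherian_mpoly noetherian_dyadic g.
rewrite -(xsX m) -gE e rmorph_sum.
have sqD i (u v : S) : (u + v) ^+ (2 ^ i) = u ^+ (2 ^ i) + v ^+ (2 ^ i).
  elim: i u v => [|i IH] u v; first by rewrite !expr1.
  by rewrite !expnS !exprM sqrD IH.
apply: (@big_rec _ (fun y : S => y ^+ (2 ^ m) = 0)).
  by rewrite expr0n expn_eq0.
by move=> j y _ y0; rewrite sqD y0 addr0 rmorphM gE exprMn xs0 ?mulr0.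
Qed.
End EtaleReduced.

(** Two maps out of R / 2 R are equal once they agree on R, so unramifiedness passes to R / 2 R, and
    so do the generators. *)
Lemma etale_reduced_mod2 (R : algebra A) : etale R -> reduced_mod2 R.
Proof.
move=> [_ [k [f [_ [_ [fs _]]]]] Ru] x y e.
pose J (z : R) := exists t, z = 2%:R * t.
have JI : Quot.ideal J.
  split=> [|u v [a ->] [b ->]|a u [b ->]]; first by exists 0; rewrite mulr0.
    by exists (a + b); rewrite mulrDr.
  by exists (a * b); rewrite mulrCA.
pose S := quot_alg JI; pose cl := quot_hom JI.
have S2 : 2%:R = 0 :> S.
  by rewrite -(rmorph_nat cl); apply/quot_hom0P; exists 1; rewrite mulr1.
have Su : formally_unramified S.
  move=> T T' p g h psq gh z; have [r <-] := quot_hom_surj z.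
  by apply: (Ru _ _ p (alghom_comp g cl) (alghom_comp h cl) psq) => w; apply: gh.
apply/(quot_hom0P JI).
apply: (@unramified_reduced S S2 Su k (alghom_comp cl f)) => [z|].
  by have [r <-] := quot_hom_surj z; have [p <-] := fs r; exists p.
by rewrite -rmorphXn e; apply/quot_hom0P; exists y.
Qed.
End DyadicRing.

(** * Jordan splittings and adapted bases *)

Definition pow2_mx (R : pzRingType) n (w : 'I_n -> nat) : 'M[R]_n :=
  diag_mx (\row_i 2%:R ^+ w i).

Lemma mul_pow2_mx (R : pzRingType) m n (w : 'I_m -> nat) (M : 'M[R]_(m, n)) a b :
  (pow2_mx R w *m M) a b = 2%:R ^+ w a * M a b.
Proof. by rewrite mul_diag_mx !mxE. Qed.

Lemma mul_mx_pow2 (R : pzRingType) m n (w : 'I_n -> nat) (M : 'M[R]_(m, n)) a b :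
  (M *m pow2_mx R w) a b = M a b * 2%:R ^+ w b.
Proof. by rewrite mul_mx_diag !mxE. Qed.

Section JordanSplitting.
Variable A : idomainType.
Hypothesis two_neq0 : 2%:R != 0 :> A.
Hypothesis two_val : forall a : A, a != 0 ->
  exists k u, u \is a GRing.unit /\ a = 2%:R ^+ k * u.
Hypothesis two_max : unramified2 A.

Definition jordan_form n (B : 'M[A]_n) := exists g (w : 'I_n -> nat) U,
  [/\ g \in unitmx, U \in unitmx, g^T *m B *m g = pow2_mx _ w *m U &
      forall a b, w a != w b -> U a b = 0].

(** A is local with maximal ideal 2 A. *)
Lemma unit_sub2 (x y : A) : (x \is a GRing.unit) = false ->
  (y - x \is a GRing.unit) = (y \is a GRing.unit).
Proof.
move=> /negbT /two_max[a ->]; apply/idP/idP; apply: contraTT => /two_max[b].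
  by move=> ->; apply/two_max; exists (b - a); rewrite mulrBr.
move=> e; apply/two_max; exists (b + a); rewrite mulrDr -e subrK//.
Qed.

Lemma jordan_congr n (B g : 'M[A]_n) :
  g \in unitmx -> jordan_form (g^T *m B *m g) -> jordan_form B.
Proof.
move=> gu [h [w [U [hu Uu e Uw]]]]; exists (g *m h), w, U; split=> //.
  by rewrite unitmx_mul gu.
by rewrite -e trmx_mul !mulmxA.
Qed.

Lemma jordan_block m n (B1 : 'M[A]_m) (B2 : 'M[A]_n) :
  jordan_form B1 -> jordan_form B2 -> jordan_form (block_mx B1 0 0 B2).
Proof.
move=> [g1 [w1 [U1 [g1u U1u e1 U1w]]]] [g2 [w2 [U2 [g2u U2u e2 U2w]]]].
exists (block_mx g1 0 0 g2).
exists (fun i => match split i with inl j => w1 j | inr j => w2 j end).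
exists (block_mx U1 0 0 U2); split.
- by rewrite unitmxE det_ublock unitrM -!unitmxE g1u g2u.
- by rewrite unitmxE det_ublock unitrM -!unitmxE U1u U2u.
- rewrite tr_block_mx !trmx0 !mulmx_block !(mulmx0, mul0mx, addr0, add0r) e1 e2.
  apply/matrixP => i j; rewrite mul_pow2_mx !mxE.
  by case: (split i) => a; rewrite !mxE; case: (split j) => b;
    rewrite ?mul_pow2_mx ?mxE ?mulr0.
- move=> i j; rewrite mxE; case: (split i) => a; rewrite mxE;
  case: (split j) => b; rewrite ?mxE//.
    exact: U1w.
  exact: U2w.
Qed.

Lemma jordan_pow2 n k (U : 'M[A]_n) : U \in unitmx -> jordan_form (2%:R ^+ k *: U).
Proof.
move=> Uu; exists 1%:M, (fun=> k), U; rewrite unitmx1 Uu; split=> //.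
  rewrite trmx1 mul1mx mulmx1; apply/matrixP => i j.
  by rewrite mul_pow2_mx !mxE.
by move=> a b; rewrite eqxx.
Qed.

(** Block elimination, which leaves the Schur complement of P. *)
Lemma split_congr m n (P : 'M[A]_m) (Q : 'M_(m, n)) (S : 'M_n) :
  P \in unitmx -> P^T = P ->
  let g := block_mx 1%:M (- (invmx P *m Q)) 0 1%:M in
  g^T *m block_mx P Q Q^T S *m g = block_mx P 0 0 (S - Q^T *m invmx P *m Q).
Proof.
move=> Pu Ps g; rewrite /g tr_block_mx !trmx1 trmx0 linearN /= trmx_mul trmx_inv Ps.
rewrite !mulmx_block !(mulmx0, mul0mx, mulmx1, mul1mx, addr0, add0r).
rewrite !mulmxN !mulNmx !mulmxA mulmxV// mul1mx addNr.
by rewrite mulmxKV// addNr !mul0mx oppr0 add0r addrC.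
Qed.

(** After division by the largest common power of 2 some entry is a unit. If a diagonal entry is
    one, a block of size 1 splits off; otherwise the diagonal is even and a block of size 2 around
    an off-diagonal unit splits off. *)
Lemma jordan_exists n (B : 'M[A]_n) : B^T = B -> \det B != 0 -> jordan_form B.
Proof.
elim/ltn_ind: n B => -[|n] IH B Bs Bd.
  exists 1%:M, (fun=> 0%N), 1%:M; rewrite unitmx1; split=> //.
  by apply/matrixP => -[].
pose Q k := `[< exists i j u, u \is a GRing.unit /\ B i j = 2%:R ^+ k * u >].
have exQ : exists k, Q k.
  apply: contrapT => h; case/eqP: Bd; rewrite (_ : B = 0) ?det0//.
  apply/matrixP => i j; rewrite mxE; apply/eqP/negPn/negP => /two_val[k [u [uu e]]].
  by apply: h; exists k; apply/asboolP; exists i, j, u.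
case: (ex_minnP exQ) => k /asboolP[i0 [j0 [u0 [u0u Bu]]]] kmin.
have /choice[B'' B'E] (ij : 'I_n.+1 * 'I_n.+1) :
    exists b, B ij.1 ij.2 = 2%:R ^+ k * b.
  have [->|/two_val[l [u [uu e]]]] := eqVneq (B ij.1 ij.2) 0.
    by exists 0; rewrite mulr0.
  have kl : (k <= l)%N by apply: kmin; apply/asboolP; exists ij.1, ij.2, u.
  by exists (2%:R ^+ (l - k) * u); rewrite mulrA -exprD subnKC.
pose B' := \matrix_(i, j) B'' (i, j).
have BB' : B = 2%:R ^+ k *: B'.
  by apply/matrixP => i j; rewrite !mxE -(B'E (i, j)).
have p0 : 2%:R ^+ k != 0 :> A by rewrite expf_neq0.
have Bu' : B' i0 j0 \is a GRing.unit.
  by move: Bu; rewrite BB' mxE => /(mulfI p0) ->.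
have B's : B'^T = B'.
  apply/matrixP => i j; apply: (mulfI p0); move/matrixP: Bs => /(_ i j).
  by rewrite BB' !mxE.
clearbody B'; clear Bu B'' B'E kmin exQ Q.
have Jperm (s : 'S_n.+1) :
    jordan_form (2%:R ^+ k *: \matrix_(i, j) B' (s i) (s j)) -> jordan_form B.
  move=> h; apply: (@jordan_congr _ _ (perm_mx s)^T).
    by rewrite unitmx_tr unitmx_perm.
  rewrite trmxK BB' -scalemxAr -scalemxAl -row_permE.
  have -> : row_perm s B' *m (perm_mx s)^T = \matrix_(i, j) B' (s i) (s j) => //.
  rewrite tr_perm_mx -col_permE; apply/matrixP => i j.
  by rewrite !mxE.
have dperm (s : 'S_n.+1) :
    \det (2%:R ^+ k *: \matrix_(i, j) B' (s i) (s j)) != 0.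
  rewrite (_ : _ *: _ = perm_mx s *m B *m (perm_mx s)^T).
    rewrite !det_mulmx !mulf_neq0// ?det_tr; apply: contraTneq (unitmx_perm A s) => e;
    by rewrite unitmxE e unitr0.
  rewrite BB' tr_perm_mx -col_permE -row_permE.
  by apply/matrixP => i j; rewrite !mxE.
have Jstep m n' (C : 'M[A]_(m.+1 + n')) : (m.+1 + n' = n.+1)%N -> C^T = C ->
    ulsubmx C \in unitmx -> \det (2%:R ^+ k *: C) != 0 -> jordan_form (2%:R ^+ k *: C).
  move=> en Cs Pu dC.
  set P := ulsubmx C in Pu *; set Q := ursubmx C; set S := drsubmx C.
  have EC : C = block_mx P Q Q^T S.
    by rewrite -[LHS]submxK /P /Q /S -{3}Cs trmx_ursub.
  have Ps : P^T = P by rewrite trmx_ulsub Cs.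
  have Ss : S^T = S by rewrite trmx_drsub Cs.
  have := split_congr Q S Pu Ps; rewrite -EC /=.
  set g := block_mx _ _ _ _; set S' := S - _ => e.
  have {}e : g^T *m (2%:R ^+ k *: C) *m g =
      block_mx (2%:R ^+ k *: P) 0 0 (2%:R ^+ k *: S').
    by rewrite -scalemxAr -scalemxAl e scale_block_mx !scaler0.
  have gd : \det g = 1 by rewrite det_ublock !det1 mulr1.
  apply: (@jordan_congr _ _ g); first by rewrite unitmxE gd unitr1.
  rewrite e; apply: jordan_block; first exact: jordan_pow2.
  apply: IH; first by move: en; lia.
    rewrite linearZ /= linearB /= !trmx_mul trmxK trmx_inv Ps Ss mulmxA.
    by congr (_ *: (_ - _)).
  apply: contraNneq dC => d0.
  have := congr1 (fun M => \det M) e; rewrite det_ublock d0 mulr0.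
  by rewrite !det_mulmx det_tr gd mul1r mulr1 => ->.
have [[i iu]|nd] := pselect (exists i, B' i i \is a GRing.unit).
  apply: (Jperm (tperm ord0 i)).
  apply: (Jstep 0%N n (\matrix_(i', j') B' (tperm ord0 i i') (tperm ord0 i j'))) => //.
  - by apply/matrixP => i' j'; rewrite !mxE -{1}B's mxE.
  - rewrite unitmxE [ulsubmx _]mx11_scalar det_scalar1 !mxE.
    have -> : @lshift 1 n ord0 = (ord0 : 'I_n.+1) by apply: val_inj.
    by rewrite tpermL.
have ij0 : i0 != j0 by apply/eqP => e; apply: nd; exists i0; rewrite {2}e.
case: n IH B Bs Bd i0 j0 u0 u0u B' BB' Bu' B's Jperm dperm Jstep nd ij0.
  by move=> IH B Bs Bd i0 j0; rewrite !ord1 eqxx.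
move=> n IH B Bs Bd i0 j0 u0 u0u B' BB' Bu' B's Jperm dperm Jstep nd ij0.
pose s1 := tperm ord0 i0; pose b := s1 j0; pose o1 : 'I_n.+2 := lift ord0 ord0.
have b0 : b != ord0 by rewrite /b -(tpermR ord0 i0) -/s1 (inj_eq perm_inj) eq_sym.
pose s := (tperm o1 b * s1)%g.
have s0 : s ord0 = i0 by rewrite permM tpermD ?tpermL// eq_sym.
have s1E : s o1 = j0 by rewrite permM tpermL /b /s1 tpermK.
apply: (Jperm s).
apply: (Jstep 1%N n (\matrix_(i', j') B' (s i') (s j'))) => //.
  by apply/matrixP => i' j'; rewrite !mxE -{1}B's mxE.
rewrite unitmxE (expand_det_row _ ord0) !big_ord_recl big_ord0 /cofactor !det_mx11 !mxE.
have l0 : @lshift 2 n ord0 = (ord0 : 'I_n.+2) by apply: val_inj.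
have l1 : @lshift 2 n (lift ord0 ord0) = o1 by apply: val_inj.
have l2 : @lshift 2 n (lift (lift ord0 ord0) 0) = (ord0 : 'I_n.+2).
  exact: val_inj.
(* The determinant is a c - b ^ 2 with a even and b a unit. *)
rewrite l0 l1 l2 s0 s1E addr0 addrC -[X in _ + X]opprK unit_sub2.
  rewrite /= /bump /= expr1 -{2}B's mxE mulN1r mulrN unitrN unitrM.
  by rewrite Bu'.
apply/negbTE; rewrite unitrN unitrM; apply/negP => /andP[iu _].
by apply: nd; exists i0.
Qed.
End JordanSplitting.

(** * Divisibility by powers of 2 *)

Section Dvd2.
Variable R : comPzRingType.
Implicit Types x y : R.

Definition dvd2 k x := exists c, x = 2%:R ^+ k * c.

Lemma dvd2_0 x : dvd2 0 x. Proof. by exists x; rewrite mul1r. Qed.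

Lemma dvd20 k : dvd2 k 0. Proof. by exists 0; rewrite mulr0. Qed.

Lemma dvd2_exp k x : dvd2 k (2%:R ^+ k * x). Proof. by exists x. Qed.

Lemma dvd2D k x y : dvd2 k x -> dvd2 k y -> dvd2 k (x + y).
Proof. by move=> [c ->] [d ->]; exists (c + d); rewrite mulrDr. Qed.

Lemma dvd2N k x : dvd2 k x -> dvd2 k (- x).
Proof. by move=> [c ->]; exists (- c); rewrite mulrN. Qed.

Lemma dvd2B k x y : dvd2 k x -> dvd2 k y -> dvd2 k (x - y).
Proof. by move=> hx hy; apply/dvd2D/dvd2N. Qed.

Lemma dvd2M k l x y : dvd2 k x -> dvd2 l y -> dvd2 (k + l) (x * y).
Proof. by move=> [c ->] [d ->]; exists (c * d); rewrite exprD; ring. Qed.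

Lemma dvd2_mull k x y : dvd2 k y -> dvd2 k (x * y).
Proof. by move=> [c ->]; exists (x * c); rewrite mulrCA. Qed.

Lemma dvd2_mulr k x y : dvd2 k x -> dvd2 k (x * y).
Proof. by move=> h; rewrite mulrC; apply: dvd2_mull. Qed.

Lemma dvd2_le k l x : (l <= k)%N -> dvd2 k x -> dvd2 l x.
Proof.
by move=> lk [c ->]; exists (2%:R ^+ (k - l) * c); rewrite mulrA -exprD subnKC.
Qed.

Lemma dvd2_sum (I : finType) (P : pred I) k (f : I -> R) :
  (forall i, P i -> dvd2 k (f i)) -> dvd2 k (\sum_(i | P i) f i).
Proof.
move=> h; apply: (@big_rec _ (dvd2 k)) => [|i x Pi hx]; first exact: dvd20.
by apply: dvd2D => //; apply: h.
Qed.

Lemma dvd2_mx m p q k (M : 'M[R]_(m, p)) (N : 'M[R]_(p, q)) :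
  (forall i j, dvd2 k (N i j)) -> forall i j, dvd2 k ((M *m N) i j).
Proof. by move=> h i j; rewrite mxE; apply: dvd2_sum => l _; apply: dvd2_mull. Qed.

Hypothesis tf : torsion_free R.

Lemma exp2I k : injective (fun x => 2%:R ^+ k * x).
Proof.
move=> x y /eqP; rewrite -subr_eq0 -mulrBr => /eqP /(torsion_freeX tf)/eqP.
by rewrite subr_eq0 => /eqP.
Qed.

Lemma dvd2_cancel k l x : dvd2 (k + l) (2%:R ^+ k * x) -> dvd2 l x.
Proof. by move=> [c]; rewrite exprD -mulrA => /exp2I ->; exists c. Qed.
End Dvd2.

(** * Quadratic forms modulo powers of 2 *)

Section QuadraticForms.
Variables (R : comPzRingType) (n : nat).

Lemma double_sum (s : 'I_n -> 'I_n -> R) : \sum_a \sum_b s a b =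
  \sum_a s a a + \sum_(a < n) \sum_(b < n | (b < a)%N) (s a b + s b a).
Proof.
have -> : \sum_(a < n) \sum_(b < n) s a b =
   \sum_(a < n) (s a a + (\sum_(b < n | (b < a)%N) s a b +
   \sum_(b < n | (a < b)%N) s a b)).
  apply: eq_bigr => a _; rewrite (bigD1 a)//=; congr (_ + _).
  rewrite (bigID (fun b : 'I_n => (b < a)%N)) /=; congr (_ + _); apply: eq_bigl => b.
    by rewrite -val_eqE neq_ltn; case: ltngtP.
  by rewrite -val_eqE neq_ltn; case: ltngtP.
rewrite !big_split /=; congr (_ + _).
under [in RHS]eq_bigr => a _ do rewrite big_split /=.
rewrite [RHS]big_split /=; congr (_ + _).
by rewrite [RHS](exchange_big_dep predT).
Qed.

Lemma double_sum_sym (s : 'I_n -> 'I_n -> R) : (forall a b, s a b = s b a) ->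
  \sum_a \sum_b s a b =
  \sum_a s a a + 2%:R * \sum_(a < n) \sum_(b < n | (b < a)%N) s a b.
Proof.
move=> sym; rewrite double_sum; congr (_ + _); rewrite mulr_sumr.
apply: eq_bigr => a _; rewrite mulr_sumr; apply: eq_bigr => b _.
by rewrite (sym b a); ring.
Qed.

(** Cross terms occur twice, so modulo 2 ^ (m + 1) only the diagonal counts, and a sum of squares is
    the square of the sum modulo 2. *)
Lemma quad_form_mod (S : 'M[R]_n) (x : 'cV[R]_n) m (z : 'I_n -> R) :
  S^T = S -> (forall a b, dvd2 m (x a 0 * S a b * x b 0)) ->
  (forall a, dvd2 m.+1 (S a a * x a 0 ^+ 2 - 2%:R ^+ m * z a ^+ 2)) ->
  exists c, (x^T *m S *m x) 0 0 = 2%:R ^+ m * ((\sum_a z a) ^+ 2 + 2%:R * c).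
Proof.
move=> Ss hd hz.
have -> : (x^T *m S *m x) 0 0 = \sum_a \sum_b x a 0 * S a b * x b 0.
  rewrite mxE exchange_big; apply: eq_bigr => b _.
  by rewrite mxE mulr_suml; apply: eq_bigr => a _; rewrite !mxE.
rewrite double_sum_sym; last first.
  by move=> a b; rewrite -{1}Ss mxE; ring.
have [c ->] : dvd2 m (\sum_(a < n) \sum_(b < n | (b < a)%N) x a 0 * S a b * x b 0).
  by apply: dvd2_sum => a _; apply: dvd2_sum => b _.
have [d dE] := choice hz.
have -> : \sum_a x a 0 * S a a * x a 0 = \sum_a (2%:R ^+ m * z a ^+ 2 + 2%:R ^+ m.+1 * d a).
  by apply: eq_bigr => a _; rewrite -dE; ring.
rewrite big_split /= -!mulr_sumr expr2 big_distrlr /=.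
rewrite (double_sum_sym (s := fun a b => z a * z b)); last by move=> a b; apply: mulrC.
exists (\sum_a d a + c - \sum_(a < n) \sum_(b < n | (b < a)%N) z a * z b).
by rewrite exprS; ring.
Qed.
End QuadraticForms.

Section Adapted.
Variables (R : comPzRingType) (n : nat) (w : 'I_n -> nat) (E : {set 'I_n}).
Variables (U V : 'M[R]_n).
Hypothesis tf : torsion_free R.
Hypothesis Usym : U^T = U.
Hypothesis Ublock : forall a b, w a != w b -> U a b = 0.
Hypothesis UV : U *m V = 1%:M.
Hypothesis VU : V *m U = 1%:M.
Hypothesis Udiag : forall a, dvd2 1 (U a a - (\sum_(b in E) U a b) ^+ 2).

(** The pairing under U of the a-th basis vector with the sum of the basis vectors in E, which
    [Udiag] makes a characteristic vector of the form U. *)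
Let r a := \sum_(b in E) U a b.
Let D : 'M[R]_n := pow2_mx R w.
Let G := D *m U.

Lemma Vsym : V^T = V.
Proof. by rewrite -[LHS]mulmx1 -UV mulmxA -{1}Usym -trmx_mul UV trmx1 mul1mx. Qed.

Lemma pow2_comm : D *m U = U *m D.
Proof.
apply/matrixP => a b; rewrite mul_pow2_mx mul_mx_pow2.
by have [->|/Ublock ->] := eqVneq (w a) (w b); rewrite ?mulr0 ?mul0r// mulrC.
Qed.

(** U commutes with the projector [P] onto a block, hence so does its inverse. *)
Lemma Vblock a b : w a != w b -> V a b = 0.
Proof.
move=> wab; pose P : 'M[R]_n := diag_mx (\row_c (w c == w b)%:R).
have PU : P *m U = U *m P.
  apply/matrixP => c d; rewrite mul_diag_mx mul_mx_diag !mxE.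
  by have [->|/Ublock ->] := eqVneq (w c) (w d); rewrite ?mulr0 ?mul0r// mulrC.
have /matrixP/(_ a b) : V *m P = P *m V.
  by rewrite -[LHS]mulmx1 -UV -mulmxA (mulmxA P U V) PU !mulmxA VU mul1mx.
by rewrite mul_diag_mx mul_mx_diag !mxE eqxx mulr1 (negbTE wab) mul0r.
Qed.

Lemma Gsym : G^T = G.
Proof. by rewrite trmx_mul Usym tr_diag_mx -pow2_comm. Qed.

Lemma GE a b : G a b = 2%:R ^+ w a * U a b.
Proof. exact: mul_pow2_mx. Qed.

(** The form U takes the value V c c at the dual basis vector V e_c, whose pairing with the
    characteristic vector is 1 or 0 according to whether c is in E. *)
Lemma Vdiag c : dvd2 1 (V c c - (c \in E)%:R).
Proof.
pose x := col c V.
have [d] : exists d, (x^T *m U *m x) 0 0 = 2%:R ^+ 0 * ((\sum_a r a * x a 0) ^+ 2 + 2%:R * d).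
  apply: quad_form_mod => // [a b|a]; first exact: dvd2_0.
  rewrite mul1r exprMn -mulrBl; exact/dvd2_mulr/Udiag.
have -> : x^T *m U *m x = x^T *m delta_mx c 0.
  by rewrite -mulmxA /x colE (mulmxA U) UV mul1mx.
have -> : \sum_a r a * x a 0 = (c \in E)%:R.
  rewrite (eq_bigr (fun a => \sum_(b in E) U b a * V a c)); last first.
    move=> a _; rewrite mulr_suml; apply: eq_bigr => b _.
    by rewrite !mxE -{1}Usym mxE.
  rewrite exchange_big /= (eq_bigr (fun b => (b == c)%:R)); last first.
    by move=> b _; move/matrixP: UV => /(_ b c); rewrite !mxE.
  have [cE|cE] := boolP (c \in E); last first.
    by rewrite big1// => b bE; case: eqP bE cE => [->->|//].
  by rewrite (bigD1 c)//= eqxx big1 ?addr0// => b /andP[_ /negbTE ->].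
rewrite mxE (bigD1 c)//= !mxE eqxx mulr1 big1 ?addr0 ?mul1r; last first.
  by move=> a /negbTE ac; rewrite !mxE ac mulr0.
move=> ->; exists d; case: (c \in E) => /=; ring.
Qed.

(* 2 ^ i times the value of the block E_i on x. *)
Definition lin i (x : 'cV[R]_n) := \sum_(a in E | w a == i) (U *m x) a 0.

Lemma lin_row i x : lin i x = \sum_(b | w b == i) r b * x b 0.
Proof.
rewrite /lin (eq_bigr (fun a => \sum_(b | w b == i) U a b * x b 0)); last first.
  move=> a /andP[_ /eqP wa]; rewrite mxE (bigID (fun b => w b == i)) /=.
  rewrite [X in _ + X]big1 ?addr0// => b wb.
  by rewrite Ublock ?mul0r// wa eq_sym.
rewrite exchange_big /=; apply: eq_bigr => b /eqP wb.
rewrite [RHS]mulr_suml [RHS](bigID (fun a => w a == i)) /= [X in _ = _ + X]big1 ?addr0 => [|a].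
  by apply: eq_bigr => a _; rewrite -{1}Usym mxE.
by move=> /andP[_ wa]; rewrite Ublock ?mul0r// wb eq_sym.
Qed.

(** The lattices [A_i] and [X_i] in Jordan coordinates, over any algebra. *)
Definition in_A i (x : 'cV[R]_n) := forall a, dvd2 i (2%:R ^+ w a * x a 0).
Definition in_X i (x : 'cV[R]_n) := in_A i x /\ forall a, w a = i -> dvd2 1 (x a 0).

Lemma in_A_lt i x a : in_A i x -> dvd2 (i - w a) (x a 0).
Proof.
move=> /(_ a); have [wi|/ltnW iw] := leqP (w a) i; last first.
  by move=> _; move: iw; rewrite -subn_eq0 => /eqP ->; apply: dvd2_0.
by rewrite -{1}(subnKC wi) => /(dvd2_cancel tf).
Qed.

Lemma in_AP i x : in_A i x <-> forall a, dvd2 i ((G *m x) a 0).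
Proof.
have e : G *m x = U *m (D *m x) by rewrite mulmxA -pow2_comm.
have DE a : (D *m x) a 0 = 2%:R ^+ w a * x a 0 by rewrite mul_pow2_mx.
split=> h a.
  by rewrite e; apply: dvd2_mx => b c; rewrite (ord1 c) DE.
have {}e : D *m x = V *m (G *m x) by rewrite e mulmxA VU mul1mx.
by rewrite -DE e; apply: dvd2_mx => b c; rewrite (ord1 c).
Qed.

(** Modulo 2 ^ (i + 1) only block i contributes: coordinates in a block w < i are divisible by 2 ^
    (i - w), and blocks w > i carry the factor 2 ^ w. *)
Lemma quad_A i x : in_A i x ->
  exists c, (x^T *m G *m x) 0 0 = 2%:R ^+ i * (lin i x ^+ 2 + 2%:R * c).
Proof.
move=> xA; rewrite lin_row big_mkcond /=; apply: quad_form_mod => [|a b|a].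
- exact: Gsym.
- rewrite GE (_ : _ * _ = (2%:R ^+ w a * x a 0) * (U a b * x b 0)); last by ring.
  exact/dvd2_mulr/xA.
- rewrite GE; case: eqP => [<-|/eqP wa].
    rewrite (_ : _ - _ = 2%:R ^+ w a * ((U a a - r a ^+ 2) * x a 0 ^+ 2)); last by ring.
    rewrite -addn1; apply: dvd2M; last exact/dvd2_mulr/Udiag.
    by exists 1; rewrite mulr1.
  rewrite expr0n mulr0 subr0.
  have [wi|iw] := ltnP (w a) i; last first.
    apply/dvd2_mulr/dvd2_mulr; apply: (@dvd2_le _ (w a)); first by rewrite ltn_neqAle eq_sym wa.
    by exists 1; rewrite mulr1.
  rewrite (_ : _ * _ = U a a * ((2%:R ^+ w a * x a 0) * x a 0)); last by ring.
  apply/dvd2_mull; rewrite -addn1; apply: dvd2M; first exact: xA.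
  by apply: dvd2_le (in_A_lt a xA); rewrite subn_gt0.
Qed.

(** On [X_i] the coordinates in blocks i - 1 and i are even. Modulo 2 ^ (i + 2), block i drops out,
    block i - 1 contributes 2 ^ (i + 1) u ^ 2, and block i + 1 its own square; this is where blocks
    at distance 2 interact. *)
Lemma quad_X i x u : in_X i x -> 2%:R * u = \sum_(a in E | (w a).+1 == i) (U *m x) a 0 ->
  exists c, (x^T *m G *m x) 0 0 = 2%:R ^+ i.+1 * ((u + lin i.+1 x) ^+ 2 + 2%:R * c).
Proof.
move=> [xA xX] uE.
have /choice[y yE] a : exists y, (w a).+1 = i -> x a 0 = 2%:R * y.
  have [wa|wa] := eqVneq (w a).+1 i; last by exists 0 => e; rewrite e eqxx in wa.
  by have := in_A_lt a xA; rewrite -wa subSn// subnn => -[y ->]; exists y; rewrite expr1.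
have -> : u = \sum_(a | (w a).+1 == i) r a * y a.
  apply: (exp2I tf (k := 1)); rewrite /= expr1 uE mulr_sumr.
  case: i {xA xX} yE {uE} => [|i] yE; first by rewrite !big_pred0// => a; rewrite andbF.
  transitivity (lin i x); first by apply: eq_bigl => a; rewrite eqSS.
  rewrite lin_row; apply: eq_big => [a|a /eqP wa]; first by rewrite eqSS.
  by rewrite yE ?wa//; ring.
pose zt a := (if (w a).+1 == i then r a * y a else 0) +
  (if w a == i.+1 then r a * x a 0 else 0).
have -> : \sum_(a | (w a).+1 == i) r a * y a + lin i.+1 x = \sum_a zt a.
  by rewrite lin_row big_mkcond [X in _ + X]big_mkcond -big_split.
apply: quad_form_mod => [|a b|a]; first exact: Gsym.
- have [wab|/Ublock Uab] := eqVneq (w a) (w b); last first.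
    by rewrite GE Uab !(mulr0, mul0r); apply: dvd20.
  rewrite GE (_ : _ * _ = (2%:R ^+ w a * x a 0) * (U a b * x b 0)); last by ring.
  rewrite -addn1; have [wi|iw|wi] := ltngtP (w a) i.
  + apply: dvd2M (xA a) _; apply/dvd2_mull; apply: dvd2_le (in_A_lt b xA).
    by rewrite subn_gt0 -wab.
  + by rewrite addn1; apply/dvd2_mulr/dvd2_mulr/(dvd2_le iw); exists 1; rewrite mulr1.
  + by apply: dvd2M (xA a) _; apply/dvd2_mull/xX; rewrite -wab.
- have dw (m p : nat) (y0 : R) : (m <= p)%N -> dvd2 m (2%:R ^+ p * y0).
    by move=> mp; apply/dvd2_mulr/(dvd2_le mp); exists 1; rewrite mulr1.
  have UU (y0 : R) : 2%:R ^+ i.+1 * (U a a * y0 ^+ 2) - 2%:R ^+ i.+1 * (r a * y0) ^+ 2 =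
      2%:R ^+ i.+1 * ((U a a - r a ^+ 2) * y0 ^+ 2) by ring.
  have dU (y0 : R) : dvd2 i.+2 (2%:R ^+ i.+1 * ((U a a - r a ^+ 2) * y0 ^+ 2)).
    rewrite -[i.+2]addn1; apply: dvd2M; last exact/dvd2_mulr/Udiag.
    by exists 1; rewrite mulr1.
  rewrite GE /zt; have [wa|wa] := eqVneq (w a) i.+1.
    rewrite ifN; last by rewrite wa neq_ltn; apply/orP; right; lia.
    by rewrite wa add0r -mulrA UU.
  rewrite addr0; have [wai|wai] := eqVneq (w a).+1 i.
    rewrite yE// (_ : _ * _ = 2%:R ^+ (w a).+2 * (U a a * y a ^+ 2)); last first.
      by rewrite !exprS; ring.
    by rewrite wai UU.
  rewrite expr0n mulr0 subr0 -mulrA.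
  have [wi|iw|wi] := ltngtP (w a) i.
  + rewrite (_ : _ * _ = U a a * ((2%:R ^+ w a * x a 0) * x a 0)); last by ring.
    apply/dvd2_mull; rewrite -[i.+2]addn2; apply: dvd2M (xA a) _.
    by apply: dvd2_le (in_A_lt a xA); move: wai wi => /eqP; lia.
  + by apply: dw; rewrite ltn_neqAle eq_sym wa.
  + have [z ->] := xX _ wi; rewrite wi; exists (U a a * z ^+ 2).
    by rewrite !exprS; ring.
Qed.
End Adapted.

Section AdaptedForm.
Variable A : idomainType.
Hypothesis two_neq0 : 2%:R != 0 :> A.
Hypothesis two_val : forall a : A, a != 0 ->
  exists k u, u \is a GRing.unit /\ a = 2%:R ^+ k * u.
Hypothesis two_max : unramified2 A.
Hypothesis two_sqrt : forall a : A, exists b c, a = b ^+ 2 + 2%:R * c.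

Lemma jordan_sym n (w : 'I_n -> nat) (U : 'M[A]_n) :
  (pow2_mx A w *m U)^T = pow2_mx A w *m U ->
  (forall a b, w a != w b -> U a b = 0) -> U^T = U.
Proof.
move=> h Uw; apply/matrixP => a b; rewrite mxE.
have [wab|wab] := eqVneq (w a) (w b); last by rewrite !Uw// eq_sym.
move/matrixP: h => /(_ a b); rewrite mxE !mul_pow2_mx wab => /mulfI; apply.
by rewrite expf_neq0.
Qed.

(* In each Jordan block take for basis vector a lift of the vector e of the
   block with b(v, e) ^ 2 = q(v) mod 2, when e is not zero. *)
Lemma adapted_exists n (B : 'M[A]_n) : B^T = B -> \det B != 0 ->
  exists g (w : 'I_n -> nat) U (E : {set 'I_n}),
  [/\ g \in unitmx, U \in unitmx, g^T *m B *m g = pow2_mx A w *m U &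
      [/\ U^T = U, forall a b, w a != w b -> U a b = 0, {in E &, injective w} &
          forall a, dvd2 1 (U a a - (\sum_(b in E) U a b) ^+ 2)]].
Proof.
move=> Bs Bd; have [g [w [U [gu Uu gB Uw]]]] :=
  jordan_exists two_neq0 two_val two_max Bs Bd.
have Us : U^T = U.
  by apply: jordan_sym Uw; rewrite -gB !trmx_mul trmxK Bs mulmxA.
have /choice[r /choice[c0 rE]] a := two_sqrt (U a a).
(* Since r a ^ 2 is U a a modulo 2, this vector [e] satisfies U(v, e) ^ 2 = U(v, v) modulo 2. *)
have [e Ue] : exists e, U *m e = \col_a r a.
  by exists (invmx U *m \col_a r a); rewrite mulmxA mulmxV// mul1mx.
(* One index for each block in which [e] has a unit coordinate: the first such index. *)
pose E : {set 'I_n} := [set a | (e a 0 \is a GRing.unit) &&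
  [forall b : 'I_n, (w b == w a) ==> (e b 0 \is a GRing.unit) ==> (a <= b)%N]].
have Ew : {in E &, injective w}.
  move=> a b; rewrite !inE => /andP[ea /forallP/(_ b)] + /andP[eb /forallP/(_ a)].
  move=> + + wab; rewrite wab eqxx ea eb /= => ab ba.
  by apply/val_inj/eqP; rewrite eqn_leq ab ba.
have Eex a : e a 0 \is a GRing.unit -> exists2 b, b \in E & w b = w a.
  move=> ea; pose Q (b : 'I_n) := (w b == w a) && (e b 0 \is a GRing.unit).
  have Qa : Q a by rewrite /Q eqxx.
  case: (arg_minnP (fun b : 'I_n => b : nat) Qa) => b /andP[/eqP wb eb] bmin.
  exists b => //; rewrite inE eb; apply/forallP => c.
  apply/implyP => /eqP wc; apply/implyP => ec; apply: bmin.
  by rewrite /Q wc wb eqxx.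
(* The basis vector b in E is replaced by the component of [e] in its block; this is invertible
   because the b-th coordinate of [e] is a unit, and [h] below is the inverse. *)
pose g1 : 'M[A]_n := \matrix_(a, b)
  if b \in E then (if w a == w b then e a 0 else 0) else (a == b)%:R.
pose h : 'M[A]_n := \matrix_(a, b)
  if b \in E then (if w a == w b then
    (if a == b then (e b 0)^-1 else - e a 0 / e b 0) else 0) else (a == b)%:R.
have g1w a b : w a != w b -> g1 a b = 0.
  move=> wab; rewrite mxE; case: ifP => _; first by rewrite (negbTE wab).
  by have [eab|//] := eqVneq a b; rewrite eab eqxx in wab.
have hg1 : h *m g1 = 1%:M.
  apply/matrixP => a b; rewrite !mxE.
  have [bE|bE] := boolP (b \in E); last first.
    rewrite (bigD1 b)//= big1 => [|c /negbTE cb].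
      by rewrite !mxE (negbTE bE) eqxx mulr1 addr0.
    by rewrite !mxE (negbTE bE) cb mulr0.
  have eb : e b 0 \is a GRing.unit by move: bE; rewrite inE => /andP[].
  rewrite (bigD1 b)//= !mxE bE eqxx.
  have -> : \sum_(c | c != b) h a c * g1 c b =
     (if (a != b) && (w a == w b) then e a 0 else 0).
    rewrite (eq_bigr (fun c => (a == c)%:R * (if w c == w b then e c 0 else 0))).
      have [->|ab] /= := eqVneq a b.
        by rewrite big1// => c /negbTE cb; rewrite eq_sym cb mul0r.
      rewrite (bigD1 a)//= eqxx mul1r big1 ?addr0// => c /andP[_ /negbTE ca].
      by rewrite eq_sym ca mul0r.
    move=> c cb; rewrite [g1 c b]mxE bE; case: ifP => [/eqP wcb|_]; last by rewrite !mulr0.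
    by rewrite mxE; case: ifP => // cE; case/eqP: cb; apply: Ew.
  have [->|ab] /= := eqVneq a b; first by rewrite eqxx addr0 mulVr.
  by case: ifP => _; rewrite ?mul0r ?addr0// divrK// addNr.
have [hu g1u] := mulmx1_unit hg1.
pose U1 := g1^T *m U *m g1.
have DE : g1^T *m pow2_mx A w = pow2_mx A w *m g1^T.
  apply/matrixP => a b; rewrite mul_pow2_mx mul_mx_pow2 mxE.
  by have [->|/g1w ->] := eqVneq (w b) (w a); rewrite ?mulr0 ?mul0r// mulrC.
exists (g *m g1), w, U1, E; split.
- by rewrite unitmx_mul gu.
- by rewrite !unitmx_mul unitmx_tr g1u Uu.
- by rewrite trmx_mul !mulmxA -(mulmxA g1^T) -(mulmxA g1^T) gB mulmxA DE -!mulmxA.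
split=> //.
- by rewrite !trmx_mul trmxK Us mulmxA.
- move=> a b wab; rewrite mxE big1// => c _; rewrite mxE mulr_suml big1// => d _.
  have [wdc|wdc] := eqVneq (w d) (w c); last by rewrite Uw// mulr0 mul0r.
  have [wcb|wcb] := eqVneq (w c) (w b); last by rewrite g1w// mulr0.
  by rewrite mxE g1w ?mul0r// wdc wcb eq_sym.
move=> a; pose x := col a g1.
have [d dE] : exists d, (x^T *m U *m x) 0 0 = 2%:R ^+ 0 * ((\sum_b r b * x b 0) ^+ 2 + 2%:R * d).
  apply: quad_form_mod => // [b b'|b]; first exact: dvd2_0.
  by rewrite mul1r exprMn -mulrBl rE addrC addKr; apply/dvd2_mulr; exists (c0 b).
have -> : U1 a a = (x^T *m U *m x) 0 0.
  rewrite !mxE; apply: eq_bigr => b _; rewrite [x b 0]mxE; congr (_ * _).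
  by rewrite !mxE; apply: eq_bigr => c _; rewrite !mxE.
(* In a block that meets E the component of [e] is the new basis vector; in the other blocks all
   coordinates of [e] are even. *)
have [z ze] : exists z : 'cV[A]_n, e = g1 *m (\col_b (b \in E)%:R) + 2%:R *: z.
  have /choice[z zE] b : exists z, e b 0 - (g1 *m (\col_b (b \in E)%:R)) b 0 = 2%:R * z.
    have -> : (g1 *m (\col_b (b \in E)%:R)) b 0 = \sum_(c in E | w b == w c) e b 0.
      rewrite mxE [RHS]big_mkcondr [RHS]big_mkcond; apply: eq_bigr => c _; rewrite !mxE.
      by case: ifP => _; rewrite ?mulr0// mulr1.
    have [/Eex[c cE wc]|/two_max[z ->]] := boolP (e b 0 \is a GRing.unit).
      exists 0; rewrite (bigD1 c) ?cE ?wc ?eqxx//= big1 ?addr0 ?subrr ?mulr0//.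
      move=> c' /andP[/andP[c'E /eqP wc'] /eqP[]]; apply: Ew => //.
      by rewrite -wc' wc.
    rewrite sumr_const; exists (z - z *+ #|[pred c in E | w b == w c]|).
    by rewrite mulrBr mulrnAr.
  exists (\col_b z b); apply/matrixP => b j; rewrite (ord1 j) [RHS]mxE.
  by rewrite [X in _ + X]mxE [X in _ + _ * X]mxE -zE addrC subrK.
have -> : \sum_(b in E) U1 a b = \sum_b r b * x b 0 - 2%:R * (x^T *m U *m z) 0 0.
  have -> : \sum_b r b * x b 0 = (x^T *m (U *m e)) 0 0.
    by rewrite Ue mxE; apply: eq_bigr => b _; rewrite !mxE mulrC.
  rewrite ze mulmxDr mulmxDr -!scalemxAr [(_ + _ : 'M_1) 0 0]mxE.
  rewrite [(_ *: _ : 'M_1) 0 0]mxE !mulmxA addrK mxE big_mkcond /=.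
  apply: eq_bigr => b _; rewrite [(\col__ _) b 0]mxE.
  have -> : (x^T *m U *m g1) 0 b = U1 a b.
    rewrite !mxE; apply: eq_bigr => c _; congr (_ * _).
    by rewrite !mxE; apply: eq_bigr => c' _; rewrite !mxE.
  by case: ifP; rewrite ?mulr1 ?mulr0.
rewrite dE; set s := \sum_b _; set t := (_ *m z) 0 0.
by exists (d + 2%:R * s * t - 2%:R * t ^+ 2); ring.
Qed.
End AdaptedForm.

(** * The monoid law and the equations of the stabilizer *)

Section Exponents.
Variables (n : nat) (w : 'I_n -> nat) (E : {set 'I_n}).

(* The congruence subgroup of the lattice of bilinear forms satisfying the
   conditions that define the monoid: entry (a, b) is divisible by 2 ^ theta. *)
Definition theta a b : nat := maxn (w a) (w b) +
  ((w a == w b) && ((a \in E) || (b \in E)) ||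
   [&& a \in E, b \in E & ((w a).+1 == w b) || ((w b).+1 == w a)]).

Lemma theta_sym a b : theta a b = theta b a.
Proof. by rewrite /theta; case: (a \in E); case: (b \in E) => /=; lia. Qed.

Lemma theta_ge a b : (w a <= theta a b)%N.
Proof. by rewrite /theta; lia. Qed.

(** This inequality makes the composition of two endomorphisms integral in the coordinates y. *)
Lemma theta_mul a b c d : w c = w d -> (theta a b + w c <= theta a c + theta d b)%N.
Proof.
rewrite /theta => wcd.
by case: (a \in E); case: (b \in E); case: (c \in E); case: (d \in E) => /=; lia.
Qed.

(** Strictness supplies the factor 2 in the coefficient of y_ca ^ 2 when V c c may be a unit. *)
Lemma theta_diag a c : c \in E -> (theta a a + w c < theta a c + theta c a)%N.
Proof. by rewrite /theta => ->; case: (a \in E) => /=; lia. Qed.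

Section Star.
Variables (R : comPzRingType) (V hV : 'M[R]_n).
Hypothesis Vsym : V^T = V.
Hypothesis Vblock : forall a b, w a != w b -> V a b = 0.

Local Notation th := theta.

(** The subtraction does not truncate when w c = w d, by [theta_mul]; otherwise the entry of V is
    0. *)
Definition coef a c d b := 2%:R ^+ (th a c + th d b - w c - th a b) * V c d.

Lemma coef_neq a c d b : w c != w d -> coef a c d b = 0.
Proof. by move=> /Vblock e; rewrite /coef e mulr0. Qed.

Lemma coef_sym a c d b : coef a c d b = coef b d c a.
Proof.
have [wcd|wcd] := eqVneq (w c) (w d); last by rewrite !coef_neq// eq_sym.
rewrite /coef -{1}Vsym mxE !(theta_sym _ b) !(theta_sym _ a) wcd; congr (_ ^+ _ * _).
by rewrite addnC.
Qed.

(* The composition law of the monoid, in the coordinates of the lattice of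
   bilinear forms. *)
Definition star (y z : 'M[R]_n) : 'M[R]_n :=
  \matrix_(a, b) \sum_c \sum_d coef a c d b * y a c * z d b.

Lemma starDl x y z : star (x + y) z = star x z + star y z.
Proof.
apply/matrixP => a b; rewrite !mxE -big_split; apply: eq_bigr => c _.
by rewrite -big_split; apply: eq_bigr => d _; rewrite /= mxE; ring.
Qed.

Lemma starDr x y z : star x (y + z) = star x y + star x z.
Proof.
apply/matrixP => a b; rewrite !mxE -big_split; apply: eq_bigr => c _.
by rewrite -big_split; apply: eq_bigr => d _; rewrite /= mxE; ring.
Qed.

Lemma star_tr y z : (star y z)^T = star z^T y^T.
Proof.
apply/matrixP => a b; rewrite !mxE exchange_big; apply: eq_bigr => c _.
by apply: eq_bigr => d _; rewrite coef_sym !mxE; ring.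
Qed.

(** Both sides carry the exponent of the triple product: the thetas of (a, e), (f, c) and (d, b),
    less w e, w c and the theta of (a, b). *)
Lemma coef_mul a e f c d b :
  coef a c d b * coef a e f c = coef a e f b * coef f c d b.
Proof.
have [wcd|wcd] := eqVneq (w c) (w d); last by rewrite !(coef_neq _ _ wcd) ?mulr0 ?mul0r.
have [wef|wef] := eqVneq (w e) (w f); last by rewrite !(coef_neq _ _ wef) ?mulr0 ?mul0r.
rewrite /coef mulrACA [RHS]mulrACA -!exprD [V c d * _]mulrC; congr (_ ^+ _ * _).
have := theta_mul a b wcd; have := theta_mul a c wef.
have := theta_mul a b wef; have := theta_mul f b wcd.
by lia.
Qed.

Lemma starA x y z : star (star x y) z = star x (star y z).
Proof.
apply/matrixP => a b; rewrite !mxE.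
transitivity (\sum_c \sum_d \sum_e \sum_f
    (coef a e f b * coef f c d b) * (x a e * y f c * z d b)).
  apply: eq_bigr => c _; apply: eq_bigr => d _.
  rewrite mxE mulr_sumr mulr_suml; apply: eq_bigr => e _.
  rewrite mulr_sumr mulr_suml; apply: eq_bigr => f _.
  by rewrite -coef_mul; ring.
under eq_bigr => c _ do rewrite exchange_big.
rewrite exchange_big; apply: eq_bigr => e _ /=.
under eq_bigr => c _ do rewrite exchange_big.
rewrite exchange_big; apply: eq_bigr => f _ /=.
rewrite mxE mulr_sumr; apply: eq_bigr => c _.
by rewrite mulr_sumr; apply: eq_bigr => d _; ring.
Qed.

Lemma star_eq0 (y z : 'M[R]_n) : (forall a b c d, y a b * z c d = 0) -> star y z = 0.
Proof.
move=> yz; apply/matrixP => a b; rewrite !mxE big1// => c _; rewrite big1// => d _.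
by rewrite -mulrA yz mulr0.
Qed.

Hypothesis hVE : forall a c, 2%:R * hV a c = coef a c c a.

(* Half of the diagonal entries of y^T * y. *)
Definition half_diag (y : 'M[R]_n) a := \sum_c hV a c * y c a ^+ 2 +
  \sum_(c < n) \sum_(d < n | (d < c)%N) coef a c d a * y c a * y d a.

Lemma star_diag (y z : 'M[R]_n) a : (star y^T z) a a =
  \sum_c 2%:R * hV a c * y c a * z c a + \sum_(c < n) \sum_(d < n | (d < c)%N)
    coef a c d a * (y c a * z d a + y d a * z c a).
Proof.
rewrite mxE (eq_bigr (fun c => \sum_d coef a c d a * y c a * z d a)); last first.
  by move=> c _; apply: eq_bigr => d _; rewrite mxE.
rewrite double_sum; congr (_ + _); first by apply: eq_bigr => c _; rewrite hVE.
apply: eq_bigr => c _; apply: eq_bigr => d _.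
by rewrite [coef a d c a]coef_sym; ring.
Qed.

Lemma half_diagE (y : 'M[R]_n) a : 2%:R * half_diag y a = (star y^T y) a a.
Proof.
rewrite star_diag mulrDr; congr (_ + _).
  by rewrite mulr_sumr; apply: eq_bigr => c _; ring.
rewrite mulr_sumr; apply: eq_bigr => c _; rewrite mulr_sumr; apply: eq_bigr => d _.
by ring.
Qed.

Lemma half_diagD (y z : 'M[R]_n) a :
  half_diag (y + z) a = half_diag y a + (star y^T z) a a + half_diag z a.
Proof.
rewrite star_diag /half_diag.
transitivity (\sum_c (hV a c * y c a ^+ 2 + 2%:R * hV a c * y c a * z c a +
   hV a c * z c a ^+ 2) + \sum_(c < n) (\sum_(d < n | (d < c)%N) coef a c d a * y c a * y d a
   + \sum_(d < n | (d < c)%N) coef a c d a * (y c a * z d a + y d a * z c a)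
   + \sum_(d < n | (d < c)%N) coef a c d a * z c a * z d a)).
  congr (_ + _); first by apply: eq_bigr => c _; rewrite mxE; ring.
  apply: eq_bigr => c _; rewrite -!big_split; apply: eq_bigr => d _ /=.
  by rewrite !mxE; ring.
by rewrite !big_split /=; ring.
Qed.

Lemma half_diag_eq0 (y : 'M[R]_n) a :
  (forall a b c d, y a b * y c d = 0) -> half_diag y a = 0.
Proof.
move=> yy; rewrite /half_diag !big1 ?addr0// => c _; last by rewrite expr2 yy mulr0.
by rewrite big1// => d _; rewrite -mulrA yy mulr0.
Qed.

(* The equations of the stabilizer: those saying that y + y^T + y^T * y is
   zero, with the ones on the diagonal divided by 2. *)
Definition stab_eqn (y : 'M[R]_n) : 'M[R]_n := \matrix_(a, b)
  if a == b then y a a + half_diag y a else y a b + y b a + (star y^T y) a b.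

(** The defect m^T B m - B in the coordinates of the congruence lattice. *)
Definition stab_full (y : 'M[R]_n) := y + y^T + star y^T y.

Lemma stab_fullE y a b : stab_full y a b = (if a == b then 2%:R else 1) * stab_eqn y a b.
Proof.
rewrite /stab_full !mxE; case: eqP => [<-|_]; last by rewrite mul1r.
by rewrite mulrDr half_diagE mxE; ring.
Qed.

Lemma stab_eqn0 y : stab_eqn y = 0 -> stab_full y = 0.
Proof. by move=> e; apply/matrixP => a b; rewrite stab_fullE e mxE mulr0. Qed.

Lemma stab_full0 y : torsion_free R -> stab_full y = 0 -> stab_eqn y = 0.
Proof.
move=> tf e; apply/matrixP => a b; have := stab_fullE y a b.
rewrite e mxE => /esym.
by case: eqP => _; [exact: tf|rewrite mul1r].
Qed.

(* Lift of a point through a square zero ideal: the correction y + z solves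
   the equations because (1 + y^T)(1 + y) = 1 modulo the ideal. *)
Lemma stab_lift (K : R -> Prop) (y : 'M[R]_n) : Quot.ideal K ->
  (forall u v, K u -> K v -> u * v = 0) -> (forall a b, K (stab_eqn y a b)) ->
  exists z : 'M[R]_n, (forall a b, K (z a b)) /\ stab_eqn (y + z) = 0.
Proof.
move=> [K0 KD KM] KK Ky.
(* The off-diagonal linearized equations see only the sum of the entries (a, b) and (b, a), so the
   whole correction goes above the diagonal; on the diagonal the halved equation contains the entry
   once. *)
pose z0 : 'M[R]_n := \matrix_(a, b) if (a <= b)%N then - stab_eqn y a b else 0.
have Kz0 a b : K (z0 a b).
  by rewrite mxE; case: ifP => // _; rewrite -mulN1r; apply: (KM).
have Kstar (x x' : 'M[R]_n) : (forall a b, K (x' a b)) -> forall a b, K (star x x' a b).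
  move=> Kx' a b; rewrite mxE; apply: (@big_rec _ K) => // c u _ Ku.
  apply: (KD _ _ _ Ku); apply: (@big_rec _ K) => // d v _ Kv.
  by apply: (KD _ _ _ Kv); apply: (KM).
(* That is z = (1 + y) z0. As (1 + y^T)(1 + y) = 1 + [stab_full y] and the ideal has square zero, (1
   + y^T) z = z0. *)
pose z := z0 + star y z0.
have Kz a b : K (z a b) by rewrite mxE; apply: (KD) => //; apply: Kstar.
exists z; split=> //.
have Kfull a b : K (stab_full y a b) by rewrite stab_fullE; apply: (KM).
have z00 : star (stab_full y) z0 = 0 by apply: star_eq0 => *; apply: (KK).
have zE : z + star y^T z = z0.
  rewrite -[RHS]addr0 -z00 /stab_full !starDl starA /z starDr.
  move: (star y z0) (star y^T z0) (star _ _) => u v u'.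
  by apply/matrixP => a b; rewrite !mxE; ring.
have Kzz a b c d : z a b * z c d = 0 by apply: (KK).
have zab c d : z c d + (star y^T z) c d = if (c <= d)%N then - stab_eqn y c d else 0.
  by move/matrixP: zE => /(_ c d); rewrite [LHS]mxE => ->; rewrite mxE.
clearbody z.
apply/matrixP => a b; rewrite [LHS]mxE [RHS]mxE; case: eqP => [_|/eqP ab].
  rewrite half_diagD (@half_diag_eq0 z)// addr0 [(y + z) a a]mxE.
  transitivity (y a a + half_diag y a + (z a a + (star y^T z) a a)); first by ring.
  by rewrite zab leqnn mxE eqxx subrr.
rewrite linearD /= !(starDl, starDr) [star z^T z]star_eq0 => [|*]; last first.
  by rewrite mxE.
have zy : (star z^T y) a b = (star y^T z) b a by rewrite -{1}[y]trmxK -star_tr [LHS]mxE.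
transitivity (stab_eqn y a b + (z a b + (star y^T z) a b)
  + (z b a + (star y^T z) b a)).
  rewrite [stab_eqn y a b]mxE (negbTE ab) -zy.
  by rewrite ![(_ + _ : 'M_n) _ _]mxE [(0 : 'M_n) _ _]mxE; ring.
have eqn_sym c d : stab_eqn y c d = stab_eqn y d c.
  rewrite mxE [RHS]mxE eq_sym; case: eqP => [->//|_].
  by rewrite -{1}[y in star _ y]trmxK -star_tr [_^T _ _]mxE [y d c + _]addrC.
rewrite !zab (eqn_sym b a); case: (ltngtP a b) => [_|_|/val_inj e].
- by rewrite addr0 subrr.
- by rewrite addr0 subrr.
- by rewrite e eqxx in ab.
Qed.
End Star.
End Exponents.

Section ScaledMatrices.
Variables (n : nat) (w : 'I_n -> nat) (E : {set 'I_n}) (R : comPzRingType).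

Local Notation th := (theta w E).

Definition theta_mx (y : 'M[R]_n) : 'M[R]_n := \matrix_(a, b) (2%:R ^+ th a b * y a b).

(** The row factor 2 ^ w is taken out: as G = 2^w U, the X with G X = [theta_mx y] is V times this
    matrix. *)
Definition theta_mx' (y : 'M[R]_n) : 'M[R]_n :=
  \matrix_(a, b) (2%:R ^+ (th a b - w a) * y a b).

Lemma pow2_theta_mx' y : pow2_mx R w *m theta_mx' y = theta_mx y.
Proof.
by apply/matrixP => a b; rewrite mul_pow2_mx !mxE mulrA -exprD subnKC ?theta_ge.
Qed.

Lemma theta_mxD y z : theta_mx (y + z) = theta_mx y + theta_mx z.
Proof. by apply/matrixP => a b; rewrite !mxE mulrDr. Qed.

Lemma theta_mx'D y z : theta_mx' (y + z) = theta_mx' y + theta_mx' z.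
Proof. by apply/matrixP => a b; rewrite !mxE mulrDr. Qed.

Lemma theta_mx_tr y : (theta_mx y)^T = theta_mx y^T.
Proof. by apply/matrixP => a b; rewrite !mxE theta_sym. Qed.

Lemma theta_mx_inj : torsion_free R -> injective theta_mx.
Proof.
move=> tf y z /matrixP e; apply/matrixP => a b; have := e a b.
by rewrite !mxE => /(exp2I tf).
Qed.

Variable V : 'M[R]_n.
Hypothesis Vblock : forall a b, w a != w b -> V a b = 0.

(** With X = V [theta_mx' y], composition of endomorphisms becomes [star]. *)
Lemma theta_mx'_star y z :
  theta_mx' y *m V *m theta_mx' z = theta_mx' (star w E V y z).
Proof.
apply/matrixP => a b; rewrite [RHS]mxE [star _ _ _ _ _ _ _]mxE exchange_big mulr_sumr.
rewrite mxE; apply: eq_bigr => d _ /=; rewrite mxE mulr_suml mulr_sumr.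
apply: eq_bigr => c _; rewrite !mxE /coef.
have [wcd|wcd] := eqVneq (w c) (w d); last by rewrite Vblock//; ring.
transitivity (2%:R ^+ ((th a c - w a) + (th d b - w d)) * (V c d * y a c * z d b)).
  by rewrite exprD; ring.
rewrite !mulrA -exprD; congr (_ ^+ _ * _ * _ * _).
have := theta_mul E a b wcd; have := theta_ge w E a b.
by have := theta_ge w E a c; have := theta_ge w E d b; lia.
Qed.

Lemma theta_mx_star y z :
  (theta_mx' y)^T *m V *m theta_mx z = theta_mx (star w E V y^T z).
Proof.
apply/matrixP => a b; rewrite [RHS]mxE [star _ _ _ _ _ _ _]mxE exchange_big mulr_sumr.
rewrite mxE; apply: eq_bigr => d _ /=; rewrite mxE mulr_suml mulr_sumr.
apply: eq_bigr => c _; rewrite !mxE /coef.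
have [wcd|wcd] := eqVneq (w c) (w d); last by rewrite Vblock//; ring.
transitivity (2%:R ^+ ((th c a - w c) + th d b) * (V c d * y c a * z d b)).
  by rewrite exprD; ring.
rewrite !mulrA -exprD; congr (_ ^+ _ * _ * _ * _).
have := theta_mul E a b wcd; rewrite !(theta_sym _ _ a).
by have := theta_ge w E c a; lia.
Qed.
End ScaledMatrices.

Section DvdTheta.
Variables (n : nat) (w : 'I_n -> nat) (E : {set 'I_n}) (R : comPzRingType).
Variable beta : 'M[R]_n.
Hypothesis Ew : {in E &, injective w}.
Hypothesis dvd_row : forall a b, dvd2 (w a) (beta a b).
Hypothesis dvd_col : forall a b, dvd2 (w b) (beta a b).
Hypothesis dvd_Erow : forall a b, a \in E -> w a = w b -> dvd2 (w a).+1 (beta a b).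
Hypothesis dvd_Ecol : forall a b, b \in E -> w a = w b -> dvd2 (w a).+1 (beta a b).
Hypothesis dvd_sum_col : forall c, c \in E -> dvd2 (w c).+2
  (2%:R * (\sum_(a in E | (w a).+1 == w c) beta a c) +
   \sum_(a in E | w a == (w c).+1) beta a c).
Hypothesis dvd_sum_row : forall c, c \in E -> dvd2 (w c).+2
  (2%:R * (\sum_(a in E | (w a).+1 == w c) beta c a) +
   \sum_(a in E | w a == (w c).+1) beta c a).

(* The conditions on blocks i - 1, i, i + 1 determine those on the blocks
   i, i + 1 inductively, as there are no blocks of negative index. *)
Let dvd_step i : forall a c, a \in E -> c \in E -> w c = i -> w a = i.+1 ->
  dvd2 i.+2 (beta a c) /\ dvd2 i.+2 (beta c a).
Proof.
elim: i => [|i IH] a c aE cE wc wa.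
  have e (f : 'I_n -> R) : \sum_(b in E | (w b).+1 == w c) f b = 0.
    by rewrite big1// => b /andP[_]; rewrite wc.
  have e' (f : 'I_n -> R) : \sum_(b in E | w b == (w c).+1) f b = f a.
    rewrite (big_pred1 a)// => b; apply/andP/eqP => [[bE /eqP wb]|->].
      by apply: Ew => //; rewrite wb wc wa.
    by rewrite aE wa wc.
  have := dvd_sum_col cE; have := dvd_sum_row cE.
  by rewrite !e !e' mulr0 !add0r wc.
have e (f : 'I_n -> R) : \sum_(b in E | w b == (w c).+1) f b = f a.
  rewrite (big_pred1 a)// => b; apply/andP/eqP => [[bE /eqP wb]|->].
    by apply: Ew => //; rewrite wb wc wa.
  by rewrite aE wa wc.
have dE (f : 'I_n -> R) : (forall b, b \in E -> w b = i -> dvd2 i.+2 (f b)) ->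
    dvd2 i.+3 (2%:R * \sum_(b in E | (w b).+1 == i.+1) f b).
  move=> h; rewrite -[i.+3]add1n; apply: dvd2M; first by exists 1; rewrite mulr1.
  by apply: dvd2_sum => b /andP[bE]; rewrite eqSS => /eqP; apply: h.
have := dvd_sum_col cE; have := dvd_sum_row cE; rewrite !e wc => h1 h2; split.
  have := dvd2B h2 (dE (fun b => beta b c) _); rewrite /= addrAC subrr add0r; apply=> b bE wb.
  by have [] := IH c b cE bE wb wc.
have := dvd2B h1 (dE (fun b => beta c b) _); rewrite /= addrAC subrr add0r; apply=> b bE wb.
by have [] := IH c b cE bE wb wc.
Qed.

Lemma dvd_theta : exists y, beta = theta_mx w E y.
Proof.
suff /choice[y yE] (ab : 'I_n * 'I_n) :
    exists c, beta ab.1 ab.2 = 2%:R ^+ theta w E ab.1 ab.2 * c.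
  exists (\matrix_(a, b) y (a, b)); apply/matrixP => a b.
  by rewrite !mxE -(yE (a, b)).
case: ab => a b /=; rewrite -/(dvd2 _ _) /theta.
have hmax : dvd2 (maxn (w a) (w b)) (beta a b) by rewrite /maxn; case: ifP.
case: (boolP (w a == w b)) => [/eqP wab|wab] /=.
  rewrite wab maxnn.
  have [aE|aE] /= := boolP (a \in E).
    by rewrite addn1 -wab; apply: dvd_Erow.
  have [bE|bE] := boolP (b \in E) => /=.
    by rewrite addn1 -wab; apply: dvd_Ecol.
  by rewrite addn0 -wab.
have [aE|aE] /= := boolP (a \in E); last by rewrite addn0.
have [bE|bE] /= := boolP (b \in E); last by rewrite addn0.
case: eqP => [wba|_] /=.
  rewrite -wba (maxn_idPr (leqnSn _)) addn1.
  by have [] := dvd_step bE aE erefl (esym wba).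
case: eqP => [wba|_] /=; last by rewrite addn0.
rewrite -wba (maxn_idPl (leqnSn _)) addn1.
by have [] := dvd_step aE bE erefl (esym wba).
Qed.
End DvdTheta.

(** * The lattices in an adapted basis *)

Section Coordinates.
Variables (R : comPzRingType) (n : nat) (w : 'I_n -> nat) (E : {set 'I_n}).
Variables (U V : 'M[R]_n).
Hypothesis tf : torsion_free R.
Hypothesis Usym : U^T = U.
Hypothesis Ublock : forall a b, w a != w b -> U a b = 0.
Hypothesis UV : U *m V = 1%:M.
Hypothesis VU : V *m U = 1%:M.
Hypothesis Udiag : forall a, dvd2 1 (U a a - (\sum_(b in E) U a b) ^+ 2).

Let G := pow2_mx R w *m U.

(** Modulo [X_i], only the characteristic coordinate of block i may survive. *)
Definition in_W i (x : 'cV[R]_n) :=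
  in_A w i x /\ forall a, w a = i -> a \notin E -> dvd2 1 (x a 0).

(** The basis vector in E of block i, or 0 if there is none: a characteristic vector of [A_i]. *)
Definition eps i : 'cV[R]_n := \col_a ((a \in E) && (w a == i))%:R.

Lemma G_lin i x : \sum_(a in E | w a == i) (G *m x) a 0 = 2%:R ^+ i * lin w E U i x.
Proof.
rewrite mulr_sumr; apply: eq_bigr => a /andP[_ /eqP <-].
by rewrite -mulmxA mul_pow2_mx.
Qed.

Lemma G_eps i x : ((eps i)^T *m G *m x) 0 0 = 2%:R ^+ i * lin w E U i x.
Proof.
rewrite -G_lin -mulmxA mxE [RHS]big_mkcond; apply: eq_bigr => a _.
by rewrite !mxE; case: ifP; rewrite ?mul0r ?mul1r.
Qed.

Lemma in_X_G i x : (forall a, dvd2 i ((G *m x) a 0)) ->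
  (forall a, w a = i -> dvd2 i.+1 ((G *m x) a 0)) -> in_X w i x.
Proof.
move=> h1 h2; split=> [|a wa]; first exact/(in_AP Ublock VU).
apply: (dvd2_cancel tf (k := i)); rewrite addn1 -{2}wa -mul_pow2_mx.
have -> : pow2_mx R w *m x = V *m (G *m x).
  by rewrite /G (pow2_comm Ublock) -(mulmxA U) (mulmxA V) VU mul1mx.
rewrite mxE; apply: dvd2_sum => b _.
have [wb|wb] := eqVneq (w b) i; first exact/dvd2_mull/h2.
by rewrite (Vblock Ublock UV VU) ?mul0r ?wa 1?eq_sym//; apply: dvd20.
Qed.

Lemma bil_X i x y : in_X w i x -> in_A w i y -> dvd2 i.+1 ((y^T *m G *m x) 0 0).
Proof.
move=> [xA xX] yA; rewrite -mulmxA mxE; apply: dvd2_sum => a _.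
rewrite mxE [(G *m x) a 0]mxE mulr_sumr; apply: dvd2_sum => b _.
rewrite (GE w U); have [wab|/Ublock ->] := eqVneq (w a) (w b); last first.
  by rewrite !(mulr0, mul0r); apply: dvd20.
rewrite (_ : _ * _ = (2%:R ^+ w a * y a 0) * (U a b * x b 0)); last by ring.
rewrite -addn1; have [wi|iw|wi] := ltngtP (w a) i.
- apply: dvd2M (yA a) _; apply/dvd2_mull; apply: dvd2_le (in_A_lt tf b xA).
  by rewrite subn_gt0 -wab.
- by rewrite addn1; apply/dvd2_mulr/dvd2_mulr/(dvd2_le iw); exists 1; rewrite mulr1.
- by apply: dvd2M (yA a) _; apply/dvd2_mull/xX; rewrite -wab.
Qed.

Section Theta.
Variable y : 'M[R]_n.
Let T := theta_mx w E y.

Let theta_term k a (x : 'cV[R]_n) :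
  (forall b, dvd2 (k - theta w E a b) (x b 0)) -> dvd2 k ((T *m x) a 0).
Proof.
move=> h; rewrite mxE; apply: dvd2_sum => b _; rewrite mxE mulrAC.
apply: dvd2_mulr; apply: (@dvd2_le _ (theta w E a b + (k - theta w E a b))); first by lia.
by apply: dvd2M => //; exists 1; rewrite mulr1.
Qed.

Lemma theta_A i x a : in_A w i x -> dvd2 i ((T *m x) a 0).
Proof.
move=> xA; apply: theta_term => b; apply: dvd2_le (in_A_lt tf b xA).
by have := theta_ge w E b a; rewrite theta_sym; lia.
Qed.

Lemma theta_A_E i x a : in_A w i x -> a \in E -> w a = i -> dvd2 i.+1 ((T *m x) a 0).
Proof.
move=> xA aE wa; apply: theta_term => b; apply: dvd2_le (in_A_lt tf b xA).
by rewrite /theta aE /=; lia.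
Qed.

Lemma theta_W i x a : in_W i x -> w a = i -> dvd2 i.+1 ((T *m x) a 0).
Proof.
move=> [xA xW] wa; apply: theta_term => b.
have [wb|wb] := eqVneq (w b) i; last first.
  by apply: dvd2_le (in_A_lt tf b xA); rewrite /theta; lia.
have [bE|/(xW _ wb)] := boolP (b \in E); last by apply: dvd2_le; rewrite /theta; lia.
by apply: (@dvd2_le _ 0); [rewrite /theta bE orbT; lia|apply: dvd2_0].
Qed.

Lemma theta_W_pred i x a : in_W i x -> a \in E -> (w a).+1 = i -> dvd2 i.+1 ((T *m x) a 0).
Proof.
move=> [xA xW] aE wa; apply: theta_term => b.
have [wb|wb] := eqVneq (w b) i; last first.
  by apply: dvd2_le (in_A_lt tf b xA); rewrite /theta aE /=; lia.
have [bE|/(xW _ wb)] := boolP (b \in E); last by apply: dvd2_le; rewrite /theta; lia.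
by apply: (@dvd2_le _ 0); [rewrite /theta aE bE /=; lia|apply: dvd2_0].
Qed.

Lemma theta_W_succ i x a : in_W i x -> a \in E -> w a = i.+1 -> dvd2 i.+2 ((T *m x) a 0).
Proof.
move=> [xA xW] aE wa; apply: theta_term => b.
have [wb|wb] := eqVneq (w b) i; last first.
  by apply: dvd2_le (in_A_lt tf b xA); rewrite /theta aE /=; lia.
have [bE|/(xW _ wb)] := boolP (b \in E); last by apply: dvd2_le; rewrite /theta; lia.
by apply: (@dvd2_le _ 0); [rewrite /theta aE bE /=; lia|apply: dvd2_0].
Qed.

Variable z : 'cV[R]_n.
Variables (i : nat) (x : 'cV[R]_n).
Hypothesis Gz : G *m z = T *m x.

Lemma theta_in_B : in_A w i x -> in_A w i z /\ dvd2 1 (lin w E U i z).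
Proof.
move=> xA; split; first by apply/(in_AP Ublock VU) => a; rewrite -/G Gz; apply: theta_A.
apply: (dvd2_cancel tf (k := i)); rewrite -G_lin addn1; apply: dvd2_sum => a.
by move=> /andP[aE /eqP wa]; rewrite Gz; apply: theta_A_E.
Qed.

(** By [quad_X] the form 2 ^ -(i + 1) q on [X_i] is modulo 2 the square of a sum over blocks i - 1
    and i + 1; both parts are even thanks to the extra factor of 2 that [theta] has between
    characteristic vectors of consecutive blocks. *)
Lemma theta_in_XZ : in_W i x -> in_X w i z /\ dvd2 i.+2 ((z^T *m G *m z) 0 0).
Proof.
move=> xW; have zX : in_X w i z.
  apply: in_X_G => a; rewrite Gz; first by apply: theta_A; case: xW.
  exact: theta_W.
split=> //.
(* Divisible by 4, since [quad_X] divides this sum by 2 and the quotient must still be even. *)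
have [u uE] : exists u, 4%:R * u = \sum_(a in E | (w a).+1 == i) (U *m z) a 0.
  have : dvd2 2 (\sum_(a in E | (w a).+1 == i) (U *m z) a 0).
    apply: dvd2_sum => a /andP[aE /eqP wa].
    apply: (dvd2_cancel tf (k := w a)); rewrite -mul_pow2_mx mulmxA -/G Gz.
    by rewrite addn2 wa; apply: theta_W_pred.
  by move=> [u ->]; exists u; ring.
have /(dvd2_cancel tf)[v vE] : dvd2 (i.+1 + 1) (2%:R ^+ i.+1 * lin w E U i.+1 z).
  rewrite -G_lin addn1; apply: dvd2_sum => a /andP[aE /eqP wa].
  by rewrite Gz; apply: theta_W_succ.
have [|c ->] := quad_X tf Usym Ublock Udiag (u := 2%:R * u) zX; first by rewrite -uE; ring.
rewrite vE -addn1; apply: dvd2M; first by exists 1; rewrite mulr1.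
by exists (2%:R * (u + v) ^+ 2 + c); ring.
Qed.
End Theta.

(** * Isometries over algebras reduced modulo 2 *)

Section Isometry.
Hypothesis red : reduced_mod2 R.
Hypothesis Ew : {in E &, injective w}.

Let sqr_even (x c : R) k : dvd2 k.+1 (2%:R ^+ k * (x ^+ 2 + 2%:R * c)) -> dvd2 1 x.
Proof.
rewrite -addn1 => /(dvd2_cancel tf)[d]; rewrite expr1 => e.
have [|z ->] := red (x := x) (y := d - c); last by exists z.
by rewrite mulrBr -e addrK.
Qed.

Let GB (m : 'M[R]_n) : G *m m - G = G *m (m - 1%:M).
Proof. by rewrite mulmxBr mulmx1. Qed.

(** From q(m e_b) = q(e_b), with m = 1 + (m - 1). It bounds the value of q at a column of m - 1 by a
    single diagonal entry. *)
Let isom_sqr (m : 'M[R]_n) b : m^T *m G *m m = G ->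
  ((col b (m - 1%:M))^T *m G *m col b (m - 1%:M)) 0 0 =
  - (2%:R * (G *m m - G) b b).
Proof.
move=> mG; have -> : ((col b (m - 1%:M))^T *m G *m col b (m - 1%:M)) 0 0 =
    ((m - 1%:M)^T *m G *m (m - 1%:M)) b b.
  rewrite !mxE; apply: eq_bigr => c _; rewrite !mxE; congr (_ * _).
  by apply: eq_bigr => d _; rewrite !mxE.
have -> : (m - 1%:M)^T *m G *m (m - 1%:M) = - ((G *m m - G)^T + (G *m m - G)).
  have -> : (m - 1%:M)^T = m^T - 1%:M by rewrite linearB /= trmx1.
  rewrite mulmxBl mul1mx mulmxBr mulmxBl mG mulmx1.
  have -> : (G *m m - G)^T = (G *m m)^T - G^T by rewrite linearB.
  rewrite trmx_mul (Gsym Usym Ublock) -/G.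
  by apply/matrixP => c d; rewrite !mxE; ring.
by rewrite !mxE; ring.
Qed.

(** The column x = (m - 1) e_b lies in [A_i] for i = w b, and q(x) is divisible by 2 ^ (i + 1). By
    [quad_A] the square of [lin] is even, hence [lin] is, and it is the wanted entry divided by 2 ^
    i. *)
Let isom_row (m : 'M[R]_n) a b : m^T *m G *m m = G ->
  (forall a b, dvd2 (w b) ((G *m m - G) a b)) -> a \in E -> w a = w b ->
  dvd2 (w a).+1 ((G *m m - G) a b).
Proof.
move=> mG hc aE wab; pose x := col b (m - 1%:M).
have Gx c : (G *m x) c 0 = (G *m m - G) c b.
  rewrite GB [LHS]mxE [RHS]mxE.
  by apply: eq_bigr => d _; rewrite [x d 0]mxE.
have xA : in_A w (w b) x by apply/(in_AP Ublock VU) => c; rewrite -/G Gx.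
have [c qx] := quad_A tf Usym Ublock Udiag xA.
have := isom_sqr b mG; rewrite -/x qx => e.
have /sqr_even[z zE] : dvd2 (w b).+1 (2%:R ^+ w b * (lin w E U (w b) x ^+ 2 + 2%:R * c)).
  rewrite e -add1n; apply/dvd2N/dvd2M; last exact: hc.
  by exists 1; rewrite mulr1.
have := G_lin (w b) x; rewrite (big_pred1 a); last first.
  move=> d; apply/andP/eqP => [[dE /eqP wd]|->]; last by rewrite aE wab.
  by apply: Ew => //; rewrite wab.
by rewrite Gx zE wab mulrA -exprD addn1 => ->; exists z.
Qed.

(** The argument of [isom_row] one level up: now x is in [X_i], q(x) is divisible by 2 ^ (i + 2),
    and the functional found to be even is the one that cuts out [Z_i]. *)
Let isom_sum (m : 'M[R]_n) c : m^T *m G *m m = G ->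
  (forall a b, dvd2 (w b) ((G *m m - G) a b)) ->
  (forall a b, b \in E -> w a = w b -> dvd2 (w a).+1 ((G *m m - G) a b)) ->
  c \in E -> dvd2 (w c).+2
  (2%:R * (\sum_(a in E | (w a).+1 == w c) (G *m m - G) a c) +
   \sum_(a in E | w a == (w c).+1) (G *m m - G) a c).
Proof.
move=> mG hc hE cE; pose x := col c (m - 1%:M).
have Gx a : (G *m m - G) a c = (G *m x) a 0.
  rewrite GB [LHS]mxE [RHS]mxE.
  by apply: eq_bigr => d _; rewrite [x d 0]mxE.
have xX : in_X w (w c) x.
  apply: in_X_G => a; first by rewrite -Gx.
  by move=> wa; rewrite -Gx -wa; apply: hE.
have [u uE] : dvd2 1 (\sum_(a in E | (w a).+1 == w c) (U *m x) a 0).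
  apply: dvd2_sum => a /andP[aE /eqP wa].
  apply: (dvd2_cancel tf (k := w a)).
  by rewrite -mul_pow2_mx mulmxA -/G -Gx addn1 wa.
have [d qx] := quad_X tf Usym Ublock Udiag xX (esym uE).
have := isom_sqr c mG; rewrite -/x qx => e.
have /sqr_even[z zE] : dvd2 (w c).+2
    (2%:R ^+ (w c).+1 * ((u + lin w E U (w c).+1 x) ^+ 2 + 2%:R * d)).
  rewrite e -add1n; apply/dvd2N/dvd2M; first by exists 1; rewrite mulr1.
  exact: hE.
under [X in _ + X]eq_bigr => a _ do rewrite Gx.
rewrite G_lin mulr_sumr.
have -> : \sum_(a in E | (w a).+1 == w c) 2%:R * (G *m m - G) a c = 2%:R ^+ (w c).+1 * u.
  rewrite exprSr -mulrA -[_ * u]expr1 -[2%:R * u]/(2%:R ^+ 1 * u) -uE mulr_sumr.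
  apply: eq_bigr => a /andP[_ /eqP <-].
  by rewrite Gx -mulmxA mul_pow2_mx exprS mulrA.
by rewrite -mulrDr zE mulrA -exprD addn1; exists z.
Qed.

(** The transpose of G (m - 1) is G (m' - 1), so the conditions on rows of m are those on columns of
    its inverse and conversely. *)
Lemma isom_theta (m m' : 'M[R]_n) : m *m m' = 1%:M -> m' *m m = 1%:M ->
  m^T *m G *m m = G -> exists y, G *m m - G = theta_mx w E y.
Proof.
move=> mm' m'm mG.
have Gm : G *m m = m'^T *m G.
  by rewrite -{2}mG !mulmxA -trmx_mul mm' trmx1 mul1mx.
have m'G : m'^T *m G *m m' = G by rewrite -Gm -mulmxA mm' mulmx1.
have Gm' : G *m m' = m^T *m G.
  by rewrite -{2}m'G !mulmxA -trmx_mul m'm trmx1 mul1mx.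
have row_dvd (k : 'M[R]_n) a b : dvd2 (w a) ((G *m k - G) a b).
  rewrite GB /G -mulmxA mul_pow2_mx.
  exact: dvd2_exp.
have tr_beta : (G *m m - G)^T = G *m m' - G.
  by rewrite Gm' linearB /= trmx_mul (Gsym Usym Ublock).
have trE a b : (G *m m' - G) a b = (G *m m - G) b a by rewrite -tr_beta mxE.
have col_dvd a b : dvd2 (w b) ((G *m m - G) a b) by rewrite -trE; apply: row_dvd.
have col_dvd' a b : dvd2 (w b) ((G *m m' - G) a b) by rewrite trE; apply: row_dvd.
have hrow a b : a \in E -> w a = w b -> dvd2 (w a).+1 ((G *m m - G) a b).
  by move=> aE wab; apply: isom_row.
have hcol a b : b \in E -> w a = w b -> dvd2 (w a).+1 ((G *m m - G) a b).
  by move=> bE wab; rewrite wab -trE; apply: isom_row.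
apply: dvd_theta => //; first by move=> c cE; apply: isom_sum.
move=> c cE; have := isom_sum m'G col_dvd' _ cE.
have e (P : pred 'I_n) : \sum_(a | P a) (G *m m' - G) a c =
    \sum_(a | P a) (G *m m - G) c a by apply: eq_bigr => a _; rewrite trE.
rewrite !e; apply => a b bE wab; rewrite trE wab; exact: hrow.
Qed.
End Isometry.
End Coordinates.

Section Lattices.
Variables (F : fieldType) (A : idomainType) (iota : {rmorphism A -> F}).
Variables (n : nat) (q : 'cV[A]_n -> A) (B g : 'M[A]_n).
Variables (w : 'I_n -> nat) (E : {set 'I_n}) (U V : 'M[A]_n).
Hypothesis iota_inj : injective iota.
Hypothesis tf : torsion_free A.
Hypothesis red : reduced_mod2 A.
Hypothesis gramE : gram iota q = map_mx iota B.
Hypothesis gu : g \in unitmx.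
Hypothesis gB : g^T *m B *m g = pow2_mx A w *m U.
Hypothesis Usym : U^T = U.
Hypothesis Ublock : forall a b, w a != w b -> U a b = 0.
Hypothesis UV : U *m V = 1%:M.
Hypothesis VU : V *m U = 1%:M.
Hypothesis Ew : {in E &, injective w}.
Hypothesis Udiag : forall a, dvd2 1 (U a a - (\sum_(b in E) U a b) ^+ 2).

Let G := pow2_mx A w *m U.
Let Gs : G^T = G. Proof. exact: Gsym Usym Ublock. Qed.
Let bil (x y : 'cV[A]_n) := (x^T *m G *m y) 0 0.
Let bil_sym x y : bil x y = bil y x.
Proof.
transitivity ((x^T *m G *m y)^T 0 0); first by rewrite [RHS]mxE.
by rewrite trmx_mul trmx_mul trmxK Gs mulmxA.
Qed.

Let bilDr x y z : bil x (y + z) = bil x y + bil x z.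
Proof. by rewrite /bil mulmxDr mxE. Qed.
Let bilZr a x y : bil x (a *: y) = a * bil x y.
Proof. by rewrite /bil -scalemxAr mxE. Qed.
Let bilNr x y : bil x (- y) = - bil x y.
Proof. by rewrite /bil mulmxN mxE. Qed.

Let bil_delta a x : bil (delta_mx a 0) x = (G *m x) a 0.
Proof. by rewrite /bil -mulmxA trmx_delta -rowE mxE. Qed.

Let quadA i x : in_A w i x ->
  exists c, bil x x = 2%:R ^+ i * (lin w E U i x ^+ 2 + 2%:R * c).
Proof. exact: quad_A. Qed.

Definition vec (x : 'cV[A]_n) : 'cV[F]_n := map_mx iota (g *m x).

Lemma bform_iota x y : bform iota q (map_mx iota x) (map_mx iota y) =
  iota ((x^T *m B *m y) 0 0).
Proof. by rewrite /bform gramE map_trmx -!map_mxM mxE. Qed.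

Lemma bform_vec x y : bform iota q (vec x) (vec y) = iota (bil x y).
Proof.
by rewrite bform_iota /bil /G -gB trmx_mul !mulmxA.
Qed.

Lemma vec_linear a x y : vec (x - a *: y) = vec x - iota a *: vec y.
Proof. by rewrite /vec mulmxBr -scalemxAr map_mxB map_mxZ. Qed.

Lemma lat_L_vec v : lat_L iota v <-> exists x, v = vec x.
Proof.
split=> [[y ->]|[x ->]]; last by exists (g *m x).
by exists (invmx g *m y); rewrite /vec mulKVmx.
Qed.

Lemma pow2A_iota i x : pow2A iota i (iota x) <-> dvd2 i x.
Proof.
split=> [[a]|[a ->]]; last by exists a; rewrite rmorphM rmorphXn rmorph_nat.
by rewrite -(rmorph_nat iota) -rmorphXn -rmorphM => /iota_inj ->; exists a.
Qed.

Lemma lat_A_vec i x : lat_A iota q i (vec x) <-> in_A w i x.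
Proof.
split=> [[_ h]|h].
  apply/(in_AP Ublock VU) => a.
  have /h : lat_L iota (vec (delta_mx a 0)) by apply/lat_L_vec; exists (delta_mx a 0).
  by rewrite bform_vec pow2A_iota bil_sym bil_delta.
split=> [|_ /lat_L_vec[y ->]]; first by apply/lat_L_vec; exists x.
rewrite bform_vec pow2A_iota bil_sym /bil -mulmxA mxE; apply: dvd2_sum => a _.
exact/dvd2_mull/(in_AP Ublock VU i x).1.
Qed.

Lemma lat_A_ex i v : lat_A iota q i v -> exists x, v = vec x /\ in_A w i x.
Proof.
move=> vA; have [/lat_L_vec[x e] _] := vA; exists x; split=> //.
by apply/lat_A_vec; rewrite -e.
Qed.

Lemma in_A_delta i a : w a = i -> in_A w i (delta_mx a 0 : 'cV[A]_n).
Proof.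
move=> wa b; rewrite mxE; case: eqP => [->|_]; last by rewrite mulr0; apply: dvd20.
by rewrite wa; apply: dvd2_exp.
Qed.

Lemma lat_X_vec i x : lat_X iota q i (vec x) <-> in_X w i x.
Proof.
split=> [[/lat_A_vec xA h]|xX].
  apply: (in_X_G tf Ublock UV VU) => a; first exact: (in_AP Ublock VU i x).1.
  move=> wa; have /h : lat_A iota q i (vec (delta_mx a 0)).
    exact/lat_A_vec/in_A_delta.
  by rewrite bform_vec pow2A_iota bil_sym bil_delta.
split=> [|_ /lat_A_ex[y [-> yA]]]; first by apply/lat_A_vec; case: xX.
by rewrite bform_vec pow2A_iota bil_sym; apply: (bil_X tf Ublock).
Qed.

Lemma lat_B_vec i x :
  lat_B iota q i (vec x) <-> in_A w i x /\ dvd2 1 (lin w E U i x).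
Proof.
rewrite /lat_B /= lat_A_vec /qform bform_vec pow2A_iota.
have e : in_A w i x -> dvd2 i.+1 (bil x x) <-> dvd2 1 (lin w E U i x).
  move=> /quadA[c qx]; rewrite qx -addn1.
  split=> [/(dvd2_cancel tf)[d]|[d ->]].
    rewrite expr1 => e; have [|z ->] := red (x := lin w E U i x) (y := d - c).
      by rewrite mulrBr -e addrK.
    by exists z.
  apply: dvd2M; first by exists 1; rewrite mulr1.
  by exists (2%:R * d ^+ 2 + c); ring.
by split=> -[xA h]; split=> //; apply/(e xA).
Qed.

(** A vector of [X_i] pairs with all of [A_i], hence with [B_i], into 2 ^ (i + 1) A, so only the
    condition on q remains. *)
Lemma lat_XZ_vec i x : (lat_X iota q i `&` lat_Z iota q i)%classic (vec x) <->
  in_X w i x /\ dvd2 i.+2 (bil x x).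
Proof.
split=> [[/lat_X_vec xX [_]]|[xX h]].
  by rewrite /qform bform_vec pow2A_iota.
have vX : lat_X iota q i (vec x) by apply/lat_X_vec.
have [vA vX'] := vX; split=> //; split; last first.
  by rewrite /qform bform_vec pow2A_iota.
split=> [|v [vA' _]]; last exact: vX'.
split=> //; rewrite /qform bform_vec pow2A_iota; apply: dvd2_le h; exact: leqnSn.
Qed.

Lemma in_A_eps i : in_A w i (eps A w E i).
Proof.
move=> a; rewrite mxE; case: andP => [[_ /eqP wa]|_] /=; last by rewrite mulr0; apply: dvd20.
by rewrite wa; apply: dvd2_exp.
Qed.

Lemma bil_eps i x : bil x (eps A w E i) = 2%:R ^+ i * lin w E U i x.
Proof. by rewrite bil_sym; apply: G_eps. Qed.

Let two_neq0 : 2%:R != 0 :> F.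
Proof.
apply: contraTneq isT => /eqP; rewrite -(rmorph_nat iota) => /eqP e.
have : 2%:R = 0 :> A by apply: iota_inj; rewrite e rmorph0.
by move=> e2; have := @tf 1; rewrite e2 mul0r => /(_ erefl) /eqP; rewrite oner_eq0.
Qed.

Let div_iota i x : iota (2%:R ^+ i * x) / 2%:R ^+ i = iota x.
Proof.
by rewrite rmorphM rmorphXn rmorph_nat mulrAC divff ?mul1r// expf_neq0.
Qed.

Lemma char_eps i : characteristic_vector iota q i (vec (eps A w E i)).
Proof.
split=> [|_ /lat_A_ex[x [-> xA]]]; first exact/lat_A_vec/in_A_eps.
have [c qx] := quadA xA.
rewrite /qform !bform_vec bil_eps qx !div_iota -rmorphXn -rmorphB pow2A_iota.
by exists (- c); ring.
Qed.

Lemma lat_W_vec i x : lat_W iota q i (vec x) -> in_W w E i x.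
Proof.
move=> [/lat_A_vec xA [_ [a [[/lat_A_ex[e [-> eA]] ce]]]]].
rewrite -vec_linear => /lat_X_vec[_ hX]; split=> // b wb bE.
(* Characteristic vectors are unique modulo [X_i]: two of them have pairings with y whose squares,
   divided by the scale, agree modulo 2, and A / 2 A is reduced. *)
have he : in_X w i (e - eps A w E i).
  apply/lat_X_vec; rewrite -[eps _ _ _ _]scale1r; split.
    apply/lat_A_vec => c; rewrite scale1r mxE mulrDr; apply: dvd2D (eA c) _.
    by rewrite mxE mulrN; apply/dvd2N/in_A_eps.
  move=> _ /lat_A_ex[y [-> yA]]; rewrite bform_vec scale1r pow2A_iota.
  have [l le] : dvd2 i (bil e y).
    rewrite bil_sym /bil -mulmxA mxE; apply: dvd2_sum => c _.
    exact/dvd2_mull/(in_AP Ublock VU i e).1.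
  have := ce _ ((lat_A_vec i y).2 yA); rewrite /qform !bform_vec bil_sym le.
  have [c qy] := quadA yA.
  rewrite qy !div_iota -rmorphXn -rmorphB pow2A_iota => -[d]; rewrite expr1 => dE.
  rewrite bil_sym bilDr bilNr bil_eps bil_sym le -mulrBr -addn1.
  apply: dvd2M; first by exists 1; rewrite mulr1.
  have [|z ->] := red (x := l - lin w E U i y)
    (y := d + c - l * lin w E U i y + lin w E U i y ^+ 2); last by exists z.
  move: dE; set s := lin _ _ _ _ _ => dE.
  have -> : (l - s) ^+ 2 = (l ^+ 2 - (s ^+ 2 + 2%:R * c)) +
    2%:R * (c - l * s + s ^+ 2) by ring.
  by rewrite dE; ring.
have := hX b wb; have := he.2 b wb; rewrite !mxE (negbTE bE) /= subr0.
move=> eb xb; rewrite -[x b 0](subrK (a * e b 0)); apply: dvd2D => //.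
exact: dvd2_mull.
Qed.

Lemma sub_XW i v : lat_X iota q i v -> lat_W iota q i v.
Proof.
move=> vX; have [vA _] := vX; split=> //.
exists (vec (eps A w E i)), 0; split; first exact: char_eps.
by rewrite rmorph0 scale0r subr0.
Qed.

Lemma lat_W_delta a : a \in E -> lat_W iota q (w a) (vec (delta_mx a 0)).
Proof.
move=> aE; split; first exact/lat_A_vec/in_A_delta.
exists (vec (eps A w E (w a))), 1; split; first exact: char_eps.
have -> : eps A w E (w a) = delta_mx a 0.
  apply/matrixP => b j; rewrite (ord1 j) !mxE eqxx andbT; congr (_ _)%:R.
  apply/andP/eqP => [[bE /eqP wb]|->]; [exact: Ew|by rewrite aE].
rewrite rmorph1 scale1r subrr -[0]/(0 : 'cV[F]_n).
have -> : 0 = vec 0 by rewrite /vec mulmx0 map_mx0.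
by apply/lat_X_vec; split=> [b|b _]; rewrite !mxE ?mulr0; apply: dvd20.
Qed.

(** [B_i] is the kernel in [A_i] of pairing with the characteristic vector modulo 2, so what pairs
    to zero with [B_i] is a multiple of that vector modulo [X_i]. *)
Lemma sub_YW i v : lat_Y iota q i v -> lat_W iota q i v.
Proof.
move=> [[vA vB] vY]; have [x [ve xA]] := lat_A_ex vA.
have hY y : in_A w i y -> dvd2 1 (lin w E U i y) -> dvd2 i.+1 (bil x y).
  move=> yA yl; rewrite -pow2A_iota -bform_vec -ve; apply: vY.
  by apply/lat_B_vec.
split=> //; exists (vec (eps A w E i)).
have hx : exists a, forall y, in_A w i y -> dvd2 i.+1 (bil (x - a *: eps A w E i) y).
  have [[c /andP[cE /eqP wc]]|nE] := pselect (exists c, (c \in E) && (w c == i)).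
    (* The dual basis vector scaled by 2 ^ i: it lies in [A_i] and [lin] is 1 there, so every y in
       [A_i] projects along it to the kernel of [lin]. *)
    pose y0 := V *m delta_mx c 0 : 'cV[A]_n.
    have Gy0 : G *m y0 = 2%:R ^+ i *: delta_mx c 0.
      rewrite /G -mulmxA (mulmxA U) UV mul1mx; apply/matrixP => a j.
      rewrite mul_pow2_mx !mxE; case: eqP => [->|_]; first by rewrite wc.
      by rewrite !mulr0.
    have y0A : in_A w i y0.
      apply/(in_AP Ublock VU) => a; rewrite -/G Gy0 mxE; exact: dvd2_exp.
    have l0 : lin w E U i y0 = 1.
      rewrite /lin (big_pred1 c).
        by rewrite mulmxA UV mul1mx mxE !eqxx.
      move=> b; apply/andP/eqP => [[bE /eqP wb]|->]; last by rewrite cE wc.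
      by apply: Ew => //; rewrite wb.
    have [a ba] : dvd2 i (bil x y0).
      rewrite /bil -mulmxA Gy0 -scalemxAr mxE; exact: dvd2_exp.
    exists a => y yA.
    have linB (z : 'cV[A]_n) b : lin w E U i (y - b *: z) = lin w E U i y - b * lin w E U i z.
      rewrite /lin mulr_sumr -sumrB; apply: eq_bigr => d _.
      by rewrite mulmxBr -scalemxAr !mxE.
    pose y' := y - lin w E U i y *: y0.
    have : dvd2 i.+1 (bil x y').
      apply: hY; last by rewrite linB l0 mulr1 subrr; apply: dvd20.
      move=> d; rewrite !mxE mulrDr mulrN mulrCA; apply: dvd2B => //.
      by apply: dvd2_mull; have := y0A d; rewrite mxE.
    rewrite bilDr bilNr bilZr ba bil_sym [X in _ -> dvd2 _ X]bil_sym bilDr bilNr bilZr.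
    by rewrite bil_eps => h; rewrite (_ : a * _ = lin w E U i y * (2%:R ^+ i * a)) //; ring.
  exists 0 => y yA; rewrite scale0r subr0; apply: hY => //.
  rewrite /lin big_pred0; first exact: dvd20.
  by move=> c; apply/negP => h; apply: nE; exists c.
have [a ha] := hx; exists a; split; first exact: char_eps.
rewrite ve -vec_linear; split=> [|_ /lat_A_ex[y [-> yA]]].
  apply/lat_A_vec => d; rewrite !mxE mulrDr mulrN mulrCA; apply: dvd2B => //.
  by apply: dvd2_mull; have := @in_A_eps i d; rewrite mxE.
by rewrite bform_vec pow2A_iota; apply: ha.
Qed.

(** The endomorphism m - 1 of the original lattice with coordinates y. *)
Definition lattice_hom (y : 'M[A]_n) : 'M[A]_n :=
  g *m V *m theta_mx' w E y *m invmx g.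

Lemma lattice_hom_vec y x :
  map_mx iota (lattice_hom y) *m vec x = vec (V *m theta_mx' w E y *m x).
Proof. by rewrite /vec -map_mxM /lattice_hom !mulmxA mulmxKV. Qed.

Lemma G_lattice_hom y : G *m (V *m theta_mx' w E y) = theta_mx w E y.
Proof. by rewrite /G mulmxA -(mulmxA _ U) UV mulmx1 pow2_theta_mx'. Qed.

Lemma lattice_hom_AB y i v : lat_A iota q i v ->
  lat_B iota q i (map_mx iota (lattice_hom y) *m v).
Proof.
move=> /lat_A_ex[x [-> xA]]; rewrite lattice_hom_vec; apply/lat_B_vec.
by apply: (theta_in_B tf Ublock VU (y := y) _ xA); rewrite mulmxA G_lattice_hom.
Qed.

Lemma lattice_hom_WXZ y i v : lat_W iota q i v ->
  (lat_X iota q i `&` lat_Z iota q i)%classic (map_mx iota (lattice_hom y) *m v).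
Proof.
move=> vW; have [vA _] := vW; have [x [ve xA]] := lat_A_ex vA.
rewrite ve lattice_hom_vec; apply/lat_XZ_vec.
apply: (theta_in_XZ tf Usym Ublock UV VU Udiag (y := y) (x := x)).
  by rewrite mulmxA G_lattice_hom.
by apply: lat_W_vec; rewrite -ve.
Qed.

Lemma lattice_hom_adj y : B *m lattice_hom y^T = (lattice_hom y)^T *m B.
Proof.
have gt : invmx g^T *m g^T = 1%:M by rewrite mulVmx ?unitmx_tr.
have Bg : B = invmx g^T *m G *m invmx g.
  by rewrite /G -gB !mulmxA gt mul1mx mulmxK.
have hB z : B *m lattice_hom z = invmx g^T *m theta_mx w E z *m invmx g.
  by rewrite {1}Bg /lattice_hom !mulmxA mulmxKV// -(G_lattice_hom z) !mulmxA.
have Bs : B^T = B.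
  by rewrite Bg trmx_mul trmx_mul Gs !trmx_inv trmxK mulmxA.
have -> : (lattice_hom y)^T *m B = (B *m lattice_hom y)^T by rewrite [RHS]trmx_mul Bs.
by rewrite !hB trmx_mul trmx_mul theta_mx_tr !trmx_inv trmxK mulmxA.
Qed.

(** Transposing y gives the adjoint endomorphism, so this is the condition on [W_i] for y^T. *)
Lemma lattice_hom_dual y i v :
  dual iota q (lat_X iota q i `&` lat_Z iota q i)%classic v ->
  dual iota q (lat_W iota q i) (map_mx iota (lattice_hom y) *m v).
Proof.
move=> vD u uW; have := vD _ (lattice_hom_WXZ y^T uW).
suff -> : bform iota q (map_mx iota (lattice_hom y) *m v) u =
    bform iota q v (map_mx iota (lattice_hom y^T) *m u) by [].
rewrite /bform gramE trmx_mul map_trmx -(mulmxA v^T _ (map_mx iota B)) -map_mxM -lattice_hom_adj.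
by rewrite map_mxM !mulmxA.
Qed.
End Lattices.

(** * Points of the monoid *)

Section BaseChange.
Variables (F : fieldType) (A : idomainType) (iota : {rmorphism A -> F}) (n : nat).
Variable R : algebra A.
Hypothesis tfR : torsion_free R.

Let tl : {rmorphism R -> loc (2%:R : R)} := to_loc (2%:R : R).
Let tla : {rmorphism A -> loc (2%:R : R)} := tl \o alg_map R.

Lemma to_loc2_inj : injective tl.
Proof.
move=> x y /Loc.fracP[N]; rewrite !mul1r => e; exact: (exp2I tfR e).
Qed.

Lemma frac_to_loc k x : loc_frac (2%:R : R) 1 k * tl (2%:R ^+ k * x) = tl x.
Proof.
rewrite -[LHS]/(Loc.mul _ _) Loc.mulE; apply/Loc.fracP; exists 0%N.
by rewrite addn0; ring.
Qed.

Lemma base_lat_vec (M : set 'cV[F]_n) x v :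
  M x -> base_vec iota x v -> base_lat (R := R) iota M v.
Proof.
move=> Mx xv; exists 1%N, (fun=> 1), (fun=> x), (fun=> v); split=> // .
by rewrite big_ord1 rmorph1 scale1r.
Qed.

Lemma base_latD (M : set 'cV[F]_n) u v :
  base_lat (R := R) iota M u -> base_lat iota M v -> base_lat iota M (u + v).
Proof.
move=> [k [c [x [z [h ->]]]]] [k' [c' [x' [z' [h' ->]]]]].
pose pick T (f : 'I_k -> T) (f' : 'I_k' -> T) (j : 'I_(k + k')) :=
  match split j with inl i => f i | inr i => f' i end.
exists (k + k')%N, (pick _ c c'), (pick _ x x'), (pick _ z z'); split.
  by move=> j; rewrite /pick; case: (split j).
rewrite big_split_ord /pick; congr (_ + _); apply: eq_bigr => j _.
  by rewrite (unsplitK (inl j)).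
by rewrite (unsplitK (inr j)).
Qed.

Lemma base_latZ (M : set 'cV[F]_n) (a : R) v :
  base_lat iota M v -> base_lat iota M (tl a *: v).
Proof.
move=> [k [c [x [z [h ->]]]]]; exists k, (fun j => a * c j), x, z; split=> //.
by rewrite scaler_sumr; apply: eq_bigr => j _; rewrite scalerA -rmorphM.
Qed.

Lemma base_lat0 (M : set 'cV[F]_n) : base_lat (R := R) iota M 0.
Proof.
by exists 0%N, (fun=> 0), (fun=> 0), (fun=> 0); split=> [[]//|]; rewrite big_ord0.
Qed.

Lemma base_lat_sum (M : set 'cV[F]_n) (I : finType) (f : I -> 'cV_n) :
  (forall i, base_lat (R := R) iota M (f i)) -> base_lat iota M (\sum_i f i).
Proof.
move=> h; apply: (@big_rec _ (base_lat (R := R) iota M)); first exact: base_lat0.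
by move=> i v _; apply: base_latD.
Qed.

Lemma base_lat_sub (M N : set 'cV[F]_n) v : (forall x, M x -> N x) ->
  base_lat (R := R) iota M v -> base_lat iota N v.
Proof.
move=> MN [k [c [x [z [h ->]]]]]; exists k, c, x, z; split=> // j.
by have [/MN] := h j.
Qed.

Lemma base_vec_hom (h : 'M[A]_n) x v : base_vec (R := R) iota x v ->
  base_vec iota (map_mx iota h *m x) (map_mx tla h *m v).
Proof.
move=> [k [y [xy ->]]]; exists k, (h *m y); split.
  by rewrite scalemxAr xy map_mxM.
by rewrite -scalemxAr map_mxM.
Qed.

Lemma base_lat_hom (M N : set 'cV[F]_n) (h : 'M[A]_n) v :
  (forall x, M x -> N (map_mx iota h *m x)) ->
  base_lat (R := R) iota M v -> base_lat iota N (map_mx tla h *m v).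
Proof.
move=> MN [k [c [x [z [hz ->]]]]]; rewrite mulmx_sumr; apply: base_lat_sum => j.
rewrite -scalemxAr; apply: base_latZ; have [Mx xz] := hz j.
by apply: base_lat_vec (MN _ Mx) _; apply: base_vec_hom.
Qed.

Variables (q : 'cV[A]_n -> A) (B : 'M[A]_n).
Hypothesis iota_inj : injective iota.
Hypothesis gramE : gram iota q = map_mx iota B.
Hypothesis Bs : B^T = B.

Lemma bform_scale k x u : bform iota q (k *: x) u = k * bform iota q x u.
Proof. by rewrite /bform linearZ /= -!scalemxAl mxE. Qed.

Lemma bform_sym x y : bform iota q x y = bform iota q y x.
Proof.
rewrite /bform gramE; transitivity ((x^T *m map_mx iota B *m y)^T 0 0).
  by rewrite [RHS]mxE.
by rewrite !trmx_mul trmxK map_trmx Bs mulmxA.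
Qed.

Lemma base_lat_pair (N : set 'cV[F]_n) (u : 'cV[A]_n) s v :
  (forall x, N x -> pow2A iota s (bform iota q x (map_mx iota u))) ->
  base_lat (R := R) iota N v ->
  exists r : R, (map_mx tla (u^T *m B) *m v) 0 0 = tl (2%:R ^+ s * r).
Proof.
move=> hN [k [c [x [z [hz ->]]]]].
have /choice[r rE] j : exists r : R, (map_mx tla (u^T *m B) *m z j) 0 0 = tl (2%:R ^+ s * r).
  have [/hN[a ea] [l [y [xy ->]]]] := hz j; exists (alg_map R a).
  have e : (u^T *m B *m y) 0 0 = 2%:R ^+ l * (2%:R ^+ s * a).
    apply: iota_inj; rewrite !rmorphM !rmorphXn rmorph_nat -ea -bform_scale xy.
    rewrite (bform_iota gramE); congr (iota _).
    transitivity ((u^T *m B *m y)^T 0 0); first by rewrite [RHS]mxE.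
    by rewrite !trmx_mul trmxK Bs mulmxA.
  rewrite -scalemxAr -map_mxM mxE mxE e -(frac_to_loc l).
  by congr (_ * tl _); rewrite !rmorphM !rmorphXn rmorph_nat.
exists (\sum_j c j * r j).
rewrite mulmx_sumr summxE mulr_sumr rmorph_sum; apply: eq_bigr => j _.
by rewrite -scalemxAr mxE rE -rmorphM mulrCA.
Qed.

(** Turns a lattice condition into a divisibility in R, by pairing N with a vector u on which it
    takes values in 2 ^ s A. The denominator 2 ^ k is for source vectors outside L, as in a dual
    lattice. *)
Lemma maps_lat_pair (M N : set 'cV[F]_n) (m : 'M[R]_n) (x u : 'cV[A]_n) v k s :
  maps_lat iota m M N -> M v -> 2%:R ^+ k *: v = map_mx iota x ->
  (forall z, N z -> pow2A iota s (bform iota q z (map_mx iota u))) ->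
  dvd2 (s + k) ((map_mx (alg_map R) (u^T *m B) *m m *m map_mx (alg_map R) x) 0 0).
Proof.
move=> mMN Mv vx hN.
pose z := loc_frac (2%:R : R) 1 k *: map_mx tla x.
have /mMN/(base_lat_pair hN)[r] : base_lat (R := R) iota M z.
  by apply: base_lat_vec Mv _; exists k, x.
rewrite -!scalemxAr mxE (_ : map_mx tla (u^T *m B) = map_mx tl (map_mx (alg_map R) (u^T *m B)));
  last by rewrite -map_mx_comp.
rewrite (_ : map_mx tla x = map_mx tl (map_mx (alg_map R) x)); last by rewrite -map_mx_comp.
rewrite -!map_mxM mulmxA mxE; set t := (_ *m map_mx _ x) 0 0 => e.
exists r; rewrite addnC exprD -mulrA; apply: to_loc2_inj.
rewrite rmorphM -e mulrA.
have -> : tl (2%:R ^+ k) * loc_frac (2%:R : R) 1 k = 1.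
  by rewrite -(rmorph1 tl) -(frac_to_loc k 1) mulr1 mulrC.
by rewrite mul1r.
Qed.
End BaseChange.

Section Points.
Variables (F : fieldType) (A : idomainType) (iota : {rmorphism A -> F}).
Variables (n : nat) (q : 'cV[A]_n -> A) (B g : 'M[A]_n).
Variables (w : 'I_n -> nat) (E : {set 'I_n}) (U V : 'M[A]_n).
Hypothesis iota_inj : injective iota.
Hypothesis tf : torsion_free A.
Hypothesis red : reduced_mod2 A.
Hypothesis gramE : gram iota q = map_mx iota B.
Hypothesis Bs : B^T = B.
Hypothesis gu : g \in unitmx.
Hypothesis gB : g^T *m B *m g = pow2_mx A w *m U.
Hypothesis Usym : U^T = U.
Hypothesis Ublock : forall a b, w a != w b -> U a b = 0.
Hypothesis UV : U *m V = 1%:M.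
Hypothesis VU : V *m U = 1%:M.
Hypothesis Ew : {in E &, injective w}.
Hypothesis Udiag : forall a, dvd2 1 (U a a - (\sum_(b in E) U a b) ^+ 2).

Variable R : algebra A.
Let fM m p l (X : 'M[A]_(m, p)) (Y : 'M[A]_(p, l)) : map_mx (alg_map R) (X *m Y) =
  map_mx (alg_map R) X *m map_mx (alg_map R) Y.
Proof. exact: map_mxM. Qed.

Local Notation UR := (map_mx (alg_map R) U).
Local Notation VR := (map_mx (alg_map R) V).
Local Notation gR := (map_mx (alg_map R) g).
Local Notation gR' := (map_mx (alg_map R) (invmx g)).
Local Notation BR := (map_mx (alg_map R) B).

Lemma map_pow2_mx : map_mx (alg_map R) (pow2_mx A w) = pow2_mx R w.
Proof.
rewrite /pow2_mx map_diag_mx; congr diag_mx; apply/matrixP => i j.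
by rewrite !mxE rmorphXn rmorph_nat.
Qed.

Lemma gRK : gR *m gR' = 1%:M. Proof. by rewrite -fM mulmxV// map_mx1. Qed.
Lemma gRK' : gR' *m gR = 1%:M. Proof. by rewrite -fM mulVmx// map_mx1. Qed.
Lemma URV : UR *m VR = 1%:M. Proof. by rewrite -fM UV map_mx1. Qed.
Lemma VRU : VR *m UR = 1%:M. Proof. by rewrite -fM VU map_mx1. Qed.
Lemma URsym : UR^T = UR. Proof. by rewrite map_trmx Usym. Qed.
Lemma URblock a b : w a != w b -> UR a b = 0.
Proof. by move=> /Ublock e; rewrite mxE e rmorph0. Qed.
Lemma VRblock a b : w a != w b -> VR a b = 0.
Proof. by move=> /(Vblock Ublock UV VU) e; rewrite mxE e rmorph0. Qed.
Lemma VRsym : VR^T = VR. Proof. by rewrite map_trmx (Vsym Usym UV). Qed.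
Lemma URdiag a : dvd2 1 (UR a a - (\sum_(b in E) UR a b) ^+ 2).
Proof.
have [c e] := Udiag a; exists (alg_map R c).
rewrite -(rmorph_nat (alg_map R)) -rmorphXn -rmorphM -e rmorphB rmorphXn rmorph_sum mxE.
by congr (_ - _ ^+ 2); apply: eq_bigr => b _; rewrite mxE.
Qed.
Lemma gRB : gR^T *m BR *m gR = pow2_mx R w *m UR.
Proof. by rewrite map_trmx -!fM gB fM map_pow2_mx. Qed.

(* The point of the monoid with coordinates y: B (m - 1) is the form with
   matrix (2 ^ theta_ab * y_ab) in the adapted basis. *)
Definition monoid_point (y : 'M[R]_n) : 'M[R]_n :=
  1%:M + gR *m VR *m theta_mx' w E y *m gR'.

Lemma point_mul y z : monoid_point y *m monoid_point z = monoid_point (y + z + star w E VR y z).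
Proof.
rewrite /monoid_point mulmxDl mul1mx mulmxDr mulmx1 -[LHS]addrA; congr (_ + _).
rewrite [RHS](_ : _ = gR *m VR *m (theta_mx' w E y + theta_mx' w E z +
   theta_mx' w E y *m VR *m theta_mx' w E z) *m gR'); last first.
  by rewrite (theta_mx'_star _ VRblock) -!theta_mx'D.
rewrite !mulmxDr !mulmxDl.
have -> : gR *m VR *m theta_mx' w E y *m gR' *m (gR *m VR *m theta_mx' w E z *m gR') =
    gR *m VR *m (theta_mx' w E y *m VR *m theta_mx' w E z) *m gR'.
  by rewrite -!mulmxA (mulmxA gR') gRK' mul1mx.
by rewrite addrA [X in X + _]addrC.
Qed.

Lemma point0 : monoid_point 0 = 1%:M.
Proof.
rewrite /monoid_point (_ : theta_mx' w E 0 = 0) ?mulmx0 ?mul0mx ?addr0//.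
by apply/matrixP => a b; rewrite !mxE mulr0.
Qed.

Lemma point_inv y : stab_full w E VR y = 0 -> monoid_point y^T *m monoid_point y = 1%:M.
Proof. move=> e; rewrite point_mul [y^T + y]addrC.
  by have := e; rewrite /stab_full => ->; apply: point0. Qed.

Lemma BRg : gR^T *m BR = pow2_mx R w *m UR *m gR'.
Proof. by rewrite -gRB -[RHS]mulmxA gRK mulmx1. Qed.

Lemma point_beta y : gR^T *m BR *m (monoid_point y - 1%:M) *m gR = theta_mx w E y.
Proof.
rewrite BRg /monoid_point addrC addKr !mulmxA -(mulmxA _ gR' gR) gRK' mulmx1.
rewrite -(mulmxA _ gR' gR) gRK' mulmx1 -(mulmxA _ UR VR) URV mulmx1.
exact: pow2_theta_mx'.
Qed.

Lemma B_point y : BR *m (monoid_point y - 1%:M) = gR'^T *m theta_mx w E y *m gR'.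
Proof.
rewrite -(point_beta y) !mulmxA -(mulmxA _ gR gR') gRK mulmx1.
by rewrite -trmx_mul gRK trmx1 mul1mx.
Qed.

Lemma point_form y : (monoid_point y)^T *m BR *m monoid_point y =
  BR + gR'^T *m theta_mx w E (stab_full w E VR y) *m gR'.
Proof.
have gt : gR^T *m gR'^T = 1%:M by rewrite -trmx_mul gRK' trmx1.
have BRs : BR^T = BR by rewrite map_trmx Bs.
set X := monoid_point y - 1%:M; have -> : monoid_point y = X + 1%:M by rewrite /X subrK.
have BX : BR *m X = gR'^T *m theta_mx w E y *m gR' := B_point y.
have XB : X^T *m BR = gR'^T *m theta_mx w E y^T *m gR'.
  by rewrite -[LHS]trmxK trmx_mul trmxK BRs BX trmx_mul trmx_mul theta_mx_tr trmxK mulmxA.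
have XBX : X^T *m BR *m X = gR'^T *m theta_mx w E (star w E VR y^T y) *m gR'.
  rewrite -mulmxA BX -(theta_mx_star _ VRblock) {1}/X /monoid_point addrC addKr.
  by rewrite !trmx_mul VRsym !mulmxA -(mulmxA _ gR^T) gt mulmx1.
have -> : (X + 1%:M)^T = X^T + 1%:M by rewrite linearD /= trmx1.
rewrite mulmxDl mul1mx mulmxDr mulmx1 mulmxDl XBX XB BX.
rewrite /stab_full !theta_mxD !mulmxDr !mulmxDl.
move: (_ *m gR') (_ *m gR') (_ *m gR') => a b c.
by rewrite addrC -!addrA addrC -!addrA; congr (_ + _); rewrite addrCA [c + _]addrC.
Qed.

(** An R-combination of endomorphisms defined over A, which reduces the lattice conditions to those
    over A. *)
Lemma point_sub1 y : monoid_point y - 1%:M = \sum_(ab : 'I_n * 'I_n)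
  y ab.1 ab.2 *: map_mx (alg_map R) (lattice_hom g w E V (delta_mx ab.1 ab.2)).
Proof.
rewrite /monoid_point addrC addKr.
have -> : theta_mx' w E y = \sum_(ab : 'I_n * 'I_n)
    y ab.1 ab.2 *: map_mx (alg_map R) (theta_mx' w E (delta_mx ab.1 ab.2)).
  apply/matrixP => a b; rewrite summxE (bigD1 (a, b))//= !mxE !eqxx /= mulr1.
  rewrite rmorphXn rmorph_nat mulrC big1 ?addr0// => -[c d] /= cd.
  rewrite !mxE; case: andP => [[/eqP ac /eqP bd]|_]; last by rewrite mulr0 rmorph0 mulr0.
  by rewrite ac bd eqxx in cd.
rewrite mulmx_sumr mulmx_suml; apply: eq_bigr => ab _.
by rewrite -scalemxAr -scalemxAl /lattice_hom !fM.
Qed.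

Hypothesis tfR : torsion_free R.

Lemma beta_point m y : gR^T *m BR *m (m - 1%:M) *m gR = theta_mx w E y -> m = monoid_point y.
Proof.
rewrite -pow2_theta_mx' BRg -!mulmxA => e.
have {}e : UR *m (gR' *m ((m - 1%:M) *m gR)) = theta_mx' w E y.
  apply/matrixP => a b; apply: (exp2I tfR (k := w a)).
  by rewrite /= -!mul_pow2_mx e.
rewrite /monoid_point -e !mulmxA -(mulmxA gR VR) VRU mulmx1 gRK mul1mx.
by rewrite -mulmxA gRK mulmx1 addrC subrK.
Qed.

Lemma point_inj : injective monoid_point.
Proof.
move=> y z e; apply: (@theta_mx_inj _ w E _ tfR).
by rewrite -!point_beta e.
Qed.

Lemma maps_lat_point y (M N : set 'cV[F]_n) :
  (forall z v, M v -> N (map_mx iota (lattice_hom g w E V z) *m v)) ->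
  maps_lat iota (monoid_point y - 1%:M) M N.
Proof.
move=> h v Mv; rewrite point_sub1 raddf_sum mulmx_suml; apply: base_lat_sum => ab.
rewrite /= map_mxZ -scalemxAl; apply: base_latZ.
rewrite -map_mx_comp; apply: base_lat_hom Mv => x; exact: h.
Qed.

(** The conditions on m - 1 for A, B, W imply stability of all six lattices, because B is contained
    in A, and X, Y, Z are contained in W. *)
Lemma monoid_pts_point y : monoid_pts iota q (monoid_point y).
Proof.
have mapsD (M N : set 'cV[F]_n) : (forall v, N v -> M v) ->
    maps_lat iota (monoid_point y - 1%:M) M N -> maps_lat iota (monoid_point y) M M.
  move=> NM h v Mv; rewrite -[monoid_point y](subrK 1%:M) map_mxD map_mx1 mulmxDl mul1mx.
  by apply: base_latD => //; exact: base_lat_sub NM (h _ Mv).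
have mapsS (M M' N N' : set 'cV[F]_n) : (forall v, M v -> M' v) ->
    (forall v, N' v -> N v) ->
    maps_lat iota (monoid_point y - 1%:M) M' N' -> maps_lat iota (monoid_point y - 1%:M) M N.
  by move=> MM NN h v Mv; exact: base_lat_sub NN (h _ (base_lat_sub MM Mv)).
move=> i.
have mAB : maps_lat iota (monoid_point y - 1%:M) (lat_A iota q i) (lat_B iota q i).
  by apply: maps_lat_point => z v;
    apply: (lattice_hom_AB iota_inj tf red gramE gu gB Usym Ublock UV VU Udiag).
have mW : maps_lat iota (monoid_point y - 1%:M) (lat_W iota q i)
    (lat_X iota q i `&` lat_Z iota q i)%classic.
  by apply: maps_lat_point => z v;
    apply: (lattice_hom_WXZ iota_inj tf red gramE gu gB Usym Ublock UV VU Udiag).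
have BA v : lat_B iota q i v -> lat_A iota q i v by case.
have XW v : lat_X iota q i v -> lat_W iota q i v.
  by exact: (sub_XW iota_inj tf gramE gu gB Usym Ublock VU Udiag).
have ZY v : lat_Z iota q i v -> lat_Y iota q i v by case.
have YW v : lat_Y iota q i v -> lat_W iota q i v.
  by exact: (sub_YW iota_inj tf red gramE gu gB Usym Ublock UV VU Ew Udiag).
have XZX v : (lat_X iota q i `&` lat_Z iota q i)%classic v -> lat_X iota q i v by case.
have XZZ v : (lat_X iota q i `&` lat_Z iota q i)%classic v -> lat_Z iota q i v by case.
have ZW v : lat_Z iota q i v -> lat_W iota q i v by move=> /ZY/YW.
have XZY v : (lat_X iota q i `&` lat_Z iota q i)%classic v -> lat_Y iota q i v.
  by move=> /XZZ/ZY.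
have XZW v : (lat_X iota q i `&` lat_Z iota q i)%classic v -> lat_W iota q i v.
  by move=> /XZX/XW.
split; split=> //.
- exact: mapsD BA mAB.
- exact: mapsD (fun v h => h) (mapsS _ _ _ _ BA (fun v h => h) mAB).
- exact: mapsD XZW mW.
- exact: mapsD (fun v h => h) (mapsS _ _ _ _ XW XZX mW).
- split; first exact: mapsD (fun v h => h) (mapsS _ _ _ _ YW XZY mW).
  exact: mapsD (fun v h => h) (mapsS _ _ _ _ ZW XZZ mW).
- by apply: maps_lat_point => z v;
    apply: (lattice_hom_dual iota_inj tf red gramE gu gB Usym Ublock UV VU Udiag).
Qed.

Let beta (m : 'M[R]_n) := gR^T *m BR *m (m - 1%:M) *m gR.

Let pair_beta (M N : set 'cV[F]_n) m v (x u : 'cV[A]_n) k s :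
  maps_lat iota (m - 1%:M) M N -> M v -> 2%:R ^+ k *: v = vec iota g x ->
  (forall z, N z -> pow2A iota s (bform iota q z (vec iota g u))) ->
  dvd2 (s + k) (((map_mx (alg_map R) u)^T *m beta m *m map_mx (alg_map R) x) 0 0).
Proof.
move=> mMN Mv vx hN.
have := maps_lat_pair tfR iota_inj gramE Bs mMN Mv vx hN.
by rewrite trmx_mul !fM -!map_trmx /beta !mulmxA.
Qed.

Let beta_delta m a b (x u : 'cV[A]_n) : x = delta_mx b 0 -> u = delta_mx a 0 ->
  ((map_mx (alg_map R) u)^T *m beta m *m map_mx (alg_map R) x) 0 0 = beta m a b.
Proof.
by move=> -> ->; rewrite !map_delta_mx trmx_delta -colE -rowE !mxE.
Qed.

(* 2 ^ (i + 2) times the dual basis vector of the functional that cuts out the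
   lattice Z_i in X_i. *)
Let zvec i : 'cV[A]_n := \col_a (if a \in E then
  2%:R * ((w a).+1 == i)%:R + (w a == i.+1)%:R else 0).

Let zvec_sum (S : comPzRingType) (h : {rmorphism A -> S}) i (r : 'I_n -> S) :
  \sum_a r a * h (zvec i a 0) = 2%:R * (\sum_(a in E | (w a).+1 == i) r a) +
     \sum_(a in E | w a == i.+1) r a.
Proof.
rewrite [X in 2%:R * X]big_mkcondr [X in _ + X]big_mkcondr /= mulr_sumr -big_split /=.
rewrite [RHS]big_mkcond; apply: eq_bigr => a _; rewrite mxE.
case: ifP => _; last by rewrite rmorph0 mulr0.
rewrite rmorphD rmorphM !rmorph_nat.
by case: ((w a).+1 == i); case: (w a == i.+1);
  rewrite /= ?(mulr0, mulr1, addr0, add0r, mulr2n); ring.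
Qed.

(** The pairing is 2 ^ (i + 1) times the quantity whose square gives 2 ^ -(i + 1) q modulo 2 in
    [quad_X]. On [Z_i] this square is even, hence so is the quantity. *)
Let zvec_XZ i x : (lat_X iota q i `&` lat_Z iota q i)%classic x ->
  pow2A iota i.+2 (bform iota q x (vec iota g (zvec i))).
Proof.
move=> xXZ; have [[xA _] _] := xXZ.
have [y [e yA]] := lat_A_ex iota_inj gramE gu gB Usym Ublock VU xA.
move: xXZ; rewrite e => /(lat_XZ_vec iota_inj tf gramE gu gB Usym Ublock UV VU)[yX qy].
rewrite (bform_vec gramE gB) pow2A_iota//= mxE.
have -> : \sum_a (y^T *m (pow2_mx A w *m U)) 0 a * zvec i a 0 =
   \sum_a (pow2_mx A w *m U *m y) a 0 * idfun (zvec i a 0).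
  apply: eq_bigr => a _; congr (_ * _).
  transitivity ((y^T *m (pow2_mx A w *m U))^T a 0); first by rewrite [RHS]mxE.
  by rewrite trmx_mul trmxK (Gsym Usym Ublock).
rewrite zvec_sum G_lin.
have [u uE] : dvd2 1 (\sum_(a in E | (w a).+1 == i) (U *m y) a 0).
  apply: dvd2_sum => a /andP[aE /eqP wa].
  apply: (dvd2_cancel tf (k := w a)).
  by rewrite -mul_pow2_mx mulmxA addn1 wa; apply: (in_AP Ublock VU i y).1.
have [c qE] := quad_X tf Usym Ublock Udiag yX (esym uE).
move: qy => /=; rewrite qE -addn1 => /(dvd2_cancel tf)[d]; rewrite expr1 => e2.
have [|z zE] := red (x := u + lin w E U i.+1 y) (y := d - c).
  by rewrite mulrBr -e2 addrK.
have -> : 2%:R * (\sum_(a in E | (w a).+1 == i) (pow2_mx A w *m U *m y) a 0) =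
    2%:R ^+ i.+1 * u.
  rewrite exprSr -mulrA -[2%:R * u]/(2%:R ^+ 1 * u) -uE !mulr_sumr.
  apply: eq_bigr => a /andP[_ /eqP <-].
  by rewrite -mulmxA mul_pow2_mx exprS mulrA.
by rewrite -mulrDr zE mulrA -exprSr addn1; exists z.
Qed.

Lemma monoid_ptsP m : monoid_pts iota q m <-> exists y, m = monoid_point y.
Proof.
split=> [mpt|[y ->]]; last exact: monoid_pts_point.
suff [y yE] : exists y, beta m = theta_mx w E y by exists y; apply: beta_point.
have mAB i : maps_lat iota (m - 1%:M) (lat_A iota q i) (lat_B iota q i).
  by have [_ []] := mpt i.
have mW i : maps_lat iota (m - 1%:M) (lat_W iota q i)
    (lat_X iota q i `&` lat_Z iota q i)%classic by have [_ []] := mpt i.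
have mD i : maps_lat iota (m - 1%:M)
    (dual iota q (lat_X iota q i `&` lat_Z iota q i)%classic)
    (dual iota q (lat_W iota q i)) by have [_ []] := mpt i.
have dA b : lat_A iota q (w b) (vec iota g (delta_mx b 0)).
  apply/(lat_A_vec iota_inj gramE gu gB Usym Ublock VU).
  exact: in_A_delta.
have dW b : b \in E -> lat_W iota q (w b) (vec iota g (delta_mx b 0)).
  exact: (lat_W_delta iota_inj tf gramE gu gB Usym Ublock UV VU Ew Udiag).
have vL (x : 'cV[A]_n) : lat_L iota (vec iota g x) by exists (g *m x).
have s1 v : 2%:R ^+ 0 *: v = v :> 'cV[F]_n by rewrite scale1r.
have epsE a : a \in E -> eps A w E (w a) = delta_mx a 0.
  move=> aE; apply/matrixP => b j; rewrite (ord1 j) !mxE eqxx andbT; congr (_ _)%:R.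
  apply/andP/eqP => [[bE /eqP wb]|->]; [exact: Ew|by rewrite aE].
apply: dvd_theta => //.
- move=> a b; rewrite /beta BRg -!mulmxA mul_pow2_mx; exact: dvd2_exp.
- move=> a b; rewrite -[w b]addn0 -(beta_delta m (erefl (delta_mx b 0)) (erefl (delta_mx a 0))).
  apply: (pair_beta (mAB (w b)) (dA b) (s1 _)) => z [[_ zA] _].
  exact: zA.
- move=> a b aE wab; rewrite wab -[(w b).+1]addn0.
  rewrite -(beta_delta m (erefl (delta_mx b 0)) (erefl (delta_mx a 0))).
  apply: (pair_beta (mAB (w b)) (dA b) (s1 _)) => z zB; have [zA _] := zB.
  have [x [e xA]] := lat_A_ex iota_inj gramE gu gB Usym Ublock VU zA.
  move: zB; rewrite e => /(lat_B_vec iota_inj tf red gramE gu gB Usym Ublock VU Udiag)[_ xl].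
  rewrite -(epsE a aE) wab (bform_vec gramE gB) (bil_eps E Usym Ublock) pow2A_iota//.
  by rewrite -addn1; apply: dvd2M => //; exists 1; rewrite mulr1.
- move=> a b bE wab; rewrite wab -[(w b).+1]addn0.
  rewrite -(beta_delta m (erefl (delta_mx b 0)) (erefl (delta_mx a 0))).
  apply: (pair_beta (mW (w b)) (dW b bE) (s1 _)) => z [[_ zX] _].
  by apply: zX; rewrite -wab.
- move=> c cE; rewrite -(zvec_sum (alg_map R) (w c) (fun a => beta m a c)).
  have e : \sum_a beta m a c * alg_map R (zvec (w c) a 0) =
      ((map_mx (alg_map R) (zvec (w c)))^T *m beta m *m
        map_mx (alg_map R) (delta_mx c 0 : 'cV[A]_n)) 0 0.
    rewrite map_delta_mx -colE !mxE; apply: eq_bigr => a _; by rewrite !mxE mulrC.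
  rewrite /= e -[(w c).+2]addn0.
  apply: (pair_beta (mW (w c)) (dW c cE) (s1 _)) => z.
  exact: zvec_XZ.
- move=> c cE; rewrite -(zvec_sum (alg_map R) (w c) (fun a => beta m c a)).
  have e : \sum_a beta m c a * alg_map R (zvec (w c) a 0) =
      ((map_mx (alg_map R) (delta_mx c 0 : 'cV[A]_n))^T *m beta m *m
        map_mx (alg_map R) (zvec (w c))) 0 0.
    rewrite map_delta_mx trmx_delta -rowE !mxE; apply: eq_bigr => a _; by rewrite !mxE.
  rewrite /= e -[(w c).+2]add0n.
  (* By [zvec_XZ] this vector is in the dual of the intersection of X and Z; its image pairs
     integrally with W, and clearing the denominator yields the divisibility. *)
  pose z := (2%:R ^+ (w c).+2)^-1 *: vec iota g (zvec (w c)).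
  have two0 : 2%:R ^+ (w c).+2 != 0 :> F.
    rewrite expf_neq0// -(rmorph_nat iota); apply/eqP => e0.
    have e2 : 2%:R = 0 :> A by apply: iota_inj; rewrite e0 rmorph0.
    by have := @tf 1; rewrite e2 mul0r => /(_ erefl) /eqP; rewrite oner_eq0.
  apply: (pair_beta (v := z) (mD (w c))) => [y yXZ| |y yW].
  - have [a ea] := zvec_XZ yXZ; exists a.
    rewrite /z bform_scale expr0 mul1r (bform_sym gramE Bs) ea mulrA mulVf ?mul1r//.
  - by rewrite /z scalerA divff// scale1r.
  - exact/yW/dW.
Qed.

Lemma isom_point m m' : reduced_mod2 R -> m *m m' = 1%:M -> m' *m m = 1%:M ->
  m^T *m BR *m m = BR -> exists y, m = monoid_point y.
Proof.
move=> redR mm' m'm mB.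
pose k := gR' *m m *m gR; pose k' := gR' *m m' *m gR.
have kk' : k *m k' = 1%:M.
  by rewrite /k /k' !mulmxA -(mulmxA _ gR gR') gRK mulmx1 -(mulmxA gR') mm' mulmx1 gRK'.
have k'k : k' *m k = 1%:M.
  by rewrite /k /k' !mulmxA -(mulmxA _ gR gR') gRK mulmx1 -(mulmxA gR') m'm mulmx1 gRK'.
have mgk : gR *m k = m *m gR by rewrite /k !mulmxA gRK mul1mx.
clearbody k k'.
have kG : k^T *m (pow2_mx R w *m UR) *m k = pow2_mx R w *m UR.
  rewrite -gRB !mulmxA -trmx_mul mgk -(mulmxA _ gR) mgk trmx_mul !mulmxA.
  by rewrite -(mulmxA _ m^T) -(mulmxA _ _ m) mB.
have [y yE] := isom_theta tfR URsym URblock URV VRU URdiag redR Ew kk' k'k kG.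
exists y; apply: beta_point; rewrite -yE -gRB -!(mulmxA _ gR) mgk.
by rewrite mulmxBr mulmx1 mulmxBl !mulmxA.
Qed.
End Points.

(** * The stabilizer scheme *)

Section LocLift.
Variables (A : comNzRingType) (R S : algebra A) (s : R) (h : alghom R S) (t : S).
Hypothesis ht : h s * t = 1.

Definition loc_lift (x : loc s) : S := h (Loc.num x) * t ^+ Loc.den x.

Lemma loc_liftE r k : loc_lift (loc_frac s r k) = h r * t ^+ k.
Proof.
have tX j : t ^+ j * h s ^+ j = 1 by rewrite -exprMn mulrC ht expr1n.
have /Loc.fracP[N] := Loc.numdenK (loc_frac s r k).
rewrite /loc_lift; set r' := Loc.num _; set k' := Loc.den _ => /(congr1 h).
rewrite !rmorphM !rmorphXn => /(congr1 (fun z => t ^+ N * z)).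
rewrite !mulrA !tX !mul1r => e; clearbody r' k'.
rewrite -[LHS]mul1r -(tX k) -[RHS]mul1r -(tX k').
transitivity (t ^+ k * t ^+ k' * (h s ^+ k * h r')); first by ring.
by rewrite e; ring.
Qed.

Lemma loc_lift_zmod_morphism : zmod_morphism loc_lift.
Proof.
have tX j : h s ^+ j * t ^+ j = 1 by rewrite -exprMn ht expr1n.
elim/Loc.fracW=> a i; elim/Loc.fracW=> b j.
rewrite -[X in loc_lift X]/(Loc.add _ (Loc.opp _)) Loc.oppE Loc.addE !loc_liftE.
rewrite rmorphD !rmorphM rmorphN !rmorphXn exprD.
transitivity ((h s ^+ j * t ^+ j) * (h a * t ^+ i) - (h s ^+ i * t ^+ i) * (h b * t ^+ j)).
  by ring.
by rewrite !tX !mul1r.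
Qed.

Lemma loc_lift_monoid_morphism : monoid_morphism loc_lift.
Proof.
split=> [|]; first by rewrite -[1]/(loc_frac s 1 0) loc_liftE rmorph1 mul1r.
elim/Loc.fracW=> a i; elim/Loc.fracW=> b j.
rewrite -[X in loc_lift X]/(Loc.mul _ _) Loc.mulE !loc_liftE rmorphM exprD.
by ring.
Qed.

HB.instance Definition _ := GRing.isZmodMorphism.Build (loc s) S loc_lift
  loc_lift_zmod_morphism.
HB.instance Definition _ := GRing.isMonoidMorphism.Build (loc s) S loc_lift
  loc_lift_monoid_morphism.

Lemma loc_lift_alg a : loc_lift (alg_map (loc_alg s) a) = alg_map S a.
Proof. by rewrite [LHS]loc_liftE mulr1 alghomP. Qed.

Definition loc_lift_hom : alghom (loc_alg s) S :=
  @AlgHom A (loc_alg s) S loc_lift loc_lift_alg.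

Lemma loc_lift_to_loc x : loc_lift_hom (to_loc s x) = h x.
Proof. by rewrite [LHS]loc_liftE mulr1. Qed.
End LocLift.

Section LocHom.
Variables (A : comNzRingType) (R S : algebra A) (s : R).

Definition to_loc_hom : alghom R (loc_alg s) :=
  @AlgHom A R (loc_alg s) (to_loc s) (fun=> erefl).

Lemma to_loc_unit : to_loc s s * loc_frac s 1 1 = 1.
Proof.
rewrite -[LHS]/(Loc.mul _ _) Loc.mulE -[RHS]/(loc_frac s 1 0).
by apply/Loc.fracP; exists 0%N; ring.
Qed.

Lemma loc_hom_eq (f g : alghom (loc_alg s) S) :
  (forall x, f (to_loc s x) = g (to_loc s x)) -> f =1 g.
Proof.
move=> h; elim/Loc.fracW => r k.
have -> : loc_frac s r k = to_loc s r * loc_frac s 1 1 ^+ k.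
  have -> : loc_frac s 1 1 ^+ k = loc_frac s 1 k.
    elim: k => // k IH; rewrite exprS IH -[LHS]/(Loc.mul _ _) Loc.mulE mulr1.
    by rewrite add1n.
  by rewrite -[RHS]/(Loc.mul _ _) Loc.mulE mulr1.
have e : f (loc_frac s 1 1) = g (loc_frac s 1 1).
  have fu : f (to_loc s s) * f (loc_frac s 1 1) = 1.
    by rewrite -rmorphM to_loc_unit rmorph1.
  have gu : f (to_loc s s) * g (loc_frac s 1 1) = 1.
    by rewrite h -rmorphM to_loc_unit rmorph1.
  by rewrite -[LHS]mulr1 -gu mulrA [f _ * f _]mulrC fu mul1r.
by rewrite !rmorphM !rmorphXn h e.
Qed.
End LocHom.

Section SmoothIso.
Variables (A : comNzRingType) (R S : algebra A) (f : alghom R S) (g : alghom S R).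
Hypothesis fg : forall x, f (g x) = x.
Hypothesis gf : forall x, g (f x) = x.

Lemma smooth_iso : smooth R -> smooth S.
Proof.
move=> [[k [p [l [r [psurj pker]]]]] Rs]; split; last first.
  move=> T T' u v ue; have [h hE] := Rs _ _ u (alghom_comp v f) ue.
  by exists (alghom_comp h g) => x; rewrite -[in RHS](fg x); apply: hE.
exists k, (alghom_comp f p), l, r; split=> [y|x].
  by have [x xE] := psurj (g y); exists x; rewrite /= xE.
rewrite -pker; split=> [/= e|/= ->]; last by rewrite rmorph0.
by rewrite -[LHS]gf e rmorph0.
Qed.
End SmoothIso.

Section StabMap.
Variables (n : nat) (w : 'I_n -> nat) (E : {set 'I_n}) (R S : comPzRingType).
Variables (h : {rmorphism R -> S}) (V hV : 'M[R]_n).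

Lemma map_coef a c d b : h (coef w E V a c d b) = coef w E (map_mx h V) a c d b.
Proof. by rewrite /coef rmorphM rmorphXn rmorph_nat mxE. Qed.

Lemma map_star (y z : 'M[R]_n) : map_mx h (star w E V y z) =
  star w E (map_mx h V) (map_mx h y) (map_mx h z).
Proof.
apply/matrixP => a b; rewrite !mxE rmorph_sum; apply: eq_bigr => c _.
rewrite rmorph_sum; apply: eq_bigr => d _.
by rewrite 2!rmorphM map_coef !mxE.
Qed.

Lemma map_stab_eqn (y : 'M[R]_n) : map_mx h (stab_eqn w E V hV y) =
  stab_eqn w E (map_mx h V) (map_mx h hV) (map_mx h y).
Proof.
apply/matrixP => a b; rewrite [LHS]mxE [in LHS]mxE [RHS]mxE.
case: eqP => _; last first.
  by rewrite !rmorphD map_trmx -map_star !mxE.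
rewrite rmorphD /half_diag rmorphD !rmorph_sum !mxE; congr (_ + (_ + _)).
  by apply: eq_bigr => c _; rewrite rmorphM rmorphXn !mxE.
apply: eq_bigr => c _; rewrite rmorph_sum; apply: eq_bigr => d _.
by rewrite 2!rmorphM map_coef !mxE.
Qed.

Lemma map_theta_mx' (y : 'M[R]_n) : map_mx h (theta_mx' w E y) = theta_mx' w E (map_mx h y).
Proof. by apply/matrixP => a b; rewrite !mxE rmorphM rmorphXn rmorph_nat. Qed.
End StabMap.

(** * The integral Gram matrix and polarization *)

Section GramMatrix.
Variables (F : fieldType) (A : idomainType) (iota : {rmorphism A -> F}).
Variables (n : nat) (q : 'cV[A]_n -> A).
Hypothesis iota_inj : injective iota.
Hypothesis tf : torsion_free A.
Hypothesis Hq : quadratic_form q.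

Lemma polar_sym x y : polar q x y = polar q y x.
Proof. by rewrite /polar [y + x]addrC addrAC. Qed.

Lemma polar_diag x : polar q x x = 2%:R * q x.
Proof.
have [h _] := Hq; have := h 2%:R x; rewrite scaler_nat mulr2n /polar => ->.
by ring.
Qed.

Lemma gram_exists : integral_form iota q -> exists B : 'M[A]_n,
  [/\ gram iota q = map_mx iota B, B^T = B, forall i, q (std_basis A i) = B i i &
      forall i j, polar q (std_basis A i) (std_basis A j) = 2%:R * B i j].
Proof.
move=> Hint.
have two0 : 2%:R != 0 :> F.
  rewrite -(rmorph_nat iota); apply/eqP => e0.
  have e2 : 2%:R = 0 :> A by apply: iota_inj; rewrite e0 rmorph0.
  by have := @tf 1; rewrite e2 mul0r => /(_ erefl) /eqP; rewrite oner_eq0.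
have dL i : lat_L iota (delta_mx i 0 : 'cV[F]_n).
  by exists (delta_mx i 0); rewrite map_delta_mx.
have /choice[B BE] (ij : 'I_n * 'I_n) : exists b, gram iota q ij.1 ij.2 = iota b.
  have [b e] := Hint _ _ (dL ij.1) (dL ij.2); exists b.
  by rewrite expr0 mul1r in e; rewrite -e /bform trmx_delta -rowE -colE !mxE.
have polE i j : polar q (std_basis A i) (std_basis A j) = 2%:R * B (i, j).
  apply: iota_inj; rewrite rmorphM rmorph_nat -BE mxE mulrC divfK//.
exists (\matrix_(i, j) B (i, j)); split.
- by apply/matrixP => i j; rewrite [RHS]mxE [in RHS]mxE -(BE (i, j)).
- apply/matrixP => i j; rewrite !mxE; apply: (exp2I tf (k := 1)).
  by rewrite /= expr1 -!polE polar_sym.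
- by move=> i; rewrite mxE; apply: (exp2I tf (k := 1)); rewrite /= expr1 -polE polar_diag.
- by move=> i j; rewrite mxE polE.
Qed.

Variable B : 'M[A]_n.
Hypothesis Bs : B^T = B.
Hypothesis qB : forall i, q (std_basis A i) = B i i.
Hypothesis polB : forall i j, polar q (std_basis A i) (std_basis A j) = 2%:R * B i j.
Variable R : algebra A.
Local Notation BR := (map_mx (alg_map R) B).

Lemma base_qE (x : 'cV[R]_n) : base_q q x = (x^T *m BR *m x) 0 0.
Proof.
have -> : (x^T *m BR *m x) 0 0 = \sum_a \sum_b x a 0 * BR a b * x b 0.
  rewrite mxE exchange_big; apply: eq_bigr => b _.
  by rewrite mxE mulr_suml; apply: eq_bigr => a _; rewrite !mxE.
rewrite double_sum_sym; last first.
  by move=> a b; rewrite -{1}Bs !mxE; ring.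
rewrite /base_q; congr (_ + _); first by apply: eq_bigr => i _; rewrite qB !mxE; ring.
rewrite mulr_sumr [RHS](eq_bigr (fun a : 'I_n => \sum_(b < n | (b < a)%N)
  alg_map R (polar q (std_basis A b) (std_basis A a)) * x b 0 * x a 0)); last first.
  move=> a _; rewrite mulr_sumr; apply: eq_bigr => b _.
  by rewrite polB rmorphM rmorph_nat !mxE -{1}Bs mxE; ring.
by rewrite [RHS](exchange_big_dep predT).
Qed.

Lemma form_preserves_q m : m^T *m BR *m m = BR -> preserves_q q m.
Proof.
by move=> e x; rewrite !base_qE trmx_mul -{2}e !mulmxA.
Qed.

(** Polarization recovers twice each entry of the matrix, and 2 cancels. *)
Lemma preserves_q_form m : torsion_free R -> preserves_q q m -> m^T *m BR *m m = BR.
Proof.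
move=> tfR h; pose C := m^T *m BR *m m.
have Cs : C^T = C by rewrite /C !trmx_mul trmxK map_trmx Bs mulmxA.
have BRs : BR^T = BR by rewrite map_trmx Bs.
have e (x : 'cV[R]_n) : (x^T *m C *m x) 0 0 = (x^T *m BR *m x) 0 0.
  by rewrite -!base_qE -h base_qE trmx_mul /C !mulmxA.
have form_delta (M : 'M[R]_n) i j :
    ((delta_mx i 0 : 'cV[R]_n)^T *m M *m (delta_mx j 0 : 'cV[R]_n)) 0 0 = M i j.
  by rewrite trmx_delta -rowE -colE !mxE.
have formD (M : 'M[R]_n) (x y : 'cV[R]_n) : ((x + y)^T *m M *m (x + y)) 0 0 =
    (x^T *m M *m x) 0 0 + (x^T *m M *m y) 0 0 + (y^T *m M *m x) 0 0 +
    (y^T *m M *m y) 0 0.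
  have addE k l (X Y : 'M[R]_(k, l)) a b : (X + Y) a b = X a b + Y a b by rewrite mxE.
  have -> : (x + y)^T = x^T + y^T by rewrite linearD.
  by rewrite mulmxDr !mulmxDl !addE -!addrA; congr (_ + _); rewrite addrCA.
apply/matrixP => i j; rewrite -/C; apply: (exp2I tfR (k := 1)); rewrite /= expr1.
pose x : 'cV[R]_n := delta_mx i 0; pose y : 'cV[R]_n := delta_mx j 0.
have polar_form (M : 'M[R]_n) : M^T = M -> 2%:R * M i j =
    ((x + y)^T *m M *m (x + y)) 0 0 - M i i - M j j.
  move=> Ms; rewrite formD !form_delta.
  have -> : M j i = M i j by rewrite -{1}Ms mxE.
  by ring.
rewrite (polar_form C)// (polar_form BR)// e; congr (_ - _ - _).
  by rewrite -!(form_delta _ i i) e.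
by rewrite -!(form_delta _ j j) e.
Qed.
End GramMatrix.

Section InverseMatrix.
Variables (R : comPzRingType) (n : nat).

Lemma mx_inverse (m : 'M[R]_n) t : \det m * t = 1 ->
  m *m (t *: \adj m) = 1%:M /\ (t *: \adj m) *m m = 1%:M.
Proof.
move=> e; rewrite -scalemxAr -scalemxAl mul_mx_adj mul_adj_mx.
by rewrite scale_scalar_mx mulrC e.
Qed.
End InverseMatrix.

(** * The scheme defined by the halved equations *)

Section Model.
Variables (A : idomainType) (n : nat) (w : 'I_n -> nat) (E : {set 'I_n}).
Variables (V hV : 'M[A]_n).
Hypothesis two_neq0 : 2%:R != 0 :> A.
Hypothesis two_val : forall a : A, a != 0 ->
  exists k u, u \is a GRing.unit /\ a = 2%:R ^+ k * u.
Hypothesis Vsym : V^T = V.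
Hypothesis Vblock : forall a b, w a != w b -> V a b = 0.
Hypothesis hVE : forall a c, 2%:R * hV a c = coef w E V a c c a.

Definition coord_alg : algebra A := mpoly_alg A (n * n).
Definition coord_mx : 'M[coord_alg]_n := \matrix_(a, b) 'X_(mxvec_index a b).

Local Notation eqn R y := (stab_eqn w E (map_mx (alg_map R) V)
  (map_mx (alg_map R) hV) y).

Definition model_eqn (j : 'I_(n * n)) : coord_alg :=
  mxvec (eqn coord_alg coord_mx) 0 j.

Definition model : algebra A := quot_alg (ideal_gen_ideal model_eqn).
Definition model_hom : alghom coord_alg model := quot_hom (ideal_gen_ideal model_eqn).
Definition model_mx : 'M[model]_n := map_mx model_hom coord_mx.

Lemma map_alg (R S : algebra A) (f : alghom R S) k l (M : 'M[A]_(k, l)) :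
  map_mx f (map_mx (alg_map R) M) = map_mx (alg_map S) M.
Proof. by apply/matrixP => i j; rewrite !mxE alghomP. Qed.

Lemma map_eqn (R S : algebra A) (f : alghom R S) y :
  map_mx f (eqn R y) = eqn S (map_mx f y).
Proof. by rewrite map_stab_eqn !map_alg. Qed.

Lemma coord_eval (R : algebra A) (y : 'M[R]_n) :
  exists f : alghom coord_alg R, map_mx f coord_mx = y.
Proof.
have [f fE] := mpoly_eval (fun i => mxvec y 0 i).
by exists f; apply/matrixP => a b; rewrite !mxE fE mxvecE.
Qed.

Lemma coord_hom_eq (R : algebra A) (f g : alghom coord_alg R) :
  map_mx f coord_mx = map_mx g coord_mx -> f =1 g.
Proof.
move=> /matrixP e; apply: mpoly_alghom_eq => i.
by case/mxvec_indexP: i => a b; have := e a b; rewrite !mxE.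
Qed.

Lemma model_eqn0 : eqn model model_mx = 0.
Proof.
rewrite -map_eqn; apply/matrixP => a b; rewrite mxE [RHS]mxE.
apply/quot_hom0P; exists (fun j => (j == mxvec_index a b)%:R).
rewrite (bigD1 (mxvec_index a b))//= eqxx mul1r /model_eqn mxvecE big1 ?addr0//.
by move=> j /negbTE ->; rewrite mul0r.
Qed.

Lemma model_lift (R : algebra A) (y : 'M[R]_n) : eqn R y = 0 ->
  exists f : alghom model R, map_mx f model_mx = y.
Proof.
move=> ey; have [f fy] := coord_eval y.
have [x [b ->]|g gE] := quot_lift (ideal_gen_ideal model_eqn) (f := f).
  rewrite rmorph_sum big1// => j _; rewrite rmorphM.
  case/mxvec_indexP: j => a c; rewrite /model_eqn mxvecE.
  have /matrixP/(_ a c) := map_eqn f coord_mx.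
  by rewrite fy ey mxE [RHS]mxE => ->; rewrite mulr0.
exists g; rewrite -fy; apply/matrixP => a c.
by rewrite mxE [model_mx a c]mxE [RHS]mxE; apply: gE.
Qed.

Lemma model_hom_eq (R : algebra A) (f g : alghom model R) :
  map_mx f model_mx = map_mx g model_mx -> f =1 g.
Proof.
move=> e z; have [x <-] := quot_hom_surj z.
apply: (@coord_hom_eq R (alghom_comp f model_hom) (alghom_comp g model_hom)).
apply/matrixP => a b; have /matrixP/(_ a b) := e.
by rewrite [LHS]mxE [RHS]mxE => h; rewrite [LHS]mxE [RHS]mxE; move: h; rewrite mxE.
Qed.

(** Coordinates lifted by a set-theoretic section solve the equations modulo the kernel, and
    [stab_lift] corrects them. *)
Lemma model_formally_smooth : formally_smooth model.
Proof.
move=> T T' p f [psurj pK].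
have /choice[s sE] := psurj.
pose y : 'M[T]_n := map_mx s (map_mx f model_mx).
have py : map_mx p y = map_mx f model_mx.
  by apply/matrixP => a b; rewrite !mxE sE.
have KI : Quot.ideal (fun x : T => p x = 0).
  split=> [|u v hu hv|a u hu]; first exact: rmorph0.
    by rewrite rmorphD hu hv addr0.
  by rewrite rmorphM hu mulr0.
have VT : (map_mx (alg_map T) V)^T = map_mx (alg_map T) V by rewrite map_trmx Vsym.
have VTb a b : w a != w b -> map_mx (alg_map T) V a b = 0.
  by move=> /Vblock e; rewrite mxE e rmorph0.
have hVT a c : 2%:R * map_mx (alg_map T) hV a c = coef w E (map_mx (alg_map T) V) a c c a.
  by rewrite -map_coef -hVE rmorphM rmorph_nat mxE.
have [|z [Kz ez]] := stab_lift (y := y) VT VTb hVT KI pK.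
  move=> a b; have /matrixP/(_ a b) := map_eqn p y.
  by rewrite py -map_eqn model_eqn0 mxE => ->; rewrite !mxE rmorph0.
have [g gE] := model_lift ez; exists g.
apply: (@model_hom_eq T' (alghom_comp p g)).
apply/matrixP => a b.
have gab : g (model_mx a b) = y a b + z a b.
  by have /matrixP/(_ a b) := gE; rewrite [LHS]mxE [RHS]mxE.
have yab : p (y a b) = f (model_mx a b).
  by have /matrixP/(_ a b) := py; rewrite [LHS]mxE [RHS]mxE.
rewrite [LHS]mxE [RHS]mxE -yab; transitivity (p (g (model_mx a b))) => //.
by rewrite gab rmorphD Kz addr0.
Qed.

Lemma coord_torsion_free : torsion_free coord_alg.
Proof.
move=> x /eqP; rewrite mulf_eq0 -(rmorph_nat (@mpolyC (n * n) A)) mpolyC_eq0.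
by rewrite (negbTE two_neq0) => /eqP.
Qed.

Lemma model_torsion_free : torsion_free model.
Proof.
move=> z; have [x <-] := quot_hom_surj z.
rewrite -(rmorph_nat (quot_hom _)) -rmorphM => /quot_hom0P h.
apply/quot_hom0P.
apply: (@formally_smooth_torsion_free A (n * n) (n * n) model_eqn 2%:R).
- exact: noetherian_dyadic.
- by move=> u; rewrite rmorph_nat; apply: coord_torsion_free.
- exact: model_formally_smooth.
- by rewrite rmorph_nat.
Qed.

Lemma model_flat : flat model.
Proof. exact/(flatP two_neq0 two_val)/model_torsion_free. Qed.

Lemma coord_flat : flat coord_alg.
Proof. exact/(flatP two_neq0 two_val)/coord_torsion_free. Qed.

Lemma model_smooth : smooth model.
Proof.
split; last exact: model_formally_smooth.
exists (n * n)%N, model_hom, (n * n)%N, model_eqn; split; first exact: quot_hom_surj.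
by move=> p; apply: quot_hom0P.
Qed.
End Model.

Section Scheme.
Variables (F : fieldType) (A : idomainType) (iota : {rmorphism A -> F}).
Variables (n : nat) (q : 'cV[A]_n -> A) (B g : 'M[A]_n).
Variables (w : 'I_n -> nat) (E : {set 'I_n}) (U V hV : 'M[A]_n).
Hypothesis two_neq0 : 2%:R != 0 :> A.
Hypothesis two_val : forall a : A, a != 0 ->
  exists k u, u \is a GRing.unit /\ a = 2%:R ^+ k * u.
Hypothesis two_sqrt : forall a : A, exists b c, a = b ^+ 2 + 2%:R * c.
Hypothesis iota_inj : injective iota.
Hypothesis tf : torsion_free A.
Hypothesis red : reduced_mod2 A.
Hypothesis gramE : gram iota q = map_mx iota B.
Hypothesis Bs : B^T = B.
Hypothesis qB : forall i, q (std_basis A i) = B i i.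
Hypothesis polB : forall i j, polar q (std_basis A i) (std_basis A j) = 2%:R * B i j.
Hypothesis gu : g \in unitmx.
Hypothesis gB : g^T *m B *m g = pow2_mx A w *m U.
Hypothesis Usym : U^T = U.
Hypothesis Ublock : forall a b, w a != w b -> U a b = 0.
Hypothesis UV : U *m V = 1%:M.
Hypothesis VU : V *m U = 1%:M.
Hypothesis Ew : {in E &, injective w}.
Hypothesis Udiag : forall a, dvd2 1 (U a a - (\sum_(b in E) U a b) ^+ 2).
Hypothesis hVE : forall a c, 2%:R * hV a c = coef w E V a c c a.

Local Notation Vs := (Vsym Usym UV).
Local Notation Vb := (Vblock Ublock UV VU).
Local Notation pt y := (monoid_point g w E V y).
Local Notation eqn R y := (stab_eqn w E (map_mx (alg_map R) V)
  (map_mx (alg_map R) hV) y).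
Local Notation C := (coord_alg A n).
Local Notation yC := (coord_mx A n).
Local Notation G0 := (model w E V hV).
Local Notation y0 := (model_mx w E V hV).

Let ptsP (R : algebra A) (hR : torsion_free R) (m : 'M[R]_n) :
  monoid_pts iota q m <-> exists y, m = pt y.
Proof.
exact: (monoid_ptsP iota_inj tf red gramE Bs gu gB Usym Ublock UV VU Ew Udiag).
Qed.

Lemma map_point (R S : algebra A) (f : alghom R S) (y : 'M[R]_n) :
  map_mx f (pt y) = pt (map_mx f y).
Proof.
by rewrite /monoid_point map_mxD map_mx1 !map_mxM !map_alg map_theta_mx'.
Qed.

Let VR_sym (R : algebra A) : (map_mx (alg_map R) V)^T = map_mx (alg_map R) V.
Proof. by rewrite map_trmx Vs. Qed.

Let VR_block (R : algebra A) a b : w a != w b -> map_mx (alg_map R) V a b = 0.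
Proof. by move=> /Vb e; rewrite mxE e rmorph0. Qed.

Let hVR (R : algebra A) a c :
  2%:R * map_mx (alg_map R) hV a c = coef w E (map_mx (alg_map R) V) a c c a.
Proof. by rewrite -map_coef -hVE rmorphM rmorph_nat mxE. Qed.

Lemma point_isometry (R : algebra A) (y : 'M[R]_n) : torsion_free R ->
  preserves_q q (pt y) <-> eqn R y = 0.
Proof.
move=> hR; have form := point_form E Bs gu gB Usym Ublock UV VU y.
split=> [/(preserves_q_form Bs qB polB hR)|ey].
  rewrite form -[RHS]addr0 => /addrI e.
  apply: (stab_full0 (VR_sym R) (@VR_block R) (@hVR R)) => //.
  apply: (@theta_mx_inj _ w E R hR).
  have gg' : map_mx (alg_map R) (invmx g) *m map_mx (alg_map R) g = 1%:M := gRK' gu R.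
  rewrite (_ : theta_mx w E 0 = 0); last by apply/matrixP => a b; rewrite !mxE mulr0.
  have := congr1 (fun M => (map_mx (alg_map R) g)^T *m M *m map_mx (alg_map R) g) e.
  rewrite mulmx0 mul0mx !mulmxA -trmx_mul gg' trmx1 mul1mx.
  by rewrite -mulmxA gg' mulmx1.
apply: (form_preserves_q Bs qB polB); rewrite form.
rewrite (stab_eqn0 (VR_sym R) (@VR_block R) (@hVR R) ey).
rewrite (_ : theta_mx w E 0 = 0); last by apply/matrixP => a b; rewrite !mxE mulr0.
by rewrite mulmx0 mul0mx addr0.
Qed.

(** The equation says that [pt y^T] is a left inverse; over a commutative ring the determinant makes
    it two-sided. *)
Lemma point_unit (R : algebra A) (y : 'M[R]_n) : eqn R y = 0 ->
  pt y^T *m pt y = 1%:M /\ pt y *m pt y^T = 1%:M.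
Proof.
move=> /(stab_eqn0 (VR_sym R) (@VR_block R) (@hVR R)) e.
have h : pt y^T *m pt y = 1%:M := point_inv gu Ublock UV VU e.
have h2 : \det (pt y) * \det (pt y^T) = 1 by rewrite mulrC -det_mulmx h det1.
have [h3 _] := mx_inverse h2; split=> //.
set t := _ *: _ in h3; rewrite -[RHS]h3; congr (_ *m _).
by rewrite -[LHS]mulmx1 -h3 mulmxA h mul1mx.
Qed.

Lemma coord_represents : represents_monoid iota q (pt yC).
Proof.
split; first exact: coord_flat.
move=> R /(flatP two_neq0 two_val) hR; split=> [f|m /(ptsP hR)[y ->]].
  by rewrite map_point; apply/(ptsP hR); exists (map_mx f yC).
have [f fy] := coord_eval y; exists f; rewrite map_point fy; split=> // h.
rewrite map_point => /(point_inj gu gB UV hR) e; apply: coord_hom_eq.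
by rewrite e fy.
Qed.

Let G0flat : flat G0.
Proof. exact: model_flat two_neq0 two_val Vs Vb hVE. Qed.

Let G0tf : torsion_free G0.
Proof. exact/(flatP two_neq0 two_val). Qed.

Let G0eqn : eqn G0 y0 = 0. Proof. exact: model_eqn0. Qed.

Lemma map_det (R S : algebra A) (f : alghom R S) (M : 'M[R]_n) :
  f (\det M) = \det (map_mx f M).
Proof. by rewrite det_map_mx. Qed.

Let model_map : alghom C G0 := model_hom w E V hV.

Let model_det : model_map (\det (pt yC)) * \det (pt y0^T) = 1.
Proof.
have [e _] := point_unit G0eqn.
rewrite map_det map_point -[map_mx _ yC]/y0.
rewrite mulrC.
rewrite -det_mulmx.
by rewrite e det1.
Qed.

Let res : alghom (loc_alg (\det (pt yC))) G0 := loc_lift_hom model_det.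

Let res_to_loc x : res (to_loc _ x) = model_map x.
Proof. exact: loc_lift_to_loc. Qed.

Let univ_pt (R : algebra A) (f : alghom (loc_alg (\det (pt yC))) R) : 'M[R]_n :=
  map_mx (alghom_comp f (to_loc_hom _)) yC.

Let map_univ (R : algebra A) (f : alghom (loc_alg (\det (pt yC))) R) :
  map_mx (f \o to_loc (\det (pt yC))) (pt yC) = pt (univ_pt f).
Proof. exact: (map_point (alghom_comp f (to_loc_hom _))). Qed.

Let factor_eqn (R : algebra A) (f : alghom (loc_alg (\det (pt yC))) R)
  (h : alghom G0 R) : h \o res =1 f -> eqn R (univ_pt f) = 0.
Proof.
move=> hf; have -> : univ_pt f = map_mx h y0.
  apply/matrixP => a b; rewrite mxE [RHS]mxE [y0 a b]mxE.
  by rewrite -res_to_loc; symmetry; apply: hf.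
by rewrite -map_eqn G0eqn; apply/matrixP => a b; rewrite !mxE rmorph0.
Qed.

Let eqn_factor (R : algebra A) (f : alghom (loc_alg (\det (pt yC))) R) :
  eqn R (univ_pt f) = 0 -> exists h : alghom G0 R, h \o res =1 f.
Proof.
move=> ey; have [h hy] := model_lift ey; exists h.
apply: (@loc_hom_eq _ _ _ _ (alghom_comp h res) f) => x.
have e : alghom_comp h model_map =1 alghom_comp f (to_loc_hom _).
  apply: coord_hom_eq; rewrite -[RHS]hy; apply/matrixP => a b.
  by rewrite mxE [RHS]mxE [y0 a b]mxE.
by rewrite -[RHS]e; congr (h _); apply: res_to_loc.
Qed.

Let res_surj y : exists x, res x = y.
Proof. by have [x <-] := quot_hom_surj y; exists (to_loc _ x); apply: res_to_loc. Qed.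

Lemma stabilizer_exists : inhabited (stabilizer_scheme iota q).
Proof.
constructor; refine (@StabilizerScheme _ _ _ _ _ _ _ coord_represents G0 res _ G0flat _).
  exact: res_surj.
move=> R /(flatP two_neq0 two_val) hR f.
rewrite map_univ point_isometry//; split=> [[h]|]; first exact: factor_eqn.
exact: eqn_factor.
Qed.

Section AnyScheme.
Variable G : stabilizer_scheme iota q.
Let s := \det (uM G).
Let univ : alghom (AM G) (AG G) := alghom_comp (res_G G) (to_loc_hom s).

(** Inverting the determinant amounts to asking for an inverse matrix: the adjugate supplies one,
    and conversely [\det m'] inverts [\det m]. *)
Lemma stabilizer_ptsP (R : algebra A) (hR : flat R) (m : 'M[R]_n) :
  stabilizer_pts G R m <-> monoid_pts iota q m /\ isometries q R m.
Proof.
have [_ repr] := AM_represents G; have [reprm reprw] := repr R hR.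
split=> [[f ->]|[mpt [[m' [mm' m'm]] mq]]].
  pose h := alghom_comp f univ.
  have -> : map_mx (f \o (res_G G \o to_loc s)) (uM G) = map_mx h (uM G) by [].
  split; first exact: reprm.
  split; last first.
    have [+ _] := @AG_pts _ _ _ _ _ G R hR (alghom_comp f (res_G G)).
    by apply; exists f.
  have e : \det (map_mx h (uM G)) * f (res_G G (loc_frac s 1 1)) = 1.
    rewrite -map_det /= -!rmorphM -[RHS](rmorph1 (alghom_comp f (res_G G))) /=.
    by congr (f (res_G G _)); apply: to_loc_unit.
  by have [h1 h2] := mx_inverse e; exists (f (res_G G (loc_frac s 1 1)) *: \adj (map_mx h (uM G))).
have [f [fm fu]] := reprw m mpt.
have e : f s * \det m' = 1 by rewrite map_det fm -det_mulmx mm' det1.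
have [_] := @AG_pts _ _ _ _ _ G R hR (loc_lift_hom e).
have -> : map_mx (loc_lift_hom e \o to_loc s) (uM G) = m.
  by rewrite -fm; apply/matrixP => a b; rewrite !mxE [LHS]loc_lift_to_loc.
move=> /(_ mq)[h hE]; exists h; rewrite -fm; apply/matrixP => a b.
by rewrite !mxE -[LHS](loc_lift_to_loc e) -hE.
Qed.

Lemma stabilizer_smooth : smooth (AG G).
Proof.
have Gflat : flat (AG G) by case: (G).
have /(flatP two_neq0 two_val) Gtf := Gflat.
(* The universal point of the model, tested on the flat algebra [G0], gives [psi]; that of [AG G]
   gives [phi] in the other direction. *)
have /(stabilizer_ptsP G0flat)[psi psiE] : monoid_pts iota q (pt y0) /\ isometries q G0 (pt y0).
  split; first by apply/(ptsP G0tf); exists y0.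
  split; last exact/point_isometry.
  by have [h1 h2] := point_unit G0eqn; exists (pt y0^T).
have : stabilizer_pts G (AG G) (map_mx univ (uM G)).
  by exists (alghom_id (AG G)).
move=> /(stabilizer_ptsP Gflat)[/(ptsP Gtf)[yG mG] [_ mq]].
have eG : eqn (AG G) yG = 0 by apply/point_isometry => //; rewrite -mG.
have [phi phiE] := model_lift eG.
(* Both compositions fix the universal point. On [AG G] this forces the identity by representability
   of M, since [AG G] is a quotient of a localization of [AM G]. *)
apply: (smooth_iso (f := phi) (g := psi)); last exact: model_smooth Vs Vb hVE.
  move=> z; have [x <-] := res_G_surj z.
  have [_ repr] := AM_represents G; have [_ reprw] := repr _ Gflat.
  have [|f [_ fu]] := reprw (map_mx univ (uM G)).
    by apply/(ptsP Gtf); exists yG.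
  apply: (@loc_hom_eq _ _ _ _ (alghom_comp phi (alghom_comp psi (res_G G))) (res_G G)) => u.
  rewrite [RHS](fu univ erefl u).
  apply: (fu (alghom_comp phi (alghom_comp psi univ))).
  have -> : map_mx (alghom_comp phi (alghom_comp psi univ)) (uM G) =
      map_mx phi (map_mx (psi \o (res_G G \o to_loc s)) (uM G)).
    by apply/matrixP => a b; rewrite !mxE.
  by rewrite -psiE map_point phiE -mG.
move=> x; apply: (@model_hom_eq _ _ _ _ _ _ _ (alghom_comp psi phi) (alghom_id G0)).
have -> : map_mx (alghom_comp psi phi) y0 = map_mx psi yG.
  by rewrite -phiE; apply/matrixP => a b; rewrite !mxE.
apply: (point_inj (E := E) gu gB UV G0tf); rewrite -[LHS](map_point psi) -mG.
have -> : map_mx (alghom_id G0) y0 = y0 by apply/matrixP => a b; rewrite mxE.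
by rewrite psiE; apply/matrixP => a b; rewrite !mxE.
Qed.

Lemma stabilizer_etale (R : algebra A) : etale R ->
  stabilizer_pts G R = isometries q R.
Proof.
move=> eR; have hR : flat R by case: eR.
have /(flatP two_neq0 two_val) tR := hR.
have rR := etale_reduced_mod2 two_val two_sqrt eR.
apply/seteqP; split=> m; first by move=> /(stabilizer_ptsP hR)[].
move=> mi; apply/(stabilizer_ptsP hR); split=> //; apply/(ptsP tR).
have [[m' [mm' m'm]] mq] := mi.
apply: (isom_point gu gB Usym Ublock UV VU Ew Udiag tR rR mm' m'm).
exact: (preserves_q_form Bs qB polB tR mq).
Qed.
End AnyScheme.
End Scheme.

(** * Unramified dyadic rings of integers *)

Section Dyadic.
Variables (Z2 : idomainType) (res : forall k : nat, {rmorphism Z2 -> 'Z_(2 ^ k.+1)%N}).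
Hypothesis HZ2 : dyadic_integers res.

Let pow_gt1 k : (1 < 2 ^ k.+1)%N.
Proof. by rewrite -{1}(expn0 2) ltn_exp2l. Qed.

Let res_lt k z : (res k z < 2 ^ k.+1)%N.
Proof. by have := ltn_ord (res k z); rewrite [X in (_ < X)%N](Zp_cast (pow_gt1 k)). Qed.

Lemma dyadic_inj z z' : (forall k, res k z = res k z') -> z = z'.
Proof.
move=> e; have [compat ex] := HZ2.
have [z0 [_ uniq_z0]] := ex _ (compat z').
by rewrite (uniq_z0 z e) (uniq_z0 z').
Qed.

Lemma dyadic_even (z : Z2) : (res 0 z : nat) = 0%N -> exists z', z = 2%:R * z'.
Proof.
move=> z0; have [compat ex] := HZ2.
have odd0 k : odd (res k z) = false.
  elim: k => [|k IH]; first by rewrite z0.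
  by have := congr1 odd (compat z k); rewrite !odd_mod ?oddX// IH.
(* Half of an even residue modulo 2 ^ (k + 2) is defined modulo 2 ^ (k + 1), hence the shift of the
   index. *)
pose a k : 'Z_(2 ^ k.+1)%N := ((res k.+1 z)./2)%:R.
have /ex[z' [z'E _]] : forall k, ((a k.+1 : nat) = (a k : nat) %[mod 2 ^ k.+1])%N.
  move=> k; rewrite /a !val_Zp_nat// modn_dvdm ?dvdn_exp2l// modn_mod.
  have := compat z k.+1; rewrite [in RHS]modn_small ?res_lt// => <-.
  move: (nat_of_ord (res k.+2 z)) => x.
  rewrite [in LHS](divn_eq x (2 ^ k.+2)) expnS mulnCA mul2n.
  by rewrite halfD doubleK odd_double /= add0n modnMDl -expnS.
exists z'; apply: dyadic_inj => k; rewrite rmorphM rmorph_nat z'E /a -natrM mul2n.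
rewrite even_halfK ?odd0//; apply: val_inj.
rewrite /= val_Zp_nat//; have := compat z k.
by rewrite [in RHS]modn_small.
Qed.

Lemma dyadic_mod2 (z : Z2) : exists z', z = 2%:R * z' \/ z = 1 + 2%:R * z'.
Proof.
have : ((res 0 z : nat) < 2)%N := res_lt 0 z.
case e: (res 0 z : nat) => [|[|//]] _.
  by have [z' ->] := dyadic_even e; exists z'; left.
have [|z' ez] := @dyadic_even (z - 1).
  by rewrite rmorphB rmorph1 (_ : res 0 z = 1) ?subrr//; apply: val_inj.
by exists z'; right; rewrite -ez addrC subrK.
Qed.

(** Otherwise z is divisible by every power of 2, so all its residues vanish. *)
Lemma dyadic_valuation (z : Z2) : z != 0 ->
  exists k z', z = 2%:R ^+ k * (1 + 2%:R * z').
Proof.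
move=> nz; apply: contrapT => H; move/eqP: nz; apply; apply: dyadic_inj => k.
have [z' ->] : exists z', z = 2%:R ^+ k.+1 * z'; last first.
  rewrite rmorphM rmorphXn rmorph_nat -natrX rmorph0.
  rewrite (_ : _%:R = 0) ?mul0r//; apply: val_inj.
  by rewrite /= val_Zp_nat// modnn.
elim: k.+1 => [|m [z' ez]]; first by exists z; rewrite expr0 mul1r.
have [z'' [e|e]] := dyadic_mod2 z'; last by case: H; exists m, z''; rewrite -e.
by exists z''; rewrite exprSr -mulrA -e.
Qed.

Lemma dyadic_two_neq0 : 2%:R != 0 :> Z2.
Proof.
apply/eqP => /(congr1 (fun z => res 1 z : nat)).
by rewrite rmorph_nat rmorph0 val_Zp_nat.
Qed.
End Dyadic.

(** * Integral extensions in which 2 generates the maximal ideal *)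

Section IntegralDvr.
Variables (Z2 A : idomainType) (j : {rmorphism Z2 -> A}).
Hypothesis Z2_mod2 : forall z : Z2, exists z', z = 2%:R * z' \/ z = 1 + 2%:R * z'.
Hypothesis j_integral : forall a,
  exists2 p : {poly Z2}, p \is monic & root (map_poly j p) a.
Hypothesis two_max : unramified2 A.

Let even (a : A) := exists b, a = 2%:R * b.

Let evenD a b : even a -> even b -> even (a + b).
Proof. by move=> [a' ->] [b' ->]; exists (a' + b'); rewrite mulrDr. Qed.

Let evenM a b : even a -> even (b * a).
Proof. by move=> [a' ->]; exists (b * a'); rewrite mulrCA. Qed.

Lemma dvr_reduced_mod2 : reduced_mod2 A.
Proof.
move=> x y e; apply/two_max; apply/negP => xu.
have : x ^+ 2 \is a GRing.unit by rewrite unitrX.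
by apply/negP/two_max; exists y.
Qed.

(* The powers of a take finitely many values modulo 2. *)
Lemma power_period (a : A) :
  exists m r, (0 < r)%N /\ exists b, a ^+ m * (1 - a ^+ r) = 2%:R * b.
Proof.
have [p pm pa] := j_integral a; set d := (size p).-1.
have dE : size p = d.+1 by rewrite prednK// lt0n size_poly_eq0 monic_neq0.
(* The remainder of X^m by the monic p has degree below d, and its coefficients in Z2 are 0 or 1
   modulo 2, so the residue of a ^ m is given by a 0-1 vector of length d. *)
have repr m : exists f : {ffun 'I_d -> bool},
    even (a ^+ m - \sum_(i < d) (f i)%:R * a ^+ i).
  pose r := Pdiv.Ring.rmodp 'X^m p.
  have rE : 'X^m = Pdiv.Ring.rdivp 'X^m p * p + r by exact: Pdiv.RingMonic.rdivp_eq.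
  have szr : (size r <= d)%N.
    by rewrite -ltnS -dE Pdiv.Ring.ltn_rmodp monic_neq0.
  have := Z2_mod2; move/choice => [h hE].
  exists [ffun i : 'I_d => r`_i != 2%:R * h r`_i].
  have -> : a ^+ m = \sum_(i < d) j r`_i * a ^+ i.
    have /(congr1 (fun u => (map_poly j u).[a])) := rE.
    rewrite rmorphXn /= map_polyX hornerXn rmorphD rmorphM /= hornerD hornerM.
    move/eqP: (pa) => ->; rewrite mulr0 add0r => ->.
    rewrite (@horner_coef_wide _ d); last exact: leq_trans (size_poly _ _) szr.
    by apply: eq_bigr => i _; rewrite coef_map.
  rewrite -sumrB; apply: (big_ind even) => [||i _].
  - by exists 0; rewrite mulr0.
  - exact: evenD.
  rewrite ffunE -mulrBl mulrC; apply: evenM.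
  exists (j (h r`_i)); case: eqVneq => [e|ne].
    by rewrite subr0 {1}e rmorphM rmorph_nat.
  have [e|e] := hE r`_i; first by rewrite -e eqxx in ne.
  by rewrite {1}e rmorphD rmorphM rmorph1 rmorph_nat addrC addKr.
have /choice[f fE] := repr.
have [m [m' [lt_mm' e]]] : exists m m', (m < m')%N /\ f m = f m'.
  pose N := #|{ffun 'I_d -> bool}|.
  have : ~~ injectiveb (fun m : 'I_N.+1 => f m).
    by apply/negP => /injectiveP/leq_card; rewrite card_ord ltnn.
  case/injectivePn => x [y nxy e].
  have [lt|lt|/val_inj e'] := ltngtP x y; last by rewrite e' eqxx in nxy.
    by exists x, y.
  by exists y, x.
exists m, (m' - m)%N; rewrite subn_gt0; split=> //.
rewrite -/(even _) mulrBr mulr1 -exprD subnKC ?(ltnW lt_mm')//.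
have := evenD (fE m) (evenM (-1) (fE m')); rewrite e.
set s := \sum_(i < d) _; congr even; ring.
Qed.

(* A unit a has finite multiplicative order modulo 2, which is odd as A / 2 A is
   reduced; hence a is a power of a ^ 2. *)
Lemma integral_two_sqrt (a : A) : exists b c, a = b ^+ 2 + 2%:R * c.
Proof.
have [au|/two_max[c ->]] := boolP (a \is a GRing.unit); last first.
  by exists 0, c; rewrite expr0n add0r.
have [m [r [r_gt0 [c cE]]]] := power_period a.
have {cE} : even (1 - a ^+ r).
  by exists (a ^- m * c); rewrite mulrCA -cE mulKr// unitrX.
elim/ltn_ind: r r_gt0 {m c} => r IH r_gt0 er.
have [odd_r|/negbTE even_r] := boolP (odd r).
  (* For r odd, a is a ^ (r + 1) modulo 2, an even power. *)
  have [c cE] := er; exists (a ^+ (r.+1)./2), (a * c).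
  rewrite -exprM muln2 halfK /= odd_r subn0 mulrCA -cE exprS; ring.
have rE : r = (r./2 * 2)%N by rewrite muln2 -[LHS]odd_double_half even_r.
have aE : a ^+ r = (a ^+ r./2) ^+ 2 by rewrite -exprM -rE.
apply: (IH r./2); [by lia | by lia|].
(* Modulo 2, 1 - a ^ r is the square of 1 - a ^ (r / 2), so the latter is even as well. *)
have [c cE] := er; apply: (@dvr_reduced_mod2 _ (c + a ^+ r - a ^+ r./2)).
rewrite aE in cE *; move: (a ^+ r./2) cE => b cE.
transitivity ((1 - b ^+ 2) + 2%:R * (b ^+ 2 - b)); first by ring.
rewrite cE; ring.
Qed.

Lemma one_not_even (a : A) : 1 <> 2%:R * a.
Proof.
move=> e; have : (1 : A) \is a GRing.unit by exact: unitr1.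
by apply/negP/two_max; exists a.
Qed.

(** After removal of the factors X, the polynomial has a nonzero constant term, which a divides. *)
Lemma algebraic_dvd (a : A) (p : {poly Z2}) : a != 0 -> p != 0 ->
  root (map_poly j p) a -> exists c d, c != 0 /\ j c = a * d.
Proof.
move=> an0; elim/poly_ind: p => [|p c IH]; first by rewrite eqxx.
rewrite rmorphD rmorphM /= map_polyX map_polyC /= /root hornerD hornerM hornerX hornerC.
have [->|cn0] := eqVneq c 0; last first.
  move=> _ /eqP e; exists c, (- (map_poly j p).[a]); split=> //.
  by apply/eqP; rewrite mulrN -addr_eq0 mulrC addrC e.
rewrite !rmorph0 !addr0 !mulf_eq0 (negbTE an0) polyX_eq0 !orbF.
exact: IH.
Qed.

Hypothesis Z2_val : forall z : Z2, z != 0 ->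
  exists k z', z = 2%:R ^+ k * (1 + 2%:R * z').
Hypothesis two_neq0 : 2%:R != 0 :> A.

(** As a divides a nonzero element of Z2, of finite valuation k, it cannot be divisible by 2 ^ (k +
    1). *)
Lemma integral_two_val (a : A) : a != 0 ->
  exists k u, u \is a GRing.unit /\ a = 2%:R ^+ k * u.
Proof.
move=> an0; apply: contrapT => H.
have dvda k : exists b, a = 2%:R ^+ k * b.
  elim: k => [|k [b e]]; first by exists a; rewrite mul1r.
  have [bu|/two_max[b' e']] := boolP (b \is a GRing.unit); first by case: H; exists k, b.
  by exists b'; rewrite exprSr -mulrA -e'.
have [p pm pa] := j_integral a.
have [c [d [cn0 cd]]] := algebraic_dvd an0 (monic_neq0 pm) pa.
have [k [z cE]] := Z2_val cn0; have [b aE] := dvda k.+1.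
apply: (@one_not_even (b * d - j z)); apply: (mulfI (expf_neq0 k two_neq0)).
move: cd; rewrite cE aE !(rmorphM, rmorphXn, rmorphD, rmorph1, rmorph_nat) /=.
rewrite exprSr => e; rewrite mulr1 mulrBr mulrBr !mulrA -e; ring.
Qed.
End IntegralDvr.

Section RingOfIntegers.
Variables (Z2 : idomainType) (F : fieldExtType {fraction Z2}) (A : idomainType).
Variable iota : {rmorphism A -> F}.
Hypothesis HA : ring_of_integers iota.

Let to_F : {rmorphism Z2 -> F} := GRing.in_alg F \o @FracField.tofrac Z2.

Lemma integers_structure : exists j : {rmorphism Z2 -> A},
  injective j /\
  forall a, exists2 p : {poly Z2}, p \is monic & root (map_poly j p) a.
Proof.
have [iota_inj integralP] := HA.
have /choice[f fE] z : exists a, to_F z = iota a.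
  by apply/integralP; apply: (integral_id to_F).
have f_add : zmod_morphism f.
  by move=> x y; apply: iota_inj; rewrite rmorphB -!fE rmorphB.
have f_mul : monoid_morphism f.
  split=> [|x y]; apply: iota_inj; first by rewrite -fE !rmorph1.
  by rewrite rmorphM -!fE rmorphM.
pose fa := GRing.isZmodMorphism.Build Z2 A f f_add.
pose fm := GRing.isMonoidMorphism.Build Z2 A f f_mul.
pose j : {rmorphism Z2 -> A} := HB.pack f fa fm.
exists j; split=> [x y e|a].
  have e' : f x = f y := e.
  have /fmorph_inj : to_F x = to_F y by rewrite !fE e'.
  by move/eqP; rewrite tofrac_eq => /eqP.
have /integralP[p pm pa] : exists b, iota a = iota b by exists a.
exists p => //; apply/eqP/iota_inj; rewrite rmorph0 -horner_map -map_poly_comp.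
by rewrite -[RHS](eqP pa); congr _.[_]; apply: eq_map_poly => z; symmetry; apply: fE.
Qed.

End RingOfIntegers.

(** For c in E the power of 2 in [coef] has positive exponent by [theta_diag]; for the other c the
    entry V c c is even. *)
Lemma half_coef_exists (A : idomainType) n (w : 'I_n -> nat) (E : {set 'I_n}) (V : 'M[A]_n) :
  (forall c, dvd2 1 (V c c - (c \in E)%:R)) ->
  exists hV : 'M[A]_n, forall a c, 2%:R * hV a c = coef w E V a c c a.
Proof.
move=> Vd.
have /choice[h hE] : forall ac : 'I_n * 'I_n, exists x : A,
    2%:R * x = coef w E V ac.1 ac.2 ac.2 ac.1.
  move=> [a c] /=; rewrite /coef; have [cE|cE] := boolP (c \in E).
    have := @theta_diag n w E a c cE; set t := (_ - _)%N => lt.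
    have -> : t = t.-1.+1 by rewrite prednK// /t; lia.
    by exists (2%:R ^+ t.-1 * V c c); rewrite exprS mulrA.
  have [v] := Vd c; rewrite (negbTE cE) subr0 expr1 => ->.
  by eexists; rewrite mulrCA.
by exists (\matrix_(a, c) h (a, c)) => a c; rewrite mxE hE.
Qed.

Lemma nondegenerate_det (F : fieldType) (A : idomainType) (iota : {rmorphism A -> F})
    n (q : 'cV[A]_n -> A) (B : 'M[A]_n) :
  nondegenerate_form iota q -> gram iota q = map_mx iota B -> \det B != 0.
Proof.
move=> nd gramE; apply/eqP => B0.
have /det0P[v vn0 vB] : \det (gram iota q) == 0 by rewrite gramE det_map_mx B0 rmorph0.
move: vn0; rewrite -(inj_eq trmx_inj) trmx0 => /eqP[]; apply: nd => y.
by rewrite /bform trmxK vB mul0mx mxE.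
Qed.
Theorem theorem3p7
    (Z2 : idomainType) (res : forall k : nat, {rmorphism Z2 -> 'Z_(2 ^ k.+1)%N})
    (HZ2 : dyadic_integers res)
    (F : fieldExtType {fraction Z2})
    (A : idomainType) (iota : {rmorphism A -> F})
    (HA : ring_of_integers iota) (Hunram : unramified2 A)
    (n : nat) (q : 'cV[A]_n -> A) (Hq : quadratic_form q)
    (Hnondeg : nondegenerate_form iota q) (Hint : integral_form iota q) :
  inhabited (stabilizer_scheme iota q) /\
  forall G : stabilizer_scheme iota q,
    smooth (AG G) /\
    forall R : algebra A, etale R -> stabilizer_pts G R = isometries q R.
Proof.
have [j [j_inj j_integral]] := integers_structure HA.
have two_neq0 : 2%:R != 0 :> A.
  by rewrite -(rmorph_nat j) -(rmorph0 j) (inj_eq j_inj) (dyadic_two_neq0 res).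
have two_val := integral_two_val j_integral Hunram (dyadic_valuation HZ2) two_neq0.
have two_sqrt := integral_two_sqrt (dyadic_mod2 HZ2) j_integral Hunram.
have iota_inj : injective iota by case: HA.
have tf : torsion_free A.
  by move=> x /eqP; rewrite mulf_eq0 (negbTE two_neq0) => /eqP.
have red := dvr_reduced_mod2 Hunram.
have [B [gramE Bs qB polB]] := gram_exists iota_inj tf Hq Hint.
have [g [w [U [E [gu Uu gB [Usym Ublock Ew Udiag]]]]]] :=
  adapted_exists two_neq0 two_val Hunram two_sqrt Bs (nondegenerate_det Hnondeg gramE).
have UV := mulmxV Uu; have VU := mulVmx Uu.
have [hV hVE] := half_coef_exists w (Vdiag Usym UV Udiag).
split.
  exact: (stabilizer_exists two_neq0 two_val iota_inj tf red gramE Bs qB polB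
    gu gB Usym Ublock UV VU Ew Udiag hVE).
move=> G; split.
  exact: (stabilizer_smooth two_neq0 two_val iota_inj tf red gramE Bs qB polB
    gu gB Usym Ublock UV VU Ew Udiag hVE).
move=> R; exact: (stabilizer_etale two_neq0 two_val two_sqrt iota_inj tf red gramE
  Bs qB polB gu gB Usym Ublock UV VU Ew Udiag).
Qed.
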